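(* Let $s>3/2$, $\kappa\ge 0$, $\alpha\in\mathbb{R}$ and $a=2$. Then for every initial condition $(u_0,\rho_0)\in C^\infty(\mathbb{S}^1)\times C^\infty(\mathbb{S}^1)$, the solution $(u,\rho)$, with $(u,\rho)(0)=(u_0,\rho_0)$, of the system $$m_t=\alpha u_x-2u_xm-um_x-\kappa\rho\rho_x,\quad m=Au,\qquad \rho_t=-u\rho_x-u_x\rho,\qquad \alpha_t=0,$$ where $A=(1-D^2)^s$, is smooth and exists globally in time, i.e. $$(u,\rho)\in C^\infty\big([0,\infty),\,C^\infty(\mathbb{S}^1)\oplus C^\infty(\mathbb{S}^1)\big),$$ meaning that the corresponding flow is geodesically complete.
   Context: $\mathbb{S}^1=\mathbb{R}/2\pi\mathbb{Z}$ is the circle, with the measure $dx$ normalised to total mass $1$, so that $e_k(x)=e^{ikx}$, $k\in\mathbb{Z}$, is an orthonormal basis of $L_2(\mathbb{S}^1)$. $D=d/dx$, and $A=(1-D^2)^s$ is the Fourier multiplier $A e_k=(1+k^2)^s e_k$. All functions are real valued. The unknowns $u=u(t,x)$, $\rho=\rho(t,x)$ are defined on a time interval times $\mathbb{S}^1$, subscripts $t,x$ denote partial derivatives, and $\alpha$ is a real constant. ''The solution'' means the unique non-extendable smooth solution $(u,\rho)\in C^\infty(J,C^\infty(\mathbb{S}^1)\oplus C^\infty(\mathbb{S}^1))$ with the given initial data at $t=0$, where $J\ni 0$ is its maximal time interval of existence; the existence and uniqueness of such a maximal solution (local well-posedness of the system in the smooth category) is taken as known. The assertion is that $[0,\infty)\subset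 J$. *)

(* Defs.v *)
From Stdlib Require Import Reals.
From Coquelicot Require Import Coquelicot.
Open Scope R_scope.

(* Functions on the circle R/2piZ are 2pi-periodic functions on R. *)
Definition smooth_circle (f : R -> R) : Prop :=
  (forall x, f (x + 2 * PI) = f x) /\
  (forall (n : nat) (x : R), ex_derive_n f n x).

(* e k x = exp (i k x). *)
Definition e (k : Z) (x : R) : C := (cos (IZR k * x), sin (IZR k * x)).

(* The L_2 inner product <f, e_k> for the measure of total mass 1. *)
Definition fourier_coef (f : R -> R) (k : Z) : C :=
  Cmult (RtoC (/ (2 * PI)))
    (RInt (V := C_R_CompleteNormedModule)
       (fun x => Cmult (RtoC (f x)) (Cconj (e k x))) 0 (2 * PI)).

(* Sum over all integers, pairing k with -k. *)
Definition ZSeries (c : Z -> R) : R :=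
  c 0%Z +
  Series (fun n => c (Z.of_nat (S n)) + c (Z.opp (Z.of_nat (S n)))).

(* A = (1 - D^2)^s, i.e. A f = sum_k (1 + k^2)^s <f, e_k> e_k.  For real f the
   terms k and -k are complex conjugate, so the sum is the sum of real parts. *)
Definition A (s : R) (f : R -> R) (x : R) : R :=
  ZSeries (fun k =>
    Re (Cmult (RtoC (Rpower (1 + IZR k ^ 2) s))
              (Cmult (fourier_coef f k) (e k x)))).

(* w is the derivative of the curve v at t, relative to J, in the Frechet space
   C^oo(S^1), whose seminorms are the sup norms of the x-derivatives. *)
Definition is_curve_derive (J : R -> Prop) (v : R -> R -> R) (t : R)
    (w : R -> R) : Prop :=
  forall (n : nat) (eps : R), 0 < eps ->
  exists delta : R, 0 < delta /\
    forall h x : R, h <> 0 -> Rabs h < delta -> J (t + h) ->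
      Rabs ((Derive_n (v (t + h)) n x - Derive_n (v t) n x) / h
            - Derive_n w n x) <= eps.

(* v is in C^oo(J, C^oo(S^1)); V j is the j-th time derivative.  Derivatives
   are one-sided at endpoints of J, and values of v outside J are irrelevant. *)
Definition smooth_curve (J : R -> Prop) (v : R -> R -> R) : Prop :=
  exists V : nat -> R -> R -> R,
    (forall t x, J t -> V 0%nat t x = v t x) /\
    (forall (j : nat) t, J t -> smooth_circle (V j t)) /\
    (forall (j : nat) t, J t -> is_curve_derive J (V j) t (V (S j) t)).

Definition open_interval_around_0 (J : R -> Prop) : Prop :=
  open J /\ J 0 /\
  (forall a b t, J a -> J b -> a <= t <= b -> J t).

Record is_solution (s kappa alpha : R) (u0 rho0 : R -> R)
    (J : R -> Prop) (u rho : R -> R -> R) : Prop := {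
  sol_interval : open_interval_around_0 J;
  sol_smooth_u : smooth_curve J u;
  sol_smooth_rho : smooth_curve J rho;
  sol_init_u : forall x, u 0 x = u0 x;
  sol_init_rho : forall x, rho 0 x = rho0 x;
  sol_momentum :
    let m := fun t => A s (u t) in
    forall t x, J t ->
      is_derive (fun tau => m tau x) t
        (alpha * Derive (u t) x
         - 2 * Derive (u t) x * m t x
         - u t x * Derive (m t) x
         - kappa * rho t x * Derive (rho t) x);
  sol_density :
    forall t x, J t ->
      is_derive (fun tau => rho tau x) t
        (- u t x * Derive (rho t) x - Derive (u t) x * rho t x)
}.

Definition is_maximal_solution (s kappa alpha : R) (u0 rho0 : R -> R)
    (J : R -> Prop) (u rho : R -> R -> R) : Prop :=
  is_solution s kappa alpha u0 rho0 J u rho /\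
  (forall J' u' rho',
     is_solution s kappa alpha u0 rho0 J' u' rho' ->
     (forall t, J t -> J' t) ->
     (forall t x, J t -> u' t x = u t x /\ rho' t x = rho t x) ->
     forall t, J' t -> J t).

Definition locally_well_posed (s kappa alpha : R) : Prop :=
  forall u0 rho0, smooth_circle u0 -> smooth_circle rho0 ->
  exists J u rho,
    is_maximal_solution s kappa alpha u0 rho0 J u rho /\
    (forall J' u' rho',
       is_maximal_solution s kappa alpha u0 rho0 J' u' rho' ->
       (forall t, J' t <-> J t) /\
       (forall t x, J t -> u' t x = u t x /\ rho' t x = rho t x)).

(* Main.v *)
Require Import Defs.
From Stdlib Require Import Reals Lra Lia ZArith FunctionalExtensionality Classical.
From Coquelicot Require Import Coquelicot.
Open Scope R_scope.

(** The system is the geodesic flow of the metric [<A u, u> + kappa <rho,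
    rho>], so this energy is conserved and bounds [u] in [H^s]. Since [3 / 2 <
    s], it bounds even the sum of [|k u_k|] over the Fourier coefficients
    [u_k] of [u]. For [r >= 0] consider the energy [E_r = <A^((s+r)/s) u, u> +
    kappa <A^(r/s) rho, rho>] of higher order, that is, with weights
    [(1+k^2)^(s+r)] and [(1+k^2)^r]. Its time derivative is a sum of products
    of three Fourier coefficients over frequencies with [j + l + n = 0]; the
    term with [alpha] drops out. After symmetrisation over the three
    frequencies the derivatives of highest order cancel: the symbol is
    essentially bounded by the smallest frequency times the square roots of
    the weights at the two large ones ([usymb_sym_bound], [rsymb_bound]). The
    factor with the smallest frequency is summable by the conserved energy,
    and Young's inequality gives [|E_r'| <= K (1 + E_0) E_r]
    ([energy_rate_bound]). By Gronwall every Sobolev norm of [u] stays bounded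
    on bounded time intervals. For [kappa = 0] the energy does not see [rho];
    but [rho] solves a linear transport equation with the smooth coefficient
    [u], which is estimated separately ([density_rate_bound]).

    If the maximal interval ended at a finite time [T], the solution would
    thus be bounded in [C^oo] for [0 <= t < T] ([flow_bounded]), hence so
    would its velocity, and it would have a limit in [C^oo] at [T]
    ([curve_limit]). The solution starting from this limit, which exists by
    local well-posedness, can be glued to the old one: the system is an
    ordinary differential equation [u_t = A^-1 (...)] with continuous right-
    hand side in [C^oo], so the one-sided velocities agree at [T]
    ([curve_glue]), and the glued curve is smooth in time by bootstrapping
    ([flow_Ck]). This contradicts maximality.

    Infinite sums over several indices are avoided: smooth functions are
    approximated by the partial sums of their Fourier series, uniformly
    ([psum_error]), so that the quadratic and trilinear expressions are limits
    of finite sums ([mean_A_self], [mean_triple]); all the symmetrisations and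
    bounds are carried out on these finite sums, uniformly in their length. *)

(** * Smooth functions on the circle *)

Lemma smooth_circle_ex_derive f x : smooth_circle f -> ex_derive f x.
Proof. intros [_ H]. exact (H 1%nat x). Qed.

Lemma smooth_circle_is_derive f x : smooth_circle f -> is_derive f x (Derive f x).
Proof. intros H. apply Derive_correct, smooth_circle_ex_derive, H. Qed.

Lemma smooth_circle_continuous f x : smooth_circle f -> continuous f x.
Proof. intros H. apply (ex_derive_continuous f). now apply smooth_circle_ex_derive. Qed.

Lemma Derive_n_Derive f n x : Derive_n (Derive f) n x = Derive_n f (S n) x.
Proof.
  change (Derive f) with (Derive_n f 1). rewrite Derive_n_comp.
  now replace (n + 1)%nat with (S n) by lia.
Qed.

Lemma smooth_circle_is_derive_n f n x :
  smooth_circle f -> is_derive (Derive_n f n) x (Derive_n f (S n) x).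
Proof. intros H. apply Derive_correct. exact (proj2 H (S n) x). Qed.

Lemma smooth_circle_Derive_n f m : smooth_circle f -> smooth_circle (Derive_n f m).
Proof.
  intros [Hp Hd]. split.
  - intros x. rewrite <- (Derive_n_comp_trans f m x (2 * PI)).
    apply Derive_n_ext. exact Hp.
  - intros [|n] x; [exact I|].
    apply (ex_derive_ext (Derive_n f (n + m))).
    + intros t. symmetry. apply Derive_n_comp.
    + exact (Hd (S (n + m)) x).
Qed.

Lemma smooth_circle_Derive f : smooth_circle f -> smooth_circle (Derive f).
Proof. exact (smooth_circle_Derive_n f 1). Qed.

Lemma ex_derive_n_S f n :
  (forall x, ex_derive f x) -> (forall x, ex_derive_n (Derive f) n x) ->
  forall x, ex_derive_n f (S n) x.
Proof.
  intros H1 Hn x. destruct n as [|n]; [apply H1|].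
  apply (ex_derive_ext (Derive_n (Derive f) n)).
  - intros t. apply Derive_n_Derive.
  - apply Hn.
Qed.

(** For functions whose derivatives are known in closed form, such as
    trigonometric series and uniform limits: they all follow by induction from
    one differentiation at each level. *)
Lemma Derive_n_tower (F : nat -> R -> R) :
  (forall n x, is_derive (F n) x (F (S n) x)) ->
  forall n x, ex_derive_n (F 0%nat) n x /\ Derive_n (F 0%nat) n x = F n x.
Proof.
  intros HF n x.
  assert (H : forall n x, Derive_n (F 0%nat) n x = F n x).
  { clear n x. induction n as [|n IH]; intros x; [reflexivity|].
    simpl. rewrite (Derive_ext _ (F n)) by (intros; apply IH).
    apply is_derive_unique, HF. }
  split; [|apply H]. destruct n as [|n]; [exact I|].
  apply (ex_derive_ext (F n)); [intros; symmetry; apply H|].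
  eexists. apply HF.
Qed.

Lemma smooth_circle_locally f n x :
  smooth_circle f ->
  locally x (fun y => forall k, (k <= n)%nat -> ex_derive_n f k y).
Proof. intros [_ H]. apply filter_forall. intros y k _. apply H. Qed.

Lemma smooth_circle_const a : smooth_circle (fun _ => a).
Proof.
  split; [reflexivity|]. intros n x.
  apply (Derive_n_tower (fun n _ => match n with O => a | S _ => 0 end)).
  intros [|m] y; apply @is_derive_const.
Qed.

Lemma smooth_circle_plus f g :
  smooth_circle f -> smooth_circle g -> smooth_circle (fun x => f x + g x).
Proof.
  intros Hf Hg. split.
  - intros x. now rewrite (proj1 Hf), (proj1 Hg).
  - intros n x. apply ex_derive_n_plus; now apply smooth_circle_locally.
Qed.

Lemma smooth_circle_scal a f :
  smooth_circle f -> smooth_circle (fun x => a * f x).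
Proof.
  intros Hf. split.
  - intros x. now rewrite (proj1 Hf).
  - intros n x. apply ex_derive_n_scal_l, Hf.
Qed.

Lemma smooth_circle_minus f g :
  smooth_circle f -> smooth_circle g -> smooth_circle (fun x => f x - g x).
Proof.
  intros Hf Hg. split.
  - intros x. now rewrite (proj1 Hf), (proj1 Hg).
  - intros n x. apply ex_derive_n_minus; now apply smooth_circle_locally.
Qed.

Lemma Derive_mult_fun f g :
  (forall x, ex_derive f x) -> (forall x, ex_derive g x) ->
  Derive (fun x => f x * g x) = (fun x => Derive f x * g x + f x * Derive g x).
Proof. intros Hf Hg. extensionality x. now apply Derive_mult. Qed.

Lemma smooth_circle_mult f g :
  smooth_circle f -> smooth_circle g -> smooth_circle (fun x => f x * g x).
Proof.
  intros Hf Hg. split.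
  - intros x. now rewrite (proj1 Hf), (proj1 Hg).
  - (* all orders up to n at once, since the derivative of the product is a
       sum and each of its terms must be differentiable to every lower order *)
    assert (H : forall n f g, smooth_circle f -> smooth_circle g ->
      forall k, (k <= n)%nat -> forall x, ex_derive_n (fun x => f x * g x) k x).
    { clear. induction n as [|n IH]; intros f g Hf Hg [|k] Hk x;
        try exact I; [lia|].
      apply ex_derive_n_S.
      - intros y. apply (ex_derive_mult f g); now apply smooth_circle_ex_derive.
      - intros y. rewrite Derive_mult_fun
          by (intros; now apply smooth_circle_ex_derive).
        apply ex_derive_n_plus; apply filter_forall; intros z i Hi;
          apply IH; auto using smooth_circle_Derive; lia. }
    intros n x. now apply (H n).
Qed.

Create HintDb smooth.
#[export] Hint Resolve smooth_circle_const smooth_circle_plus smooth_circle_minus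
  smooth_circle_scal smooth_circle_mult smooth_circle_Derive smooth_circle_Derive_n : smooth.

Lemma Derive_n_plus_smooth f g n x :
  smooth_circle f -> smooth_circle g ->
  Derive_n (fun x => f x + g x) n x = Derive_n f n x + Derive_n g n x.
Proof. intros. apply Derive_n_plus; now apply smooth_circle_locally. Qed.

Lemma Derive_n_minus_smooth f g n x :
  smooth_circle f -> smooth_circle g ->
  Derive_n (fun x => f x - g x) n x = Derive_n f n x - Derive_n g n x.
Proof. intros. apply Derive_n_minus; now apply smooth_circle_locally. Qed.

Lemma Derive_n_const a n x :
  Derive_n (fun _ => a) n x = match n with O => a | S _ => 0 end.
Proof.
  apply (Derive_n_tower (fun n _ => match n with O => a | S _ => 0 end)).
  intros [|m] y; apply @is_derive_const.
Qed.

Lemma periodic_nat (f : R -> R) n x :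
  (forall x, f (x + 2 * PI) = f x) -> f (x + INR n * (2 * PI)) = f x.
Proof.
  intros H. induction n as [|n IH]; [f_equal; simpl; ring|].
  rewrite S_INR, <- IH.
  replace (x + (INR n + 1) * (2 * PI)) with (x + INR n * (2 * PI) + 2 * PI) by ring.
  apply H.
Qed.

Lemma periodic_Z (f : R -> R) z x :
  (forall x, f (x + 2 * PI) = f x) -> f (x + IZR z * (2 * PI)) = f x.
Proof.
  intros H. destruct (Z_le_gt_dec 0 z) as [Hz|Hz].
  - rewrite <- (periodic_nat f (Z.to_nat z) x H).
    rewrite INR_IZR_INZ, Z2Nat.id by lia. reflexivity.
  - rewrite <- (periodic_nat f (Z.to_nat (- z)) (x + IZR z * (2 * PI)) H). f_equal.
    rewrite INR_IZR_INZ, Z2Nat.id, opp_IZR by lia. ring.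
Qed.

Lemma periodic_rep (f : R -> R) x :
  (forall x, f (x + 2 * PI) = f x) ->
  exists y, 0 <= y <= 2 * PI /\ f y = f x.
Proof.
  intros H. pose proof PI_RGT_0 as HPI.
  set (z := Int_part (x / (2 * PI))).
  destruct (base_Int_part (x / (2 * PI))) as [H1 H2]. fold z in H1, H2.
  exists (x - IZR z * (2 * PI)). split.
  - assert (E : x = x / (2 * PI) * (2 * PI)) by (field; lra).
    split; rewrite E at 1; nra.
  - rewrite <- (periodic_Z f z (x - _) H). f_equal. ring.
Qed.

(** The seminorms of the Frechet space of smooth functions, given by their upper
    bounds so that no supremum has to be formed. *)
Definition bnd (n : nat) (f : R -> R) (a : R) : Prop :=
  forall i x, (i <= n)%nat -> Rabs (Derive_n f i x) <= a.

Lemma bnd_le n m f a b : (n <= m)%nat -> a <= b -> bnd m f a -> bnd n f b.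
Proof. intros Hn Ha H i x Hi. apply Rle_trans with a; [apply H; lia|exact Ha]. Qed.

Lemma bnd_nonneg n f a : bnd n f a -> 0 <= a.
Proof.
  intros H. apply Rle_trans with (1 := Rabs_pos (Derive_n f 0 0)).
  apply H. lia.
Qed.

Lemma bnd_exists n f : smooth_circle f -> exists a, bnd n f a.
Proof.
  intros Hf. induction n as [|n [a Ha]].
  - destruct (bounded_continuity (V := R_NormedModule) f 0 (2 * PI)) as [M HM].
    { intros x _. now apply smooth_circle_continuous. }
    exists M. intros i x Hi. replace i with 0%nat by lia. simpl.
    destruct (periodic_rep f x (proj1 Hf)) as [y [Hy <-]].
    left. now apply HM.
  - pose proof (smooth_circle_Derive_n f (S n) Hf) as Hf'.
    destruct (bounded_continuity (V := R_NormedModule) (Derive_n f (S n)) 0 (2 * PI))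
      as [M HM].
    { intros x _. now apply smooth_circle_continuous. }
    exists (Rmax a M). intros i x Hi.
    destruct (Nat.eq_dec i (S n)) as [->|Hne].
    + destruct (periodic_rep _ x (proj1 Hf')) as [y [Hy <-]].
      apply Rle_trans with M; [left; now apply HM|apply Rmax_r].
    + apply Rle_trans with a; [apply Ha; lia|apply Rmax_l].
Qed.

Lemma bnd_plus n f g a b :
  smooth_circle f -> smooth_circle g ->
  bnd n f a -> bnd n g b -> bnd n (fun x => f x + g x) (a + b).
Proof.
  intros Hf Hg Ha Hb i x Hi. rewrite Derive_n_plus_smooth by assumption.
  apply Rle_trans with (1 := Rabs_triang _ _).
  specialize (Ha i x Hi). specialize (Hb i x Hi). lra.
Qed.

Lemma bnd_scal n c f a : bnd n f a -> bnd n (fun x => c * f x) (Rabs c * a).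
Proof.
  intros Ha i x Hi. rewrite Derive_n_scal_l, Rabs_mult.
  apply Rmult_le_compat_l; [apply Rabs_pos|now apply Ha].
Qed.

Lemma bnd_Derive n f a : bnd (S n) f a -> bnd n (Derive f) a.
Proof. intros H i x Hi. rewrite Derive_n_Derive. apply H. lia. Qed.

(** Induction on [n] with the product rule: each differentiation at most doubles
    the number of terms, hence the factor [2 ^ n]. *)
Lemma bnd_mult n f g a b :
  smooth_circle f -> smooth_circle g ->
  bnd n f a -> bnd n g b -> bnd n (fun x => f x * g x) (2 ^ n * (a * b)).
Proof.
  revert f g. induction n as [|n IH]; intros f g Hf Hg Ha Hb i x Hi.
  - replace i with 0%nat by lia. simpl. rewrite Rabs_mult, Rmult_1_l.
    apply Rmult_le_compat; try apply Rabs_pos.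
    + now apply (Ha 0%nat).
    + now apply (Hb 0%nat).
  - pose proof (bnd_nonneg _ _ _ Ha) as Ha0.
    pose proof (bnd_nonneg _ _ _ Hb) as Hb0.
    assert (Hab : 0 <= a * b) by now apply Rmult_le_pos.
    pose proof (pow_le 2 n ltac:(lra)) as H2.
    assert (0 <= 2 ^ n * (a * b)) by now apply Rmult_le_pos.
    destruct i as [|i].
    + apply Rle_trans with (2 ^ n * (a * b)); [|simpl; lra].
      apply (IH f g Hf Hg (bnd_le n (S n) _ _ a ltac:(lia) (Rle_refl _) Ha)
               (bnd_le n (S n) _ _ b ltac:(lia) (Rle_refl _) Hb)). lia.
    + rewrite <- Derive_n_Derive, Derive_mult_fun
        by (intros; now apply smooth_circle_ex_derive).
      rewrite Derive_n_plus_smooth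
        by (apply smooth_circle_mult; auto using smooth_circle_Derive).
      apply Rle_trans with (1 := Rabs_triang _ _).
      replace (2 ^ S n * (a * b))
        with (2 ^ n * (a * b) + 2 ^ n * (a * b)) by (simpl; ring).
      apply Rplus_le_compat.
      * apply (IH (Derive f) g); [now apply smooth_circle_Derive|exact Hg| | |lia].
        -- now apply bnd_Derive.
        -- exact (bnd_le n (S n) g b b ltac:(lia) (Rle_refl _) Hb).
      * apply (IH f (Derive g)); [exact Hf|now apply smooth_circle_Derive| | |lia].
        -- exact (bnd_le n (S n) f a a ltac:(lia) (Rle_refl _) Ha).
        -- now apply bnd_Derive.
Qed.

(** * Symmetric sums over the integers *)

(** The indices [k] and [-k] are paired as in [ZSeries], whose partial sums
    these are. *)
Fixpoint zsum (N : nat) (c : Z -> R) : R :=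
  match N with
  | O => c 0%Z
  | S n => zsum n c + (c (Z.of_nat (S n)) + c (Z.opp (Z.of_nat (S n))))
  end.

Lemma zsum_S N c :
  zsum (S N) c = zsum N c + (c (Z.of_nat (S N)) + c (Z.opp (Z.of_nat (S N)))).
Proof. reflexivity. Qed.

Lemma zsum_ext N c d : (forall k, c k = d k) -> zsum N c = zsum N d.
Proof.
  intros H. induction N as [|N IH]; cbn [zsum]; [apply H|]. now rewrite IH, !H.
Qed.

Lemma zsum_plus N c d : zsum N (fun k => c k + d k) = zsum N c + zsum N d.
Proof. induction N as [|N IH]; cbn [zsum]; [reflexivity|]. rewrite IH. ring. Qed.

Lemma zsum_scal N a c : zsum N (fun k => a * c k) = a * zsum N c.
Proof. induction N as [|N IH]; cbn [zsum]; [reflexivity|]. rewrite IH. ring. Qed.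

Lemma zsum_minus N c d : zsum N (fun k => c k - d k) = zsum N c - zsum N d.
Proof. induction N as [|N IH]; cbn [zsum]; [reflexivity|]. rewrite IH. ring. Qed.

Lemma zsum_zero N : zsum N (fun _ => 0) = 0.
Proof. induction N as [|N IH]; cbn [zsum]; [reflexivity|]. rewrite IH. ring. Qed.

Lemma zsum_le N c d : (forall k, c k <= d k) -> zsum N c <= zsum N d.
Proof.
  intros H. induction N as [|N IH]; cbn [zsum]; [apply H|].
  apply Rplus_le_compat; [exact IH|]. now apply Rplus_le_compat.
Qed.

Lemma zsum_abs N c : Rabs (zsum N c) <= zsum N (fun k => Rabs (c k)).
Proof.
  induction N as [|N IH]; cbn [zsum]; [apply Rle_refl|].
  apply Rle_trans with (1 := Rabs_triang _ _). apply Rplus_le_compat; [exact IH|].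
  apply Rabs_triang.
Qed.

Lemma zsum_nonneg N c : (forall k, 0 <= c k) -> 0 <= zsum N c.
Proof. intros H. rewrite <- (zsum_zero N). now apply zsum_le. Qed.

Lemma zsum_exchange N M (c : Z -> Z -> R) :
  zsum N (fun k => zsum M (c k)) = zsum M (fun l => zsum N (fun k => c k l)).
Proof.
  induction N as [|N IH]; cbn [zsum]; [reflexivity|].
  rewrite IH, !zsum_plus. reflexivity.
Qed.

Lemma zsum_opp_index N c : zsum N (fun k => c (- k)%Z) = zsum N c.
Proof.
  induction N as [|N IH]; cbn [zsum]; [reflexivity|].
  rewrite IH, Z.opp_involutive. ring.
Qed.

Lemma zsum_delta N m a :
  zsum N (fun k => if Z.eqb k m then a else 0)
  = if Z.leb (Z.abs m) (Z.of_nat N) then a else 0.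
Proof.
  induction N as [|N IH]; cbn [zsum].
  - destruct (Z.eqb_spec 0 m), (Z.leb_spec (Z.abs m) (Z.of_nat 0)); lia || reflexivity.
  - rewrite IH.
    destruct (Z.eqb_spec (Z.of_nat (S N)) m), (Z.eqb_spec (- Z.of_nat (S N)) m),
      (Z.leb_spec (Z.abs m) (Z.of_nat N)),
      (Z.leb_spec (Z.abs m) (Z.of_nat (S N))); lia || lra.
Qed.

Lemma zsum_delta_le N m a :
  0 <= a -> zsum N (fun k => if Z.eqb k m then a else 0) <= a.
Proof. intros H. rewrite zsum_delta. destruct (Z.leb _ _); lra. Qed.

Lemma zsum_incr N M c :
  (forall k, 0 <= c k) -> (N <= M)%nat -> zsum N c <= zsum M c.
Proof.
  intros H HNM. induction HNM as [|M _ IH]; [apply Rle_refl|]. cbn [zsum].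
  pose proof (H (Z.of_nat (S M))). pose proof (H (- Z.of_nat (S M))%Z). lra.
Qed.

Lemma zsum_term_le N c k :
  (forall k, 0 <= c k) -> (Z.abs k <= Z.of_nat N)%Z -> c k <= zsum N c.
Proof.
  intros H Hk.
  apply Rle_trans with (zsum N (fun l => if Z.eqb l k then c k else 0)).
  - rewrite zsum_delta, (proj2 (Z.leb_le _ _) Hk). apply Rle_refl.
  - apply zsum_le. intros l. destruct (Z.eqb_spec l k) as [->|]; [lra|apply H].
Qed.

(** The square of the bracket [<k>] in the definition of Sobolev norms. *)
Definition jap (k : Z) : R := 1 + IZR k ^ 2.

Lemma jap_ge_1 k : 1 <= jap k.
Proof. unfold jap. pose proof (pow2_ge_0 (IZR k)). lra. Qed.

Lemma jap_pos k : 0 < jap k.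
Proof. pose proof (jap_ge_1 k). lra. Qed.

Lemma jap_opp k : jap (- k) = jap k.
Proof. unfold jap. rewrite opp_IZR. ring. Qed.

Lemma abs_le_jap k : Rabs (IZR k) <= jap k.
Proof. unfold jap. apply Rabs_le. split; nra. Qed.

(** Domination by a multiple of [1 / (1 + k ^ 2)]; all the coefficients to come
    decrease fast enough for this single criterion of absolute convergence. *)
Definition summable (C : R) (c : Z -> R) : Prop :=
  forall k, jap k * Rabs (c k) <= C.

Lemma summable_nonneg C c : summable C c -> 0 <= C.
Proof.
  intros H. apply Rle_trans with (2 := H 0%Z).
  apply Rmult_le_pos; [left; apply jap_pos|apply Rabs_pos].
Qed.

(** The tails are compared with the telescoping series
    [1 / (n + 1) - 1 / (n + 2)]. *)
Lemma summable_cauchy C c n p :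
  summable C c ->
  Rabs (zsum (n + p) c - zsum n c)
    <= 4 * C * (/ (INR n + 1) - / (INR (n + p) + 1)).
Proof.
  intros H. pose proof (summable_nonneg _ _ H) as HC.
  induction p as [|p IH].
  - rewrite Nat.add_0_r, !Rminus_diag, Rabs_R0. lra.
  - replace (n + S p)%nat with (S (n + p)) by lia. cbn [zsum].
    set (m := (n + p)%nat) in *.
    set (a := c (Z.of_nat (S m))). set (b := c (- Z.of_nat (S m))%Z).
    replace (zsum m c + (a + b) - zsum n c)
      with ((zsum m c - zsum n c) + (a + b)) by ring.
    apply Rle_trans with (1 := Rabs_triang _ _).
    replace (4 * C * (/ (INR n + 1) - / (INR (S m) + 1)))
      with (4 * C * (/ (INR n + 1) - / (INR m + 1))
            + 4 * C * (/ (INR m + 1) - / (INR (S m) + 1))) by ring.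
    apply Rplus_le_compat; [exact IH|].
    pose proof (H (Z.of_nat (S m))) as Ha. fold a in Ha.
    pose proof (H (- Z.of_nat (S m))%Z) as Hb. fold b in Hb.
    rewrite jap_opp in Hb.
    assert (Hj : jap (Z.of_nat (S m)) = 1 + (INR m + 1) ^ 2).
    { unfold jap. now rewrite <- INR_IZR_INZ, S_INR. }
    rewrite Hj in Ha, Hb. rewrite S_INR.
    pose proof (pos_INR m) as Hm. set (x := INR m + 1) in *.
    apply Rle_trans with (1 := Rabs_triang a b).
    assert (Hab : (1 + x ^ 2) * (Rabs a + Rabs b) <= 2 * C) by lra.
    replace (4 * C * (/ x - / (x + 1))) with (4 * C / (x * (x + 1)))
      by (field; unfold x; lra).
    assert (Hx : 0 < x * (x + 1)) by (unfold x; nra).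
    apply Rmult_le_reg_l with (x * (x + 1)); [exact Hx|].
    replace (x * (x + 1) * (4 * C / (x * (x + 1)))) with (4 * C) by (field; unfold x; lra).
    pose proof (Rabs_pos a). pose proof (Rabs_pos b).
    apply Rle_trans with (2 * ((1 + x ^ 2) * (Rabs a + Rabs b))); [|lra].
    rewrite <- Rmult_assoc. apply Rmult_le_compat_r; [lra|]. nra.
Qed.

Lemma zsum_sum_n N c :
  zsum (S N) c
  = c 0%Z + sum_n (fun n => c (Z.of_nat (S n)) + c (Z.opp (Z.of_nat (S n)))) N.
Proof.
  induction N as [|N IH].
  - rewrite sum_O. reflexivity.
  - rewrite sum_Sn. change plus with Rplus.
    rewrite <- Rplus_assoc, <- IH. reflexivity.
Qed.

Lemma is_lim_zsum C c :
  summable C c -> is_lim_seq (fun N => zsum N c) (ZSeries c).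
Proof.
  intros H.
  assert (E : ex_finite_lim_seq (fun N => zsum N c)).
  { apply ex_lim_seq_cauchy_corr. intros eps.
    destruct (nfloor_ex (4 * C / eps)) as [N0 HN0].
    { apply Rmult_le_pos; [pose proof (summable_nonneg _ _ H); lra|].
      left. apply Rinv_0_lt_compat, cond_pos. }
    assert (A : forall n p, (N0 <= n)%nat ->
      Rabs (zsum (n + p) c - zsum n c) < eps).
    { intros n p Hn. apply Rle_lt_trans with (1 := summable_cauchy C c n p H).
      pose proof (pos_INR n) as Hn0. apply le_INR in Hn.
      assert (Hp : 0 < / (INR (n + p) + 1))
        by (apply Rinv_0_lt_compat; pose proof (pos_INR (n + p)); lra).
      apply Rle_lt_trans with (4 * C * / (INR n + 1)).
      { apply Rmult_le_compat_l; [pose proof (summable_nonneg _ _ H)|]; lra. }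
      apply Rmult_lt_reg_r with (INR n + 1); [lra|].
      rewrite Rmult_assoc, Rinv_l by lra.
      pose proof (cond_pos eps) as Heps.
      assert (4 * C / eps < INR n + 1) by lra.
      apply Rmult_lt_compat_r with (r := eps) in H0; [|lra].
      unfold Rdiv in H0. rewrite Rmult_assoc, Rinv_l in H0 by lra. lra. }
    exists N0. intros n m Hn Hm.
    destruct (Nat.le_ge_cases n m) as [Hnm|Hnm].
    - replace m with (n + (m - n))%nat by lia. rewrite Rabs_minus_sym. now apply A.
    - replace n with (m + (n - m))%nat by lia. now apply A. }
  destruct E as [l Hl].
  replace (ZSeries c) with l; [exact Hl|]. unfold ZSeries.
  apply is_lim_seq_incr_1 in Hl.
  rewrite (is_series_unique _ (l - c 0%Z)); [ring|].
  assert (L : is_lim_seq (fun N => zsum (S N) c - c 0%Z) (l - c 0%Z)).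
  { apply is_lim_seq_minus' with (1 := Hl). apply is_lim_seq_const. }
  apply is_lim_seq_ext with (2 := L). intros N. rewrite zsum_sum_n.
  apply Rplus_minus_l.
Qed.

Lemma ZSeries_tail C c n :
  summable C c -> Rabs (ZSeries c - zsum n c) <= 4 * C / (INR n + 1).
Proof.
  intros H. pose proof (is_lim_zsum _ _ H) as L.
  apply (is_lim_seq_incr_n _ n) in L.
  assert (L' : is_lim_seq (fun p => Rabs (zsum (p + n) c - zsum n c))
    (Rabs (ZSeries c - zsum n c))).
  { apply (is_lim_seq_abs _ (Finite (ZSeries c - zsum n c))).
    apply is_lim_seq_minus' with (1 := L). apply is_lim_seq_const. }
  apply (is_lim_seq_le _ (fun _ => 4 * C / (INR n + 1)) _ _) with (2 := L')
    (3 := is_lim_seq_const _).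
  intros p. rewrite Nat.add_comm.
  apply Rle_trans with (1 := summable_cauchy C c n p H).
  apply Rmult_le_compat_l; [pose proof (summable_nonneg _ _ H); lra|].
  assert (0 < / (INR (n + p) + 1))
    by (apply Rinv_0_lt_compat; pose proof (pos_INR (n + p)); lra). lra.
Qed.

Lemma ZSeries_bound C c : summable C c -> Rabs (ZSeries c) <= 5 * C.
Proof.
  intros H. pose proof (ZSeries_tail C c 0 H) as H1. simpl in H1.
  pose proof (H 0%Z) as H0. pose proof (jap_ge_1 0). pose proof (Rabs_pos (c 0%Z)).
  replace (ZSeries c) with ((ZSeries c - c 0%Z) + c 0%Z) by ring.
  apply Rle_trans with (1 := Rabs_triang _ _).
  replace (4 * C / (0 + 1)) with (4 * C) in H1 by field.
  assert (Rabs (c 0%Z) <= C) by nra. lra.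
Qed.

(** * Means and Fourier coefficients *)

Definition mean (f : R -> R) : R := / (2 * PI) * RInt f 0 (2 * PI).

Lemma two_PI_pos : 0 < 2 * PI.
Proof. pose proof PI_RGT_0. lra. Qed.

Lemma ex_RInt_cont (f : R -> R) a b : (forall x, continuous f x) -> ex_RInt f a b.
Proof. intros H. apply (ex_RInt_continuous (V := R_CompleteNormedModule) f).
  intros x _. apply H. Qed.

Lemma ex_RInt_smooth f a b : smooth_circle f -> ex_RInt f a b.
Proof. intros Hf. apply ex_RInt_cont. intros x. now apply smooth_circle_continuous. Qed.

Lemma mean_plus f g :
  smooth_circle f -> smooth_circle g -> mean (fun x => f x + g x) = mean f + mean g.
Proof.
  intros Hf Hg. unfold mean.
  assert (E : RInt (fun x => f x + g x) 0 (2 * PI)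
              = RInt f 0 (2 * PI) + RInt g 0 (2 * PI))
    by (apply (RInt_plus f g); now apply ex_RInt_smooth).
  rewrite E. ring.
Qed.

Lemma mean_scal a f : smooth_circle f -> mean (fun x => a * f x) = a * mean f.
Proof.
  intros Hf. unfold mean.
  assert (E : RInt (fun x => a * f x) 0 (2 * PI) = a * RInt f 0 (2 * PI))
    by (apply (RInt_scal f); now apply ex_RInt_smooth).
  rewrite E. ring.
Qed.

Lemma mean_minus f g :
  smooth_circle f -> smooth_circle g -> mean (fun x => f x - g x) = mean f - mean g.
Proof.
  intros Hf Hg. transitivity (mean (fun x => f x + -1 * g x)).
  - f_equal. extensionality x. ring.
  - rewrite mean_plus, mean_scal by auto with smooth. ring.
Qed.

Lemma mean_const a : mean (fun _ => a) = a.
Proof.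
  unfold mean. rewrite RInt_const. change scal with Rmult.
  pose proof two_PI_pos. field. lra.
Qed.

Lemma mean_abs_le f M :
  smooth_circle f -> (forall x, Rabs (f x) <= M) -> Rabs (mean f) <= M.
Proof.
  intros Hf HM. unfold mean. pose proof two_PI_pos as H.
  rewrite Rabs_mult, Rabs_right by (left; now apply Rinv_0_lt_compat).
  apply Rmult_le_reg_l with (2 * PI); [exact H|].
  rewrite <- Rmult_assoc, Rinv_r, Rmult_1_l by lra.
  replace (2 * PI * M) with ((2 * PI - 0) * M) by ring.
  apply abs_RInt_le_const; [lra|now apply ex_RInt_smooth|]. intros; apply HM.
Qed.

Lemma smooth_circle_zsum N (F : Z -> R -> R) :
  (forall k, smooth_circle (F k)) -> smooth_circle (fun x => zsum N (fun k => F k x)).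
Proof.
  intros H. induction N as [|N IH]; cbn [zsum]; [apply H|].
  apply (smooth_circle_plus (fun x => zsum N (fun k => F k x))); auto with smooth.
Qed.

#[export] Hint Resolve smooth_circle_zsum : smooth.

Lemma mean_zsum N (F : Z -> R -> R) :
  (forall k, smooth_circle (F k)) ->
  mean (fun x => zsum N (fun k => F k x)) = zsum N (fun k => mean (F k)).
Proof.
  intros H. induction N as [|N IH]; cbn [zsum]; [reflexivity|].
  rewrite <- IH, <- mean_plus by apply H.
  apply (mean_plus (fun x => zsum N (fun k => F k x))); auto with smooth.
Qed.

Lemma is_lim_mean (F : nat -> R -> R) f (eps : nat -> R) :
  (forall N, smooth_circle (F N)) -> smooth_circle f ->
  (forall N x, Rabs (F N x - f x) <= eps N) -> is_lim_seq eps 0 ->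
  is_lim_seq (fun N => mean (F N)) (mean f).
Proof.
  intros HF Hf He Hl.
  assert (L : is_lim_seq (fun N => mean (F N) - mean f) 0).
  { apply is_lim_seq_abs_0.
    apply is_lim_seq_le_le with (u := fun _ => 0) (w := eps);
      [|apply is_lim_seq_const|exact Hl].
    intros N. split; [apply Rabs_pos|]. rewrite <- mean_minus by auto.
    apply mean_abs_le; auto with smooth. }
  assert (L' : is_lim_seq (fun N => mean (F N) - mean f + mean f) (0 + mean f))
    by (apply is_lim_seq_plus' with (1 := L); apply is_lim_seq_const).
  rewrite Rplus_0_l in L'. apply is_lim_seq_ext with (2 := L'). intros; ring.
Qed.

Lemma mean_Derive f : smooth_circle f -> mean (Derive f) = 0.
Proof.
  intros Hf. unfold mean.
  rewrite (is_RInt_unique (Derive f) 0 (2 * PI) (minus (f (2 * PI)) (f 0))).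
  - rewrite <- (proj1 Hf 0), Rplus_0_l. unfold minus, plus, opp; simpl. ring.
  - apply (is_RInt_derive (V := R_CompleteNormedModule) f); intros x _.
    + now apply smooth_circle_is_derive.
    + apply smooth_circle_continuous. now apply smooth_circle_Derive.
Qed.

Lemma cos_2PI_Z k x : cos (IZR k * (x + 2 * PI)) = cos (IZR k * x).
Proof.
  rewrite Rmult_plus_distr_l. apply (periodic_Z cos).
  intros y. rewrite cos_plus, cos_2PI, sin_2PI. ring.
Qed.

Lemma sin_2PI_Z k x : sin (IZR k * (x + 2 * PI)) = sin (IZR k * x).
Proof.
  rewrite Rmult_plus_distr_l. apply (periodic_Z sin).
  intros y. rewrite sin_plus, cos_2PI, sin_2PI. ring.
Qed.

Lemma smooth_circle_trig k p :
  smooth_circle (fun x => cos (IZR k * x + p * (PI / 2))).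
Proof.
  split.
  - intros x. rewrite !cos_plus. now rewrite cos_2PI_Z, sin_2PI_Z.
  - intros n x.
    destruct (Derive_n_tower
      (fun n x => IZR k ^ n * cos (IZR k * x + (p + INR n) * (PI / 2)))) with n x
      as [H _].
    + intros m y. rewrite S_INR.
      replace ((p + (INR m + 1)) * (PI / 2)) with ((p + INR m) * (PI / 2) + PI / 2) by field.
      rewrite <- Rplus_assoc, (cos_plus (_ + _) (PI / 2)), cos_PI2, sin_PI2.
      auto_derive; [exact I|]. simpl. ring.
    + apply ex_derive_n_ext with (2 := H). intros t. simpl. rewrite Rplus_0_r. ring.
Qed.

Lemma smooth_circle_cos k : smooth_circle (fun x => cos (IZR k * x)).
Proof.
  replace (fun x => cos (IZR k * x)) with (fun x => cos (IZR k * x + 0 * (PI / 2))).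
  - apply smooth_circle_trig.
  - extensionality x. f_equal. ring.
Qed.

Lemma smooth_circle_sin k : smooth_circle (fun x => sin (IZR k * x)).
Proof.
  replace (fun x => sin (IZR k * x)) with (fun x => cos (IZR k * x + 3 * (PI / 2))).
  - apply smooth_circle_trig.
  - extensionality x.
    rewrite cos_plus, cos_3PI2, sin_3PI2. ring.
Qed.

#[export] Hint Resolve smooth_circle_cos smooth_circle_sin : smooth.

Lemma fourier_coef_smooth f k :
  smooth_circle f ->
  fourier_coef f k
  = (mean (fun x => f x * cos (IZR k * x)), - mean (fun x => f x * sin (IZR k * x))).
Proof.
  intros Hf. unfold fourier_coef.
  rewrite (is_RInt_unique (V := C_R_CompleteNormedModule) _ 0 (2 * PI)
    (RInt (fun x => f x * cos (IZR k * x)) 0 (2 * PI),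
     - RInt (fun x => f x * sin (IZR k * x)) 0 (2 * PI))).
  - unfold mean, Cmult, RtoC. simpl. f_equal; ring.
  - apply (is_RInt_fct_extend_pair (U := R_NormedModule) (V := R_NormedModule)).
    + apply (is_RInt_ext (fun x => f x * cos (IZR k * x))).
      * intros x _. simpl. ring.
      * apply (RInt_correct (V := R_CompleteNormedModule)), ex_RInt_smooth.
        auto with smooth.
    + apply (is_RInt_ext (fun x => opp (f x * sin (IZR k * x)))).
      * intros x _. unfold opp; simpl. ring.
      * apply (is_RInt_opp (V := R_NormedModule)).
        apply (RInt_correct (V := R_CompleteNormedModule)), ex_RInt_smooth.
        auto with smooth.
Qed.

(** * The Dirichlet kernel *)

Definition dirichlet (N : nat) (y : R) : R := zsum N (fun k => cos (IZR k * y)).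

Lemma dirichlet_smooth N : smooth_circle (dirichlet N).
Proof.
  apply (smooth_circle_zsum N (fun k x => cos (IZR k * x))). auto with smooth.
Qed.

#[export] Hint Resolve dirichlet_smooth : smooth.

Lemma dirichlet_opp N y : dirichlet N (- y) = dirichlet N y.
Proof.
  apply zsum_ext. intros k. rewrite <- cos_neg. f_equal. ring.
Qed.

Lemma dirichlet_sin N y :
  dirichlet N y * sin (y / 2) = sin ((INR N + / 2) * y).
Proof.
  unfold dirichlet. induction N as [|N IH]; cbn [zsum].
  - rewrite Rmult_0_l, cos_0, Rmult_1_l. f_equal. simpl. field.
  - rewrite Rmult_plus_distr_r, IH, opp_IZR, <- INR_IZR_INZ, S_INR.
    replace (- (INR N + 1) * y) with (- ((INR N + 1) * y)) by ring.
    rewrite cos_neg.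
    replace ((INR N + / 2) * y) with ((INR N + 1) * y - y / 2) by field.
    replace ((INR N + 1 + / 2) * y) with ((INR N + 1) * y + y / 2) by field.
    rewrite sin_plus, sin_minus. ring.
Qed.

Lemma mean_cos k : mean (fun x => cos (IZR k * x)) = if Z.eqb k 0 then 1 else 0.
Proof.
  destruct (Z.eqb_spec k 0) as [->|Hk].
  - replace (fun x => cos (0 * x)) with (fun _ : R => 1); [apply mean_const|].
    extensionality x. now rewrite Rmult_0_l, cos_0.
  - assert (Hk' : IZR k <> 0) by now apply not_0_IZR.
    replace (fun x => cos (IZR k * x))
      with (fun x => / IZR k * Derive (fun x => sin (IZR k * x)) x).
    + rewrite mean_scal, mean_Derive by auto with smooth. ring.
    + extensionality x.
      rewrite (is_derive_unique _ x (IZR k * cos (IZR k * x)))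
        by (auto_derive; [exact I|ring]). now field.
Qed.

Lemma mean_sin k : mean (fun x => sin (IZR k * x)) = 0.
Proof.
  destruct (Z.eqb_spec k 0) as [->|Hk].
  - replace (fun x => sin (0 * x)) with (fun _ : R => 0); [apply mean_const|].
    extensionality x. now rewrite Rmult_0_l, sin_0.
  - assert (Hk' : IZR k <> 0) by now apply not_0_IZR.
    replace (fun x => sin (IZR k * x))
      with (fun x => - / IZR k * Derive (fun x => cos (IZR k * x)) x).
    + rewrite mean_scal, mean_Derive by auto with smooth. ring.
    + extensionality x.
      rewrite (is_derive_unique _ x (- IZR k * sin (IZR k * x)))
        by (auto_derive; [exact I|ring]). now field.
Qed.

Lemma mean_dirichlet N : mean (dirichlet N) = 1.
Proof.
  unfold dirichlet. rewrite mean_zsum.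
  - rewrite (zsum_ext N _ (fun k => if Z.eqb k 0 then 1 else 0))
      by (intros; apply mean_cos).
    rewrite zsum_delta. now rewrite (proj2 (Z.leb_le _ _)) by lia.
  - auto with smooth.
Qed.

Lemma smooth_circle_shift f a : smooth_circle f -> smooth_circle (fun x => f (x + a)).
Proof.
  intros Hf. split; [intros x|intros n x].
  - rewrite <- (proj1 Hf (x + a)). f_equal. ring.
  - apply ex_derive_n_comp_trans, Hf.
Qed.

Lemma smooth_circle_reflect f : smooth_circle f -> smooth_circle (fun x => f (- x)).
Proof.
  intros Hf. split; [intros x|intros n x].
  - rewrite <- (proj1 Hf (- (x + 2 * PI))). f_equal. ring.
  - apply ex_derive_n_comp_opp. now apply smooth_circle_locally.
Qed.

#[export] Hint Resolve smooth_circle_shift : smooth.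

Lemma mean_shift f a :
  smooth_circle f -> mean (fun x => f (x + a)) = mean f.
Proof.
  intros Hf. pose proof (fun a b => ex_RInt_smooth f a b Hf) as Hi.
  unfold mean. f_equal.
  assert (S : forall b c d, RInt (fun x => f (x + b)) c d = RInt f (c + b) (d + b)).
  { intros b c d.
    pose proof (RInt_comp_lin (V := R_CompleteNormedModule) f 1 b c d
      (Hi _ _)) as H.
    rewrite !Rmult_1_l in H. rewrite <- H. apply RInt_ext. intros x _.
    change scal with Rmult. rewrite !Rmult_1_l. reflexivity. }
  rewrite S, Rplus_0_l.
  pose proof (RInt_Chasles (V := R_CompleteNormedModule) f 0 a (2 * PI + a)
    (Hi _ _) (Hi _ _)) as H1.
  pose proof (RInt_Chasles (V := R_CompleteNormedModule) f 0 (2 * PI) (2 * PI + a)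
    (Hi _ _) (Hi _ _)) as H2.
  assert (H3 : RInt f (2 * PI) (2 * PI + a) = RInt f 0 a).
  { pose proof (S (2 * PI) 0 a) as H3. rewrite Rplus_0_l, (Rplus_comm a) in H3.
    rewrite <- H3. apply RInt_ext. intros x _. apply Hf. }
  rewrite H3 in H2. rewrite <- H2 in H1.
  change plus with Rplus in H1.
  apply Rplus_eq_reg_l with (RInt f 0 a). rewrite H1. apply Rplus_comm.
Qed.

(** Brings the singularity of the conjugate kernel [1 / sin (y / 2)] to the left
    end of the interval of integration and makes the even part of [f] appear. *)
Lemma mean_fold f :
  smooth_circle f -> mean f = / (2 * PI) * RInt (fun x => f x + f (- x)) 0 PI.
Proof.
  intros Hf. pose proof (fun a b => ex_RInt_smooth f a b Hf) as Hi.
  pose proof (smooth_circle_reflect f Hf) as Hf'.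
  pose proof (fun a b => ex_RInt_smooth _ a b Hf') as Hi'.
  unfold mean. f_equal.
  rewrite (RInt_plus (V := R_CompleteNormedModule) f (fun x => f (- x)))
    by auto.
  rewrite <- (RInt_Chasles (V := R_CompleteNormedModule) f 0 PI (2 * PI))
    by auto.
  f_equal.
  pose proof (RInt_comp_lin (V := R_CompleteNormedModule) f (-1) (2 * PI) 0 PI
    (Hi _ _)) as H.
  replace (-1 * 0 + 2 * PI) with (2 * PI) in H by ring.
  replace (-1 * PI + 2 * PI) with PI in H by ring.
  rewrite <- opp_RInt_swap, <- H by auto.
  rewrite (RInt_ext _ (fun y => opp (f (- y)))).
  - rewrite (RInt_opp (V := R_CompleteNormedModule) (fun y => f (- y)))
      by auto.
    apply (opp_opp (G := R_AbelianGroup)).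
  - intros x _. change (-1 * f (-1 * x + 2 * PI) = - f (- x)).
    replace (-1 * x + 2 * PI) with (- x + 2 * PI) by ring. rewrite (proj1 Hf). ring.
Qed.

Definition psum (N : nat) (f : R -> R) (x : R) : R :=
  zsum N (fun k => Re (fourier_coef f k * e k x)%C).

Lemma psum_dirichlet N f x :
  smooth_circle f -> psum N f x = mean (fun y => f (y + x) * dirichlet N y).
Proof.
  intros Hf.
  assert (Hd : forall k y, f y * cos (IZR k * (y + - x))
    = cos (IZR k * x) * (f y * cos (IZR k * y)) + sin (IZR k * x) * (f y * sin (IZR k * y))).
  { intros k y. replace (IZR k * (y + - x)) with (IZR k * y - IZR k * x) by ring.
    rewrite cos_minus. ring. }
  transitivity (mean (fun y => f y * dirichlet N (y + - x))).
  - unfold psum.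
    transitivity (zsum N (fun k => mean (fun y => f y * cos (IZR k * (y + - x))))).
    + apply zsum_ext. intros k. rewrite fourier_coef_smooth by exact Hf.
      replace (fun y => f y * cos (IZR k * (y + - x)))
        with (fun y => cos (IZR k * x) * (f y * cos (IZR k * y))
                       + sin (IZR k * x) * (f y * sin (IZR k * y)))
        by (extensionality y; now rewrite Hd).
      rewrite mean_plus, !mean_scal by auto with smooth.
      unfold e. simpl. ring.
    + rewrite <- mean_zsum.
      * f_equal. extensionality y. unfold dirichlet. apply zsum_scal.
      * intros k. apply smooth_circle_mult; [exact Hf|].
        apply (smooth_circle_shift (fun y => cos (IZR k * y))). auto with smooth.
  - replace (fun y => f (y + x) * dirichlet N y)
      with (fun y => f (y + x) * dirichlet N (y + x + - x))
      by (extensionality y; do 2 f_equal; ring).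
    symmetry. apply (mean_shift (fun y => f y * dirichlet N (y + - x)) x).
    apply smooth_circle_mult; [exact Hf|]. apply smooth_circle_shift, dirichlet_smooth.
Qed.

Lemma abs_le_of_derive_le (f df : R -> R) a b K :
  a <= b -> (forall x, a <= x <= b -> is_derive f x (df x)) ->
  (forall x, a <= x <= b -> Rabs (df x) <= K) ->
  Rabs (f b - f a) <= K * (b - a).
Proof.
  intros Hab Hd HK.
  destruct (MVT_gen f a b df) as [c [Hc E]].
  - intros x Hx. apply Hd. rewrite Rmin_left, Rmax_right in Hx; lra.
  - intros x Hx. rewrite Rmin_left, Rmax_right in Hx by exact Hab.
    apply continuity_pt_filterlim. apply (ex_derive_continuous f).
    eexists. now apply Hd.
  - rewrite Rmin_left, Rmax_right in Hc by exact Hab.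
    rewrite E, Rabs_mult, (Rabs_right (b - a)) by lra.
    apply Rmult_le_compat_r; [lra|]. now apply HK.
Qed.

Lemma sin_half_lower y : 0 <= y <= PI -> y / 6 <= sin (y / 2).
Proof.
  intros [H0 H1]. pose proof PI_4 as H4. pose proof PI_RGT_0.
  destruct (Rle_lt_dec (y / 2) (PI / 3)) as [Hy|Hy].
  - destruct (MVT_gen sin 0 (y / 2) cos) as [c [Hc E]].
    + intros x _. apply is_derive_Reals, derivable_pt_lim_sin.
    + intros x _. apply continuity_sin.
    + rewrite Rmin_left, Rmax_right in Hc by lra. rewrite sin_0 in E.
      assert (cos (PI / 3) <= cos c) by (apply cos_decr_1; lra).
      rewrite cos_PI3 in *. nra.
  - assert (sin (PI / 3) <= sin (y / 2)) by (apply sin_incr_1; lra).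
    rewrite sin_PI3 in *.
    assert (4 / 3 <= sqrt 3) by (rewrite <- (sqrt_square (4 / 3)) by lra; apply sqrt_le_1_alt; lra). lra.
Qed.

(** Integration by parts against the oscillating Dirichlet kernel: the quotient
    of [phi] by [sin (y / 2)] stays of class C^1 up to 0 because [phi] vanishes
    there to second order. *)
Lemma dirichlet_decay N (phi phi1 : R -> R) M :
  (forall y, is_derive phi y (phi1 y)) ->
  (forall y, 0 <= y <= PI -> Rabs (phi1 y) <= 2 * M * y) ->
  (forall y, 0 <= y <= PI -> Rabs (phi y) <= 2 * M * y ^ 2) ->
  Rabs (RInt (fun y => phi y * dirichlet N y) 0 PI) <= 600 * M / (INR N + 1).
Proof.
  intros Hd H1 H0.
  pose proof PI_RGT_0 as HPI. pose proof PI_4 as HPI4.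
  pose proof (pos_INR N) as HN.
  set (om := INR N + / 2). assert (Hom : / 2 <= om) by (unfold om; lra).
  assert (HM : 0 <= M).
  { specialize (H1 PI ltac:(lra)). pose proof (Rabs_pos (phi1 PI)). nra. }
  set (h := fun y => phi y * dirichlet N y).
  assert (Hh : forall y, continuous h y).
  { intros y. apply (continuous_mult phi).
    - apply (ex_derive_continuous phi). eexists. apply Hd.
    - apply smooth_circle_continuous, dirichlet_smooth. }
  set (P := fun y => RInt h 0 y).
  assert (HP : forall y, is_derive P y (h y)).
  { intros y. apply (is_derive_RInt h P 0 y); [|apply Hh].
    apply filter_forall. intros z. apply (RInt_correct (V := R_CompleteNormedModule)).
    now apply ex_RInt_cont. }
  (* H is the boundary term of the integration by parts and r the new integrand,
     so that P - H has derivative r; r is bounded by a multiple of M / om *)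
  set (H := fun y => - (phi y / sin (y / 2)) * (cos (om * y) / om)).
  set (r := fun y => (phi1 y / sin (y / 2) - phi y * cos (y / 2) / (2 * sin (y / 2) ^ 2))
                     * (cos (om * y) / om)).
  assert (Hcos : forall y, Rabs (cos (om * y) / om) <= / om).
  { intros y. unfold Rdiv. rewrite Rabs_mult, (Rabs_right (/ om))
      by (left; apply Rinv_0_lt_compat; lra).
    rewrite <- (Rmult_1_l (/ om)) at 2. apply Rmult_le_compat_r.
    - left; apply Rinv_0_lt_compat; lra.
    - apply Rabs_le, COS_bound. }
  assert (Hq : forall y, 0 < y <= PI -> Rabs (phi y / sin (y / 2)) <= 12 * M * y).
  { intros y Hy. pose proof (sin_half_lower y ltac:(lra)) as Hs.
    unfold Rdiv. rewrite Rabs_mult, Rabs_inv, (Rabs_right (sin _)) by lra.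
    apply Rmult_le_reg_r with (sin (y * / 2)); [lra|].
    change (y * / 2) with (y / 2).
    rewrite Rmult_assoc, Rinv_l, Rmult_1_r by lra.
    apply Rle_trans with (1 := H0 y ltac:(lra)).
    replace (2 * M * y ^ 2) with (12 * M * y * (y / 6)) by field.
    apply Rmult_le_compat_l; [nra|exact Hs]. }
  assert (HH : forall y, 0 < y <= PI -> Rabs (H y) <= 48 * M / om).
  { intros y Hy. unfold H. rewrite Rabs_mult, Rabs_Ropp. change (48 * M / om) with (48 * M * / om).
    apply Rmult_le_compat; try apply Rabs_pos; [|apply Hcos].
    apply Rle_trans with (1 := Hq y Hy). nra. }
  assert (Hr : forall y, 0 < y <= PI -> Rabs (r y) <= 48 * M / om).
  { intros y Hy. pose proof (sin_half_lower y ltac:(lra)) as Hs.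
    unfold r. rewrite Rabs_mult. change (48 * M / om) with (48 * M * / om).
    apply Rmult_le_compat; try apply Rabs_pos; [|apply Hcos].
    apply Rle_trans with (12 * M + 36 * M); [|lra].
    unfold Rminus. apply Rle_trans with (1 := Rabs_triang _ _).
    rewrite Rabs_Ropp. apply Rplus_le_compat.
    - unfold Rdiv. rewrite Rabs_mult, Rabs_inv, (Rabs_right (sin _)) by lra.
      apply Rmult_le_reg_r with (sin (y * / 2)); [lra|].
      change (y * / 2) with (y / 2).
      rewrite Rmult_assoc, Rinv_l, Rmult_1_r by lra.
      apply Rle_trans with (1 := H1 y ltac:(lra)).
      replace (2 * M * y) with (12 * M * (y / 6)) by field.
      apply Rmult_le_compat_l; [lra|exact Hs].
    - replace (phi y * cos (y / 2) / (2 * sin (y / 2) ^ 2))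
        with ((phi y / sin (y / 2)) * (cos (y / 2) / (2 * sin (y / 2))))
        by (field; lra).
      rewrite Rabs_mult.
      apply Rle_trans with (12 * M * y * (3 / y)); [|right; field; lra].
      apply Rmult_le_compat; try apply Rabs_pos; [now apply Hq|].
      unfold Rdiv. rewrite Rabs_mult, Rabs_inv, (Rabs_right (2 * sin _)) by lra.
      apply Rmult_le_reg_r with (2 * sin (y * / 2)); [lra|].
      change (y * / 2) with (y / 2).
      rewrite Rmult_assoc, Rinv_l, Rmult_1_r by lra.
      apply Rle_trans with 1; [apply Rabs_le, COS_bound|].
      replace 1 with (3 * / y * (2 * (y / 6))) by (field; lra).
      apply Rmult_le_compat_l; [|lra].
      apply Rmult_le_pos; [lra|]. left; apply Rinv_0_lt_compat; lra. }
  assert (Hder : forall y, 0 < y <= PI -> is_derive (fun y => P y - H y) y (r y)).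
  { intros y Hy. pose proof (sin_half_lower y ltac:(lra)) as Hs.
    assert (Hs2 : sin (om * y) = dirichlet N y * sin (y / 2))
      by (symmetry; apply dirichlet_sin).
    unfold H. evar_last.
    - apply (is_derive_minus P); [apply HP|].
      auto_derive; [|reflexivity]. repeat split; try lra. eexists; apply Hd.
    - change (fun x : R => phi x) with phi.
      rewrite (is_derive_unique _ _ _ (Hd y)). unfold minus, plus, opp; simpl.
      change (y * / 2) with (y / 2).
      unfold h, r. rewrite Hs2. field. split; lra. }
  destruct (bounded_continuity (V := R_NormedModule) h 0 PI) as [B HB].
  { intros x _. apply Hh. }
  assert (HB' : forall d, 0 < d <= PI -> Rabs (P d) <= B * d).
  { intros d Hd'. pose proof (abs_le_of_derive_le P h 0 d B) as E.
    assert (HP0 : P 0 = 0) by apply (RInt_point (V := R_CompleteNormedModule)).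
    rewrite HP0, !Rminus_0_r in E. apply E; [lra| |].
    - intros; apply HP.
    - intros x Hx. left. apply HB. lra. }
  assert (Hmain : forall d, 0 < d <= PI -> Rabs (P PI) <= 288 * M / om + B * d).
  { intros d Hd'.
    pose proof (abs_le_of_derive_le (fun y => P y - H y) r d PI (48 * M / om)) as E.
    cbv beta in E.
    (* 48 for each of the two boundary terms, and 48 * PI for the integral of r *)
    replace (P PI) with ((P PI - H PI - (P d - H d)) + (H PI + (P d + - H d))) by ring.
    apply Rle_trans with (1 := Rabs_triang _ _).
    assert (E1 : Rabs (P PI - H PI - (P d - H d)) <= 192 * M / om).
    { apply Rle_trans with (48 * M / om * (PI - d)).
      - apply E; [lra| |]; intros x Hx; [apply Hder|apply Hr]; lra.
      - replace (192 * M / om) with (48 * M / om * 4) by (field; lra).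
        apply Rmult_le_compat_l; [|lra].
        apply Rmult_le_pos; [lra|]. left; apply Rinv_0_lt_compat; lra. }
    pose proof (Rabs_triang (H PI) (P d + - H d)).
    pose proof (Rabs_triang (P d) (- H d)). rewrite Rabs_Ropp in H3.
    pose proof (HH PI ltac:(lra)). pose proof (HH d ltac:(lra)).
    pose proof (HB' d Hd').
    replace (288 * M / om) with (192 * M / om + 48 * M / om + 48 * M / om)
      by (field; lra). lra. }
  apply Rle_trans with (288 * M / om).
  - apply Rnot_lt_le. intros Hlt. change (288 * M / om < Rabs (P PI)) in Hlt.
    set (eps := Rabs (P PI) - 288 * M / om).
    assert (Heps : 0 < eps) by (unfold eps; lra).
    assert (HB0 : 0 <= B).
    { exact (Rle_trans _ _ _ (norm_ge_0 (V := R_NormedModule) (h 0))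
        (Rlt_le _ _ (HB 0 ltac:(lra)))). }
    set (d := Rmin PI (eps / (2 * (B + 1)))).
    assert (Hd' : 0 < eps / (2 * (B + 1))).
    { apply Rdiv_lt_0_compat; lra. }
    assert (Hd1 : 0 < d <= PI).
    { unfold d. split; [now apply Rmin_pos|apply Rmin_l]. }
    pose proof (Hmain d Hd1) as E.
    assert (B * d <= eps / 2).
    { apply Rle_trans with ((B + 1) * (eps / (2 * (B + 1)))).
      - apply Rmult_le_compat; try lra. apply Rmin_r.
      - right. field. lra. }
    unfold eps in *. lra.
  - apply Rmult_le_reg_r with (om * (INR N + 1)); [apply Rmult_lt_0_compat; lra|].
    replace (288 * M / om * (om * (INR N + 1))) with (288 * M * (INR N + 1))
      by (field; lra).
    replace (600 * M / (INR N + 1) * (om * (INR N + 1))) with (600 * M * om)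
      by (field; lra).
    assert (INR N + 1 <= 2 * om) by (unfold om; lra). nra.
Qed.

(** The kernel is even, so only the even part of [f (x + y) - f x] counts, and
    this vanishes to second order at [y = 0].  The rate is uniform in [x], which
    later allows limits under integrals. *)
Lemma psum_error N f x M :
  smooth_circle f -> (forall y, Rabs (Derive_n f 2 y) <= M) ->
  Rabs (psum N f x - f x) <= 600 * M / (INR N + 1).
Proof.
  intros Hf HM.
  set (g := fun y => (f (y + x) - f x) * dirichlet N y).
  assert (Hg : smooth_circle g) by (unfold g; auto with smooth).
  assert (E : psum N f x - f x = mean g).
  { rewrite psum_dirichlet by exact Hf.
    replace (f x) with (mean (fun y => f x * dirichlet N y)) at 1.
    - rewrite <- mean_minus by auto with smooth.
      f_equal. extensionality y. unfold g. ring.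
    - rewrite mean_scal, mean_dirichlet by auto with smooth. ring. }
  rewrite E, mean_fold by exact Hg.
  set (phi := fun y => f (y + x) + f (- y + x) - 2 * f x).
  set (phi1 := fun y => Derive f (y + x) - Derive f (- y + x)).
  replace (fun y => g y + g (- y)) with (fun y => phi y * dirichlet N y)
    by (extensionality y; unfold g, phi; rewrite dirichlet_opp; ring).
  assert (Hd : forall y, is_derive phi y (phi1 y)).
  { intros y. unfold phi, phi1. auto_derive.
    - repeat split; now apply smooth_circle_ex_derive.
    - change (fun z : R => f z) with f. ring. }
  assert (H1 : forall y, 0 <= y <= PI -> Rabs (phi1 y) <= 2 * M * y).
  { intros y Hy. unfold phi1.
    replace (2 * M * y) with (M * ((y + x) - (- y + x))) by ring.
    apply (abs_le_of_derive_le (Derive f) (Derive_n f 2)); [lra| |auto].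
    intros z _. apply (smooth_circle_is_derive_n f 1 z Hf). }
  assert (HM0 : 0 <= M) by (eapply Rle_trans; [apply Rabs_pos|apply (HM 0)]).
  assert (H0 : forall y, 0 <= y <= PI -> Rabs (phi y) <= 2 * M * y ^ 2).
  { intros y Hy.
    pose proof (abs_le_of_derive_le phi phi1 0 y (2 * M * y)) as A.
    replace (phi 0) with 0 in A
      by (unfold phi; rewrite Ropp_0, Rplus_0_l; ring).
    rewrite !Rminus_0_r in A. replace (2 * M * y ^ 2) with (2 * M * y * y) by ring.
    apply A; [lra|intros; apply Hd|].
    intros z Hz. apply Rle_trans with (1 := H1 z ltac:(lra)). nra. }
  pose proof (dirichlet_decay N phi phi1 M Hd H1 H0) as B.
  rewrite Rabs_mult, Rabs_right
    by (left; apply Rinv_0_lt_compat, two_PI_pos).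
  pose proof PI2_3_2.
  rewrite <- (Rmult_1_l (600 * M / (INR N + 1))).
  apply Rmult_le_compat; [left; apply Rinv_0_lt_compat, two_PI_pos|apply Rabs_pos| |exact B].
  rewrite <- Rinv_1. apply Rinv_le_contravar; lra.
Qed.

Lemma e_add j l x : e (j + l) x = Cmult (e j x) (e l x).
Proof.
  unfold e, Cmult. simpl. rewrite plus_IZR, Rmult_plus_distr_r, cos_plus, sin_plus.
  f_equal. ring.
Qed.

Lemma Cmod_e k x : Cmod (e k x) = 1.
Proof.
  unfold Cmod, e. simpl. rewrite !Rmult_1_r.
  replace (_ + _) with 1; [apply sqrt_1|].
  pose proof (sin2_cos2 (IZR k * x)) as H. unfold Rsqr in H. lra.
Qed.

Lemma Cmod_le_re_im z : Cmod z <= Rabs (Re z) + Rabs (Im z).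
Proof.
  destruct z as [a b]. unfold Cmod. cbn [fst snd Re Im].
  pose proof (Rabs_pos a). pose proof (Rabs_pos b).
  rewrite <- (sqrt_pow2 (Rabs a + Rabs b)) by lra.
  apply sqrt_le_1_alt. rewrite <- (pow2_abs a), <- (pow2_abs b). nra.
Qed.

Lemma fourier_coef_opp f k :
  smooth_circle f -> fourier_coef f (- k) = Cconj (fourier_coef f k).
Proof.
  intros Hf. rewrite !fourier_coef_smooth by exact Hf. unfold Cconj. simpl.
  rewrite opp_IZR.
  f_equal.
  - f_equal. extensionality x. rewrite <- cos_neg. do 2 f_equal. ring.
  - replace (fun x => f x * sin (- IZR k * x))
      with (fun x => -1 * (f x * sin (IZR k * x))).
    + rewrite mean_scal by auto with smooth. ring.
    + extensionality x. replace (- IZR k * x) with (- (IZR k * x)) by ring.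
      rewrite sin_neg. ring.
Qed.

(** Integration by parts; the boundary terms cancel by periodicity. *)
Lemma fourier_coef_Derive f k :
  smooth_circle f ->
  fourier_coef (Derive f) k = Cmult (0, IZR k) (fourier_coef f k).
Proof.
  intros Hf. pose proof (smooth_circle_Derive _ Hf) as Hf'.
  pose proof (smooth_circle_cos k) as Hc. pose proof (smooth_circle_sin k) as Hs.
  rewrite !fourier_coef_smooth by assumption. unfold Cmult. simpl.
  assert (E1 : mean (fun x => Derive f x * cos (IZR k * x))
               = IZR k * mean (fun x => f x * sin (IZR k * x))).
  { pose proof (mean_Derive _ (smooth_circle_mult _ _ Hf Hc)) as A.
    rewrite Derive_mult_fun in A by (intros; now apply smooth_circle_ex_derive).
    rewrite mean_plus in A by auto with smooth.
    replace (fun x => f x * Derive (fun y => cos (IZR k * y)) x)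
      with (fun x => (- IZR k) * (f x * sin (IZR k * x))) in A.
    - rewrite mean_scal in A by auto with smooth. lra.
    - extensionality x.
      rewrite (is_derive_unique _ x (- IZR k * sin (IZR k * x)))
        by (auto_derive; [exact I|ring]). ring. }
  assert (E2 : mean (fun x => Derive f x * sin (IZR k * x))
               = - IZR k * mean (fun x => f x * cos (IZR k * x))).
  { pose proof (mean_Derive _ (smooth_circle_mult _ _ Hf Hs)) as A.
    rewrite Derive_mult_fun in A by (intros; now apply smooth_circle_ex_derive).
    rewrite mean_plus in A by auto with smooth.
    replace (fun x => f x * Derive (fun y => sin (IZR k * y)) x)
      with (fun x => (IZR k) * (f x * cos (IZR k * x))) in A.
    - rewrite mean_scal in A by auto with smooth. lra.
    - extensionality x.
      rewrite (is_derive_unique _ x (IZR k * cos (IZR k * x)))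
        by (auto_derive; [exact I|ring]). ring. }
  rewrite E1, E2. f_equal; ring.
Qed.

Lemma fourier_coef_plus f g k :
  smooth_circle f -> smooth_circle g ->
  fourier_coef (fun x => f x + g x) k = Cplus (fourier_coef f k) (fourier_coef g k).
Proof.
  intros Hf Hg. rewrite !fourier_coef_smooth by auto with smooth.
  unfold Cplus. simpl. rewrite <- Ropp_plus_distr, <- !mean_plus by auto with smooth.
  f_equal; [f_equal|do 2 f_equal]; extensionality x; ring.
Qed.

Lemma fourier_coef_scal a f k :
  smooth_circle f ->
  fourier_coef (fun x => a * f x) k = Cmult (RtoC a) (fourier_coef f k).
Proof.
  intros Hf. rewrite !fourier_coef_smooth by auto using smooth_circle_scal.
  unfold Cmult, RtoC. simpl.
  replace (fun x => a * f x * cos (IZR k * x))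
    with (fun x => a * (f x * cos (IZR k * x))) by (extensionality x; ring).
  replace (fun x => a * f x * sin (IZR k * x))
    with (fun x => a * (f x * sin (IZR k * x))) by (extensionality x; ring).
  rewrite !mean_scal by auto with smooth. f_equal; ring.
Qed.

Lemma Cmod_fourier_coef_le f k M :
  smooth_circle f -> (forall x, Rabs (f x) <= M) -> Cmod (fourier_coef f k) <= 2 * M.
Proof.
  intros Hf HM. apply Rle_trans with (1 := Cmod_le_re_im _).
  rewrite fourier_coef_smooth by exact Hf. cbn [Re Im fst snd]. rewrite Rabs_Ropp.
  assert (HM0 : 0 <= M) by (eapply Rle_trans; [apply Rabs_pos|apply (HM 0)]).
  assert (B : forall g, smooth_circle g -> (forall x, Rabs (g x) <= 1) ->
    Rabs (mean (fun x => f x * g x)) <= M).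
  { intros g Hg Hg1. apply mean_abs_le; [auto with smooth|].
    intros x. rewrite Rabs_mult, <- (Rmult_1_r M).
    apply Rmult_le_compat; auto using Rabs_pos. }
  pose proof (B _ (smooth_circle_cos k) ltac:(intros; apply Rabs_le, COS_bound)).
  pose proof (B _ (smooth_circle_sin k) ltac:(intros; apply Rabs_le, SIN_bound)).
  lra.
Qed.

(** The counterpart of the seminorms [bnd] for Fourier coefficients. *)
Definition decay (q : nat) (C : R) (c : Z -> Complex.C) : Prop :=
  forall k, jap k ^ q * Cmod (c k) <= C.

Lemma Cmod_fourier_coef_Derive_n f n k :
  smooth_circle f ->
  Cmod (fourier_coef (Derive_n f n) k) = Rabs (IZR k) ^ n * Cmod (fourier_coef f k).
Proof.
  intros Hf. induction n as [|n IH]; [rewrite pow_O, Rmult_1_l; reflexivity|].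
  change (Derive_n f (S n)) with (Derive (Derive_n f n)).
  rewrite fourier_coef_Derive, Cmod_mult, IH by now apply smooth_circle_Derive_n.
  replace (Cmod (0, IZR k)) with (Rabs (IZR k)); [rewrite <- tech_pow_Rmult; ring|].
  unfold Cmod. cbn [fst snd]. rewrite <- sqrt_Rsqr_abs. f_equal. unfold Rsqr. ring.
Qed.

Lemma jap_pow_le q k : jap k ^ q <= 2 ^ q * (1 + Rabs (IZR k) ^ (2 * q)).
Proof.
  rewrite pow_mult, pow2_abs. set (y := IZR k ^ 2).
  assert (Hy : 0 <= y) by apply pow2_ge_0.
  unfold jap. fold y.
  pose proof (pow_le 2 q ltac:(lra)). pose proof (pow_le y q Hy).
  destruct (Rle_lt_dec y 1) as [H1|H1].
  - apply Rle_trans with (2 ^ q); [apply pow_incr; lra|nra].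
  - apply Rle_trans with ((2 * y) ^ q); [apply pow_incr; lra|].
    rewrite Rpow_mult_distr. nra.
Qed.

(** The derivative of order [2 * q] has bounded coefficients, and these are [k ^
    (2 * q)] times the given ones up to sign. *)
Lemma fourier_coef_decay q f a :
  smooth_circle f -> bnd (2 * q) f a -> decay q (2 ^ q * (4 * a)) (fourier_coef f).
Proof.
  intros Hf Ha k.
  apply Rle_trans with
    (2 ^ q * (1 + Rabs (IZR k) ^ (2 * q)) * Cmod (fourier_coef f k)).
  { apply Rmult_le_compat_r; [apply Cmod_ge_0|apply jap_pow_le]. }
  rewrite Rmult_assoc. apply Rmult_le_compat_l; [apply pow_le; lra|].
  rewrite Rmult_plus_distr_r, <- Cmod_fourier_coef_Derive_n, Rmult_1_l by exact Hf.
  pose proof (Cmod_fourier_coef_le f k a Hf) as H1.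
  pose proof (Cmod_fourier_coef_le _ k a (smooth_circle_Derive_n f (2 * q) Hf)) as H2.
  specialize (H1 (fun x => Ha 0%nat x ltac:(lia))).
  specialize (H2 (fun x => Ha (2 * q)%nat x (le_n _))). lra.
Qed.

Definition rapid (c : Z -> Complex.C) : Prop := forall q, exists C, decay q C c.

Lemma fourier_coef_rapid f : smooth_circle f -> rapid (fourier_coef f).
Proof.
  intros Hf q. destruct (bnd_exists (2 * q) f Hf) as [a Ha].
  eexists. exact (fourier_coef_decay q f a Hf Ha).
Qed.

Lemma decay_le q q' C C' c : (q <= q')%nat -> C <= C' -> decay q' C c -> decay q C' c.
Proof.
  intros Hq HC H k. apply Rle_trans with (jap k ^ q' * Cmod (c k)).
  - apply Rmult_le_compat_r; [apply Cmod_ge_0|]. apply Rle_pow; [apply jap_ge_1|exact Hq].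
  - apply Rle_trans with (1 := H k). exact HC.
Qed.

(** * Trigonometric series *)

Definition syn (c : Z -> Complex.C) (x : R) : R :=
  ZSeries (fun k => Re (c k * e k x)%C).

Lemma ZSeries_ext c d : (forall k, c k = d k) -> ZSeries c = ZSeries d.
Proof.
  intros H. unfold ZSeries. rewrite H. f_equal. apply Series_ext. intros n.
  now rewrite !H.
Qed.

Lemma ZSeries_unique C c (l : R) :
  summable C c -> is_lim_seq (fun N => zsum N c) l -> ZSeries c = l.
Proof.
  intros Hc Hl. apply is_lim_zsum in Hc. apply is_lim_seq_unique in Hc, Hl.
  rewrite Hc in Hl. now injection Hl.
Qed.

Lemma ZSeries_lin C c C' d a b :
  summable C c -> summable C' d ->
  ZSeries (fun k => a * c k + b * d k) = a * ZSeries c + b * ZSeries d.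
Proof.
  intros Hc Hd. apply (ZSeries_unique (Rabs a * C + Rabs b * C')).
  - intros k. specialize (Hc k). specialize (Hd k).
    apply Rle_trans with (jap k * (Rabs a * Rabs (c k) + Rabs b * Rabs (d k))).
    + apply Rmult_le_compat_l; [left; apply jap_pos|].
      rewrite <- !Rabs_mult. apply Rabs_triang.
    + pose proof (Rabs_pos a). pose proof (Rabs_pos b).
      apply Rmult_le_compat_l with (r := Rabs a) in Hc; [|assumption].
      apply Rmult_le_compat_l with (r := Rabs b) in Hd; [|assumption]. lra.
  - apply is_lim_seq_ext with (fun N => a * zsum N c + b * zsum N d).
    + intros N. now rewrite zsum_plus, !zsum_scal.
    + apply is_lim_seq_plus'.
      * apply (is_lim_seq_scal_l _ a (ZSeries c)). now apply is_lim_zsum with C.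
      * apply (is_lim_seq_scal_l _ b (ZSeries d)). now apply is_lim_zsum with C'.
Qed.

Lemma Rabs_Re_e_le z k x : Rabs (Re (z * e k x)%C) <= Cmod z.
Proof.
  apply Rle_trans with (1 := re_le_Cmod _). rewrite Cmod_mult, Cmod_e. lra.
Qed.

Lemma syn_summable C c x :
  decay 1 C c -> summable C (fun k => Re (c k * e k x)%C).
Proof.
  intros H k. apply Rle_trans with (2 := H k). rewrite pow_1.
  apply Rmult_le_compat_l; [left; apply jap_pos|apply Rabs_Re_e_le].
Qed.

Lemma syn_bound C c x : decay 1 C c -> Rabs (syn c x) <= 5 * C.
Proof. intros H. now apply ZSeries_bound, syn_summable. Qed.

Definition ik (c : Z -> Complex.C) (k : Z) : Complex.C := Cmult (0, IZR k) (c k).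

Lemma Cmod_ik c k : Cmod (ik c k) = Rabs (IZR k) * Cmod (c k).
Proof.
  unfold ik. rewrite Cmod_mult. f_equal.
  unfold Cmod. cbn [fst snd]. rewrite <- sqrt_Rsqr_abs. f_equal. unfold Rsqr. ring.
Qed.

Lemma ik_decay q C c : decay (S q) C c -> decay q C (ik c).
Proof.
  intros H k. apply Rle_trans with (2 := H k). rewrite Cmod_ik, <- tech_pow_Rmult.
  replace (jap k * jap k ^ q * Cmod (c k)) with (jap k ^ q * (jap k * Cmod (c k))) by ring.
  apply Rmult_le_compat_l; [apply pow_le; left; apply jap_pos|].
  apply Rmult_le_compat_r; [apply Cmod_ge_0|apply abs_le_jap].
Qed.

Lemma ik_rapid c : rapid c -> rapid (ik c).
Proof. intros H q. destruct (H (S q)) as [C HC]. exists C. now apply ik_decay. Qed.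

Lemma iter_ik_rapid n c : rapid c -> rapid (Nat.iter n ik c).
Proof. intros H. induction n as [|n IH]; [exact H|]. simpl. now apply ik_rapid. Qed.

Lemma iter_ik_decay n q C c : decay (n + q) C c -> decay q C (Nat.iter n ik c).
Proof.
  revert q. induction n as [|n IH]; intros q H; [exact H|].
  simpl. apply ik_decay, IH. now replace (n + S q)%nat with (S n + q)%nat by lia.
Qed.

(** A quadratic remainder with an explicit constant survives summation and
    passage to the limit; together with the next lemma this replaces the
    theorems on termwise differentiation. *)
Lemma taylor_bound (f f1 f2 : R -> R) K x h :
  (forall y, is_derive f y (f1 y)) -> (forall y, is_derive f1 y (f2 y)) ->
  (forall y, Rabs (f2 y) <= K) ->
  Rabs (f (x + h) - f x - h * f1 x) <= K * h ^ 2.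
Proof.
  intros H1 H2 HK.
  assert (L : forall y z, Rabs (f1 z - f1 y) <= K * Rabs (z - y)).
  { intros y z. destruct (Rle_dec y z) as [Hyz|Hyz].
    - rewrite (Rabs_right (z - y)) by lra.
      apply (abs_le_of_derive_le f1 f2); auto.
    - rewrite Rabs_minus_sym, (Rabs_minus_sym z), (Rabs_right (y - z)) by lra.
      apply (abs_le_of_derive_le f1 f2); auto; lra. }
  assert (HK0 : 0 <= K) by (eapply Rle_trans; [apply Rabs_pos|apply (HK 0)]).
  assert (D : forall y, is_derive (fun y => f y - y * f1 x) y (f1 y - f1 x)).
  { intros y. auto_derive; [now exists (f1 y)|].
    change (fun x : R => f x) with f. rewrite (is_derive_unique _ _ _ (H1 y)). ring. }
  replace (f (x + h) - f x - h * f1 x)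
    with ((f (x + h) - (x + h) * f1 x) - (f x - x * f1 x)) by ring.
  destruct (Rle_dec 0 h) as [Hh|Hh].
  - replace (K * h ^ 2) with (K * h * (x + h - x)) by ring.
    apply (abs_le_of_derive_le (fun y => f y - y * f1 x) (fun y => f1 y - f1 x));
      [lra|auto|].
    intros y Hy. apply Rle_trans with (1 := L x y). apply Rmult_le_compat_l; [lra|].
    rewrite Rabs_right; lra.
  - rewrite Rabs_minus_sym. replace (K * h ^ 2) with (K * - h * (x - (x + h))) by ring.
    apply (abs_le_of_derive_le (fun y => f y - y * f1 x) (fun y => f1 y - f1 x));
      [lra|auto|].
    intros y Hy. apply Rle_trans with (1 := L x y). apply Rmult_le_compat_l; [lra|].
    rewrite Rabs_minus_sym, Rabs_right; lra.
Qed.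

Lemma is_derive_of_quadratic (f : R -> R) x l K :
  (forall h, Rabs (f (x + h) - f x - h * l) <= K * h ^ 2) -> is_derive f x l.
Proof.
  intros H. apply is_derive_Reals. intros eps Heps.
  assert (HK : 0 <= K).
  { specialize (H 1). pose proof (Rabs_pos (f (x + 1) - f x - 1 * l)). lra. }
  assert (Hd : 0 < eps / (K + 1)) by (apply Rdiv_lt_0_compat; lra).
  exists (mkposreal _ Hd). intros h Hh Hlt. simpl in Hlt.
  replace ((f (x + h) - f x) / h - l) with ((f (x + h) - f x - h * l) / h)
    by (field; exact Hh).
  unfold Rdiv. rewrite Rabs_mult, Rabs_inv.
  pose proof (Rabs_pos_lt h Hh) as Hh0.
  apply Rmult_lt_reg_r with (Rabs h); [exact Hh0|].
  rewrite Rmult_assoc, Rinv_l, Rmult_1_r by lra.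
  apply Rle_lt_trans with (1 := H h).
  rewrite <- (pow2_abs h).
  apply Rmult_lt_compat_r with (r := K + 1) in Hlt; [|lra].
  unfold Rdiv in Hlt. rewrite Rmult_assoc, Rinv_l, Rmult_1_r in Hlt by lra.
  nra.
Qed.

Lemma is_derive_Re_e z k x :
  is_derive (fun x => Re (z * e k x)%C) x
    (Re ((0, IZR k) * z * e k x)%C).
Proof.
  destruct z as [a b]. unfold Cmult, e. simpl. auto_derive; [exact I|ring].
Qed.

Lemma syn_is_derive c x : rapid c -> is_derive (syn c) x (syn (ik c) x).
Proof.
  intros Hc. destruct (Hc 3%nat) as [C HC].
  assert (H1 : decay 1 C c).
  { apply decay_le with (3 := HC); [lia|lra]. }
  assert (H2 : decay 1 C (ik c)).
  { apply ik_decay, decay_le with (3 := HC); [lia|lra]. }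
  assert (H3 : decay 1 C (ik (ik c))) by now apply ik_decay, ik_decay.
  apply is_derive_of_quadratic with (5 * C). intros h.
  assert (S1 := syn_summable C c (x + h) H1). assert (S2 := syn_summable C c x H1).
  assert (S3 := syn_summable C (ik c) x H2).
  set (d := fun k => 1 * Re (c k * e k (x + h))%C
     + -1 * (1 * Re (c k * e k x)%C + h * Re (ik c k * e k x)%C)).
  assert (S4 : summable (C + Rabs h * C)
    (fun k => 1 * Re (c k * e k x)%C + h * Re (ik c k * e k x)%C)).
  { intros k. specialize (S2 k). specialize (S3 k).
    apply Rmult_le_compat_l with (r := Rabs h) in S3; [|apply Rabs_pos].
    apply Rle_trans with (jap k * (Rabs (Re (c k * e k x)%C)
      + Rabs h * Rabs (Re (ik c k * e k x)%C))); [|cbv beta in S2, S3; lra].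
    apply Rmult_le_compat_l; [left; apply jap_pos|].
    rewrite <- Rabs_mult, Rmult_1_l. apply Rabs_triang. }
  replace (syn c (x + h) - syn c x - h * syn (ik c) x) with (ZSeries d).
  - replace (5 * C * h ^ 2) with (5 * (C * h ^ 2)) by ring.
    apply ZSeries_bound. intros k.
    replace (d k) with (Re (c k * e k (x + h))%C - Re (Cmult (c k) (e k x))
      - h * Re (ik c k * e k x)%C) by (unfold d; ring).
    apply Rle_trans with (jap k * (Cmod (ik (ik c) k) * h ^ 2)).
    + apply Rmult_le_compat_l; [left; apply jap_pos|].
      apply (taylor_bound (fun x => Re (c k * e k x)%C)
        (fun x => Re (ik c k * e k x)%C)
        (fun x => Re (ik (ik c) k * e k x)%C)).
      * intros y. apply is_derive_Re_e.
      * intros y. apply is_derive_Re_e.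
      * intros y. apply Rabs_Re_e_le.
    + rewrite <- Rmult_assoc. apply Rmult_le_compat_r; [apply pow2_ge_0|].
      rewrite <- (pow_1 (jap k)). apply H3.
  - unfold d. rewrite (ZSeries_lin C _ _ _ _ _ S1 S4), (ZSeries_lin C _ C _ _ _ S2 S3).
    unfold syn. ring.
Qed.

Lemma syn_Derive_n c n x :
  rapid c ->
  ex_derive_n (syn c) n x /\ Derive_n (syn c) n x = syn (Nat.iter n ik c) x.
Proof.
  intros Hc. apply (Derive_n_tower (fun n => syn (Nat.iter n ik c))).
  intros m y. apply syn_is_derive. now apply iter_ik_rapid.
Qed.

Lemma e_periodic k x : e k (x + 2 * PI) = e k x.
Proof. unfold e. now rewrite cos_2PI_Z, sin_2PI_Z. Qed.

Lemma syn_smooth c : rapid c -> smooth_circle (syn c).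
Proof.
  intros Hc. split.
  - intros x. apply ZSeries_ext. intros k. now rewrite e_periodic.
  - intros n x. now apply syn_Derive_n.
Qed.

Lemma syn_bnd n C c : rapid c -> decay (S n) C c -> bnd n (syn c) (5 * C).
Proof.
  intros Hr Hc i x Hi. rewrite (proj2 (syn_Derive_n c i x Hr)).
  apply syn_bound, iter_ik_decay. apply decay_le with (3 := Hc); [lia|lra].
Qed.

Lemma is_lim_seq_inv_succ K : is_lim_seq (fun N => K / (INR N + 1)) 0.
Proof.
  assert (L : is_lim_seq (fun N => / INR (S N)) 0).
  { apply (is_lim_seq_incr_1 (fun N => / INR N)).
    apply (is_lim_seq_inv _ p_infty); [apply is_lim_seq_INR|discriminate]. }
  apply (is_lim_seq_scal_l _ K) in L.
  replace (Rbar_mult K 0) with (Finite 0) in L by (simpl; f_equal; ring).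
  apply is_lim_seq_ext with (2 := L). intros N.
  rewrite <- S_INR. reflexivity.
Qed.

Lemma syn_fourier_coef f : smooth_circle f -> syn (fourier_coef f) = f.
Proof.
  intros Hf. extensionality x.
  destruct (fourier_coef_rapid f Hf 1%nat) as [C HC].
  destruct (bnd_exists 2 f Hf) as [M HM].
  apply (ZSeries_unique C); [now apply syn_summable|].
  pose proof (is_lim_seq_inv_succ (600 * M)) as L.
  assert (L' : is_lim_seq (fun N => psum N f x - f x) 0).
  { apply is_lim_seq_abs_0.
    apply is_lim_seq_le_le with (u := fun _ => 0) (3 := L); [|apply is_lim_seq_const].
    intros N. split; [apply Rabs_pos|]. apply psum_error; [exact Hf|].
    intros y. apply HM. lia. }
  assert (L2 : is_lim_seq (fun N => psum N f x - f x + f x) (0 + f x))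
    by (apply is_lim_seq_plus' with (1 := L'); apply is_lim_seq_const).
  rewrite Rplus_0_l in L2. apply is_lim_seq_ext with (2 := L2).
  intros N. unfold psum. ring.
Qed.

Lemma mean_Re_e z m :
  mean (fun x => Re (z * e m x)%C) = if Z.eqb m 0 then Re z else 0.
Proof.
  destruct z as [a b]. unfold Cmult, e. simpl.
  rewrite mean_minus, !mean_scal, mean_cos, mean_sin by auto with smooth.
  destruct (Z.eqb m 0); ring.
Qed.

Lemma smooth_circle_Re_e z m : smooth_circle (fun x => Re (z * e m x)%C).
Proof.
  destruct z as [a b]. unfold Cmult, e. simpl.
  auto with smooth.
Qed.

#[export] Hint Resolve smooth_circle_Re_e syn_smooth : smooth.

Lemma syn_uniform C c N x :
  decay 1 C c ->
  Rabs (zsum N (fun k => Re (c k * e k x)%C) - syn c x) <= 4 * C / (INR N + 1).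
Proof.
  intros H. rewrite Rabs_minus_sym. now apply ZSeries_tail, syn_summable.
Qed.

Lemma mean_syn_mult_terms c g :
  rapid c -> smooth_circle g ->
  is_lim_seq (fun N => zsum N (fun k => mean (fun x => Re (c k * e k x)%C * g x)))
    (mean (fun x => syn c x * g x)).
Proof.
  intros Hc Hg. destruct (Hc 1%nat) as [C HC]. destruct (bnd_exists 0 g Hg) as [B HB].
  apply is_lim_seq_ext with
    (fun N => mean (fun x => zsum N (fun k => Re (c k * e k x)%C) * g x)).
  - intros N. rewrite <- mean_zsum by auto with smooth.
    f_equal. extensionality x. rewrite Rmult_comm, <- zsum_scal.
    apply zsum_ext. intros; ring.
  - apply is_lim_mean with (eps := fun N => 4 * C * B / (INR N + 1)).
    + auto with smooth.
    + auto with smooth.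
    + intros N x. rewrite <- Rmult_minus_distr_r, Rabs_mult.
      replace (4 * C * B / (INR N + 1)) with (4 * C / (INR N + 1) * B)
        by (field; pose proof (pos_INR N); lra).
      apply Rmult_le_compat; try apply Rabs_pos; [now apply syn_uniform|].
      apply (HB 0%nat x). lia.
    + apply is_lim_seq_inv_succ.
Qed.

Lemma mean_Re_e_mult z k g :
  smooth_circle g ->
  mean (fun x => Re (z * e k x)%C * g x) = Re (z * Cconj (fourier_coef g k))%C.
Proof.
  intros Hg. rewrite fourier_coef_smooth by exact Hg.
  destruct z as [a b]. unfold Cmult, Cconj, e. simpl. rewrite Ropp_involutive.
  rewrite <- !mean_scal, <- mean_minus by auto with smooth.
  f_equal. extensionality x. ring.
Qed.

Lemma mean_syn_mult c g :
  rapid c -> smooth_circle g ->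
  is_lim_seq (fun N => zsum N (fun k => Re (c k * Cconj (fourier_coef g k))%C))
    (mean (fun x => syn c x * g x)).
Proof.
  intros Hc Hg. apply is_lim_seq_ext with (2 := mean_syn_mult_terms c g Hc Hg).
  intros N. apply zsum_ext. intros k. now apply mean_Re_e_mult.
Qed.

Definition hermitian (c : Z -> Complex.C) : Prop := forall k, c (- k)%Z = Cconj (c k).

Lemma mean_Re_e_Re_e c z j k :
  mean (fun x => Re (c * e j x)%C * Re (z * e k x)%C)
  = / 2 * (Re (c * Cconj z)%C * (if Z.eqb j k then 1 else 0))
    + / 2 * (Re (c * z)%C * (if Z.eqb j (- k) then 1 else 0)).
Proof.
  transitivity (mean (fun x => / 2 * Re (c * Cconj z * e (j - k) x)%C
                               + / 2 * Re (c * z * e (j + k) x)%C)).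
  - f_equal. extensionality x. destruct c as [a b], z as [a' b'].
    unfold Cmult, Cconj, e. simpl. rewrite minus_IZR, plus_IZR.
    replace ((IZR j - IZR k) * x) with (IZR j * x - IZR k * x) by ring.
    replace ((IZR j + IZR k) * x) with (IZR j * x + IZR k * x) by ring.
    rewrite cos_minus, cos_plus, sin_minus, sin_plus. field.
  - rewrite mean_plus, !mean_scal, !mean_Re_e by auto with smooth.
    destruct (Z.eqb_spec (j - k) 0), (Z.eqb_spec (j + k) 0), (Z.eqb_spec j k),
      (Z.eqb_spec j (- k)); lia || ring.
Qed.

Lemma zsum_pick N k (F : Z -> R) :
  (Z.abs k <= Z.of_nat N)%Z ->
  zsum N (fun j => F j * (if Z.eqb j k then 1 else 0)) = F k.
Proof.
  intros Hk. rewrite (zsum_ext N _ (fun j => if Z.eqb j k then F k else 0)).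
  - now rewrite zsum_delta, (proj2 (Z.leb_le _ _) Hk).
  - intros j. destruct (Z.eqb_spec j k) as [->|]; ring.
Qed.

Lemma is_lim_seq_eventually_const (u : nat -> R) l (m : R) n :
  (forall N, (n <= N)%nat -> u N = m) -> is_lim_seq u l -> l = m.
Proof.
  intros H Hu. apply is_lim_seq_unique in Hu. rewrite <- Hu.
  apply is_lim_seq_unique.
  apply is_lim_seq_ext_loc with (fun _ => m); [|apply is_lim_seq_const].
  exists n. intros N HN. symmetry. now apply H.
Qed.

(** Orthogonality singles out the terms of index [k] and [- k]; the symmetry of
    [c], without which the series of real parts would forget half of it, makes
    the two contributions equal. *)
Lemma fourier_coef_syn c :
  rapid c -> hermitian c -> fourier_coef (syn c) = c.
Proof.
  intros Hc Hh. extensionality k. set (f := fourier_coef (syn c) k).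
  (* test against both the real and the imaginary part of e_k *)
  assert (E : forall z, Re (z * Cconj f)%C = Re (c k * Cconj z)%C).
  { intros z. unfold f. rewrite <- mean_Re_e_mult by auto with smooth.
    replace (fun x => Re (z * e k x)%C * syn c x)
      with (fun x => syn c x * Re (z * e k x)%C) by (extensionality x; ring).
    pose proof (mean_syn_mult_terms c _ Hc (smooth_circle_Re_e z k)) as L.
    apply (is_lim_seq_eventually_const _ _ (Re (c k * Cconj z)%C)
      (Z.to_nat (Z.abs k))) in L; [now injection L|].
    intros N HN. rewrite (zsum_ext N _ _ (fun j => mean_Re_e_Re_e (c j) z j k)).
    rewrite zsum_plus, !zsum_scal, !zsum_pick, Hh by lia.
    destruct (c k), z. unfold Cmult, Cconj, Re. simpl. field. }
  pose proof (E (1, 0)) as E1. pose proof (E (0, 1)) as E2.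
  destruct f as [a b], (c k) as [a' b']. unfold Cmult, Cconj, Re in E1, E2. simpl in E1, E2.
  f_equal; lra.
Qed.

(** * The multipliers and products of Fourier series *)

(** The symbol of the multiplier [A p]. *)
Definition pw (p : R) (k : Z) : R := Rpower (jap k) p.

Lemma pw_pos p k : 0 < pw p k.
Proof. apply exp_pos. Qed.

Lemma pw_plus p q k : pw (p + q) k = pw p k * pw q k.
Proof. apply Rpower_plus. Qed.

Lemma pw_0 k : pw 0 k = 1.
Proof. apply Rpower_O, jap_pos. Qed.

Lemma pw_opp p k : pw p (- k) = pw p k.
Proof. unfold pw. now rewrite jap_opp. Qed.

Lemma pw_le p q k : p <= q -> pw p k <= pw q k.
Proof.
  intros [H| ->]; [|lra]. unfold pw.
  destruct (Rle_lt_or_eq_dec _ _ (jap_ge_1 k)) as [H1|H1].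
  - left. now apply Rpower_lt.
  - rewrite <- H1. unfold Rpower. rewrite ln_1, !Rmult_0_r. lra.
Qed.

Lemma pw_ge_1 p k : 0 <= p -> 1 <= pw p k.
Proof. intros H. rewrite <- (pw_0 k). now apply pw_le. Qed.

Lemma pw_INR n k : pw (INR n) k = jap k ^ n.
Proof. apply Rpower_pow, jap_pos. Qed.

Lemma pw_le_pow p : exists n, forall k, pw p k <= jap k ^ n.
Proof.
  destruct (INR_unbounded p) as [n Hn]. exists n. intros k.
  rewrite <- pw_INR. apply pw_le. lra.
Qed.

Definition pwc (p : R) (c : Z -> Complex.C) (k : Z) : Complex.C :=
  Cmult (RtoC (pw p k)) (c k).

Lemma Cmod_pwc p c k : Cmod (pwc p c k) = pw p k * Cmod (c k).
Proof.
  unfold pwc. rewrite Cmod_mult, Cmod_R, Rabs_right; [reflexivity|].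
  left. apply pw_pos.
Qed.

Lemma pwc_decay p n q C c :
  (forall k, pw p k <= jap k ^ n) -> decay (q + n) C c -> decay q C (pwc p c).
Proof.
  intros Hn H k. apply Rle_trans with (2 := H k).
  rewrite Cmod_pwc, pow_add, Rmult_assoc.
  apply Rmult_le_compat_l; [apply pow_le; left; apply jap_pos|].
  apply Rmult_le_compat_r; [apply Cmod_ge_0|apply Hn].
Qed.

Lemma pwc_rapid p c : rapid c -> rapid (pwc p c).
Proof.
  intros H q. destruct (pw_le_pow p) as [n Hn]. destruct (H (q + n)%nat) as [C HC].
  exists C. now apply pwc_decay with n.
Qed.

Lemma pwc_hermitian p c : hermitian c -> hermitian (pwc p c).
Proof.
  intros H k. unfold pwc. rewrite pw_opp, H.
  destruct (c k) as [a b]. unfold Cmult, Cconj, RtoC. simpl. f_equal; ring.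
Qed.

Lemma fourier_coef_hermitian f : smooth_circle f -> hermitian (fourier_coef f).
Proof. intros Hf k. now apply fourier_coef_opp. Qed.

Lemma A_syn p f : A p f = syn (pwc p (fourier_coef f)).
Proof.
  extensionality x. apply ZSeries_ext. intros k. unfold pwc, pw, jap.
  now rewrite Cmult_assoc.
Qed.

Lemma A_smooth p f : smooth_circle f -> smooth_circle (A p f).
Proof. intros Hf. rewrite A_syn. now apply syn_smooth, pwc_rapid, fourier_coef_rapid. Qed.

#[export] Hint Resolve A_smooth : smooth.

Lemma fourier_coef_A p f : smooth_circle f -> fourier_coef (A p f) = pwc p (fourier_coef f).
Proof.
  intros Hf. rewrite A_syn. apply fourier_coef_syn.
  - now apply pwc_rapid, fourier_coef_rapid.
  - now apply pwc_hermitian, fourier_coef_hermitian.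
Qed.

Lemma A_A p q f : smooth_circle f -> A p (A q f) = A (p + q) f.
Proof.
  intros Hf. rewrite A_syn, fourier_coef_A, (A_syn (p + q)) by exact Hf.
  f_equal. extensionality k. unfold pwc. rewrite pw_plus, RtoC_mult. ring.
Qed.

Lemma A_0 f : smooth_circle f -> A 0 f = f.
Proof.
  intros Hf. rewrite A_syn. rewrite <- (syn_fourier_coef f Hf) at 2. f_equal.
  extensionality k. unfold pwc. rewrite pw_0. ring.
Qed.

Lemma A_lin p a b f g :
  smooth_circle f -> smooth_circle g ->
  A p (fun x => a * f x + b * g x) = (fun x => a * A p f x + b * A p g x).
Proof.
  intros Hf Hg. extensionality x. rewrite !A_syn. unfold syn.
  destruct (pwc_rapid p _ (fourier_coef_rapid f Hf) 1%nat) as [C1 H1].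
  destruct (pwc_rapid p _ (fourier_coef_rapid g Hg) 1%nat) as [C2 H2].
  rewrite <- (ZSeries_lin C1 _ C2) by now apply syn_summable.
  apply ZSeries_ext. intros k. unfold pwc.
  rewrite fourier_coef_plus, !fourier_coef_scal by auto with smooth.
  unfold Cmult, Cplus, RtoC. simpl. ring.
Qed.

(** The weight is absorbed into a power of [1 + k ^ 2], at the price of more
    derivatives of [f]; this is enough for continuity in [C^oo]. *)
Lemma A_bnd p n :
  exists m K, forall f a, smooth_circle f -> bnd m f a -> bnd n (A p f) (K * a).
Proof.
  destruct (pw_le_pow p) as [n' Hn'].
  exists (2 * (S n + n'))%nat, (5 * (2 ^ (S n + n') * 4)).
  intros f a Hf Ha. rewrite A_syn.
  replace (5 * (2 ^ (S n + n') * 4) * a) with (5 * (2 ^ (S n + n') * (4 * a))) by ring.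
  apply syn_bnd.
  - now apply pwc_rapid, fourier_coef_rapid.
  - apply pwc_decay with n'; [exact Hn'|]. now apply fourier_coef_decay.
Qed.

Lemma mean_A_mult p f g :
  smooth_circle f -> smooth_circle g ->
  is_lim_seq (fun N => zsum N (fun k =>
      pw p k * Re (fourier_coef f k * Cconj (fourier_coef g k))%C))
    (mean (fun x => A p f x * g x)).
Proof.
  intros Hf Hg. rewrite A_syn.
  apply is_lim_seq_ext with (2 := mean_syn_mult (pwc p (fourier_coef f)) g
    (pwc_rapid p _ (fourier_coef_rapid f Hf)) Hg).
  intros N. apply zsum_ext. intros k. unfold pwc.
  rewrite <- Cmult_assoc. apply re_scal_l.
Qed.

Lemma mean_A_sym p f g :
  smooth_circle f -> smooth_circle g ->
  mean (fun x => A p f x * g x) = mean (fun x => f x * A p g x).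
Proof.
  intros Hf Hg.
  replace (fun x => f x * A p g x) with (fun x => A p g x * f x)
    by (extensionality x; ring).
  pose proof (mean_A_mult p f g Hf Hg) as L1.
  pose proof (mean_A_mult p g f Hg Hf) as L2.
  apply is_lim_seq_unique in L1, L2.
  rewrite (Lim_seq_ext _ (fun N => zsum N (fun k =>
      pw p k * Re (fourier_coef g k * Cconj (fourier_coef f k))%C))) in L1.
  - rewrite L1 in L2. now injection L2.
  - intros N. apply zsum_ext. intros k. f_equal.
    unfold Cmult, Cconj, Re. simpl. ring.
Qed.

Lemma Re_mult_conj z : Re (z * Cconj z)%C = Cmod z ^ 2.
Proof. rewrite Cmod2_alt. destruct z as [a b]. unfold Cmult, Cconj. simpl. ring. Qed.

Lemma mean_A_self p f :
  smooth_circle f ->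
  is_lim_seq (fun N => zsum N (fun k => pw p k * Cmod (fourier_coef f k) ^ 2))
    (mean (fun x => A p f x * f x)).
Proof.
  intros Hf. apply is_lim_seq_ext with (2 := mean_A_mult p f f Hf Hf).
  intros N. apply zsum_ext. intros k. now rewrite Re_mult_conj.
Qed.

(** Bessel's inequality: the quadratic forms [mean (A p f * f)] control the
    finite sums in which all the estimates are carried out. *)
Lemma zsum_le_mean_A p f N :
  smooth_circle f ->
  zsum N (fun k => pw p k * Cmod (fourier_coef f k) ^ 2) <= mean (fun x => A p f x * f x).
Proof.
  intros Hf. pose proof (mean_A_self p f Hf) as L.
  apply (is_lim_seq_incr_compare _ _ L). intros n.
  apply zsum_incr; [|lia]. intros k.
  apply Rmult_le_pos; [left; apply pw_pos|apply pow2_ge_0].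
Qed.

Lemma mean_A_self_nonneg p f :
  smooth_circle f -> 0 <= mean (fun x => A p f x * f x).
Proof.
  intros Hf. apply Rle_trans with (2 := zsum_le_mean_A p f 0 Hf). cbn [zsum].
  apply Rmult_le_pos; [left; apply pw_pos|apply pow2_ge_0].
Qed.

(** A product of three exponentials [e_j e_l e_n] has nonzero mean only if [j +
    l + n = 0]. *)
Definition tsum (N : nat) (F : Z -> Z -> Z -> R) : R :=
  zsum N (fun j => zsum N (fun l => zsum N (fun n =>
    if Z.eqb (j + l + n) 0 then F j l n else 0))).

Definition csum (N : nat) (c : Z -> Complex.C) : Complex.C :=
  (zsum N (fun k => Re (c k)), zsum N (fun k => Im (c k))).

Lemma csum_ext N c d : (forall k, c k = d k) -> csum N c = csum N d.
Proof. intros H. unfold csum. f_equal; apply zsum_ext; intros; now rewrite H. Qed.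

Lemma csum_mult_l N a c : Cmult a (csum N c) = csum N (fun k => Cmult a (c k)).
Proof.
  unfold csum, Cmult, Re, Im. cbn [fst snd].
  f_equal; rewrite <- !zsum_scal.
  - now rewrite <- zsum_minus.
  - now rewrite <- zsum_plus.
Qed.

Lemma csum_mult_r N a c : Cmult (csum N c) a = csum N (fun k => Cmult (c k) a).
Proof.
  rewrite Cmult_comm, csum_mult_l. apply csum_ext. intros; apply Cmult_comm.
Qed.

Lemma csum_psum N f x :
  smooth_circle f -> csum N (fun k => Cmult (fourier_coef f k) (e k x)) = RtoC (psum N f x).
Proof.
  intros Hf. unfold csum, RtoC. f_equal.
  set (S := zsum N _).
  assert (H : S = - S); [|lra].
  unfold S at 1. rewrite <- zsum_opp_index.
  replace (- S) with (-1 * S) by ring. unfold S. rewrite <- zsum_scal.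
  apply zsum_ext. intros k. rewrite fourier_coef_opp by exact Hf.
  unfold e, Cmult, Cconj, Im. cbn [fst snd]. rewrite opp_IZR.
  replace (- IZR k * x) with (- (IZR k * x)) by ring. rewrite cos_neg, sin_neg. ring.
Qed.

Lemma psum_product N f g h x :
  smooth_circle f -> smooth_circle g -> smooth_circle h ->
  psum N f x * psum N g x * psum N h x
  = zsum N (fun j => zsum N (fun l => zsum N (fun n =>
      Re (fourier_coef f j * fourier_coef g l * fourier_coef h n * e (j + l + n) x)%C))).
Proof.
  intros Hf Hg Hh.
  assert (E : RtoC (psum N f x * psum N g x * psum N h x)
    = csum N (fun j => csum N (fun l => csum N (fun n =>
        Cmult (Cmult (Cmult (fourier_coef f j) (fourier_coef g l)) (fourier_coef h n))
              (e (j + l + n) x))))).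
  { rewrite !RtoC_mult, <- !csum_psum, !csum_mult_r by assumption.
    apply csum_ext. intros j.
    rewrite (csum_mult_l N (Cmult (fourier_coef f j) (e j x))), csum_mult_r.
    apply csum_ext. intros l. rewrite csum_mult_l.
    apply csum_ext. intros n. rewrite !e_add. ring. }
  apply (f_equal Re) in E. exact E.
Qed.

Lemma psum_smooth N f : smooth_circle (psum N f).
Proof. apply (smooth_circle_zsum N (fun k x => Re (_ * e k x)%C)). auto with smooth. Qed.

#[export] Hint Resolve psum_smooth : smooth.

Lemma mean_psum_product N f g h :
  smooth_circle f -> smooth_circle g -> smooth_circle h ->
  mean (fun x => psum N f x * psum N g x * psum N h x)
  = tsum N (fun j l n =>
      Re (fourier_coef f j * fourier_coef g l * fourier_coef h n)%C).
Proof.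
  intros Hf Hg Hh. unfold tsum.
  set (z := fun j l n => Cmult (Cmult (fourier_coef f j) (fourier_coef g l)) (fourier_coef h n)).
  transitivity (mean (fun x => zsum N (fun j => zsum N (fun l => zsum N (fun n =>
    Re (z j l n * e (j + l + n) x)%C))))).
  { f_equal. extensionality x. now apply psum_product. }
  rewrite mean_zsum by auto 6 with smooth.
  apply zsum_ext. intros j.
  rewrite mean_zsum by auto 6 with smooth.
  apply zsum_ext. intros l.
  rewrite mean_zsum by auto 6 with smooth.
  apply zsum_ext. intros n. apply mean_Re_e.
Qed.

(** All three factors are replaced by their partial sums, although one could be
    kept: only then is the index set invariant under permutations of [j], [l],
    [n]. *)
Lemma mean_triple f g h :
  smooth_circle f -> smooth_circle g -> smooth_circle h ->
  is_lim_seq (fun N => tsum N (fun j l n =>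
      Re (fourier_coef f j * fourier_coef g l * fourier_coef h n)%C))
    (mean (fun x => f x * g x * h x)).
Proof.
  intros Hf Hg Hh.
  apply is_lim_seq_ext with (fun N => mean (fun x => psum N f x * psum N g x * psum N h x)).
  { intros N. now apply mean_psum_product. }
  assert (B : exists B, forall F, (F = f \/ F = g \/ F = h) ->
    (forall N x, Rabs (psum N F x - F x) <= B / (INR N + 1)) /\
    (forall x, Rabs (F x) <= B) /\ (forall N x, Rabs (psum N F x) <= B)).
  { assert (B1 : forall F, smooth_circle F -> exists B, forall B', B <= B' ->
      (forall N x, Rabs (psum N F x - F x) <= B' / (INR N + 1)) /\
      (forall x, Rabs (F x) <= B') /\ (forall N x, Rabs (psum N F x) <= B')).
    { intros F HF. destruct (bnd_exists 2 F HF) as [M HM].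
      pose proof (bnd_nonneg _ _ _ HM) as HM0.
      exists (601 * M). intros B' HB'.
      assert (E : forall N x, Rabs (psum N F x - F x) <= 600 * M / (INR N + 1)).
      { intros N x. apply psum_error; [exact HF|]. intros y. apply HM. lia. }
      assert (E0 : forall x, Rabs (F x) <= M) by (intros x; apply (HM 0%nat x); lia).
      assert (EN : forall N, 600 * M / (INR N + 1) <= 600 * M).
      { intros N. pose proof (pos_INR N).
        apply Rmult_le_reg_r with (INR N + 1); [lra|].
        unfold Rdiv. rewrite Rmult_assoc, Rinv_l by lra. nra. }
      repeat split.
      - intros N x. apply Rle_trans with (1 := E N x).
        apply Rmult_le_compat_r; [|lra].
        left. apply Rinv_0_lt_compat. pose proof (pos_INR N). lra.
      - intros x. specialize (E0 x). lra.
      - intros N x. replace (psum N F x) with ((psum N F x - F x) + F x) by ring.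
        apply Rle_trans with (1 := Rabs_triang _ _).
        specialize (E0 x). specialize (E N x). specialize (EN N). lra. }
    destruct (B1 f Hf) as [Bf HBf], (B1 g Hg) as [Bg HBg], (B1 h Hh) as [Bh HBh].
    exists (Rmax Bf (Rmax Bg Bh)).
    intros F [->|[->| ->]]; [apply HBf|apply HBg|apply HBh].
    - apply Rmax_l.
    - apply Rle_trans with (2 := Rmax_r _ _). apply Rmax_l.
    - apply Rle_trans with (2 := Rmax_r _ _). apply Rmax_r. }
  destruct B as [B HB].
  destruct (HB f ltac:(auto)) as [Df [Bf Pf]], (HB g ltac:(auto)) as [Dg [Bg Pg]],
    (HB h ltac:(auto)) as [Dh [Bh Ph]].
  assert (HB0 : 0 <= B) by (eapply Rle_trans; [apply Rabs_pos|apply (Bf 0)]).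
  apply is_lim_mean with (eps := fun N => (3 * B ^ 3) / (INR N + 1)).
  - auto with smooth.
  - auto with smooth.
  - intros N x. specialize (Df N x). specialize (Dg N x). specialize (Dh N x).
    set (d := B / (INR N + 1)) in *.
    replace (3 * B ^ 3 / (INR N + 1)) with (d * B * B + B * d * B + B * B * d)
      by (unfold d; field; pose proof (pos_INR N); lra).
    replace (psum N f x * psum N g x * psum N h x - f x * g x * h x)
      with ((psum N f x - f x) * psum N g x * psum N h x
            + f x * (psum N g x - g x) * psum N h x
            + f x * g x * (psum N h x - h x)) by ring.
    assert (T : forall a b c a' b' c', Rabs a <= a' -> Rabs b <= b' -> Rabs c <= c' ->
      Rabs (a * b * c) <= a' * b' * c').
    { intros a b c a' b' c' H1 H2 H3. rewrite !Rabs_mult.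
      apply Rmult_le_compat; auto using Rabs_pos.
      - apply Rmult_le_pos; apply Rabs_pos.
      - apply Rmult_le_compat; auto using Rabs_pos. }
    apply Rle_trans with (1 := Rabs_triang _ _). apply Rplus_le_compat; [|auto].
    apply Rle_trans with (1 := Rabs_triang _ _). apply Rplus_le_compat; auto.
  - apply is_lim_seq_inv_succ.
Qed.

(** * Symbol estimates *)

Lemma Rpower_base_le x y p : 0 < x <= y -> 0 <= p -> Rpower x p <= Rpower y p.
Proof. intros H Hp. now apply Rle_Rpower_l. Qed.

Lemma jap_abs_le k l c :
  1 <= c -> Rabs (IZR k) <= c * Rabs (IZR l) -> jap k <= c ^ 2 * jap l.
Proof.
  intros Hc H. unfold jap. rewrite <- (pow2_abs (IZR k)), <- (pow2_abs (IZR l)).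
  pose proof (Rabs_pos (IZR k)). pose proof (Rabs_pos (IZR l)).
  assert (Rabs (IZR k) ^ 2 <= (c * Rabs (IZR l)) ^ 2) by (apply pow_incr; lra).
  nra.
Qed.

Lemma pw_abs_le p k l c :
  0 <= p -> 1 <= c -> Rabs (IZR k) <= c * Rabs (IZR l) ->
  pw p k <= Rpower (c ^ 2) p * pw p l.
Proof.
  intros Hp Hc H. unfold pw. rewrite Rpower_mult_distr by (nra || apply jap_pos).
  apply Rpower_base_le; [|exact Hp]. split; [apply jap_pos|now apply jap_abs_le].
Qed.

Lemma pw_mono p k l : 0 <= p -> Rabs (IZR k) <= Rabs (IZR l) -> pw p k <= pw p l.
Proof.
  intros Hp H. pose proof (pw_abs_le p k l 1 Hp (Rle_refl 1)) as A.
  rewrite pow1, Rmult_1_l in A. unfold Rpower in A. rewrite ln_1, Rmult_0_r, exp_0 in A.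
  rewrite Rmult_1_l in A. now apply A.
Qed.

Lemma resonant_IZR j l n : (j + l + n = 0)%Z -> IZR n = - IZR j - IZR l.
Proof. intros H. replace n with (- j - l)%Z by lia. rewrite minus_IZR, opp_IZR. ring. Qed.

Lemma resonant_abs j l n :
  (j + l + n = 0)%Z -> Rabs (IZR n) <= Rabs (IZR j) + Rabs (IZR l).
Proof.
  intros H. rewrite (resonant_IZR j l n H).
  replace (- IZR j - IZR l) with (- (IZR j + IZR l)) by ring.
  rewrite Rabs_Ropp. apply Rabs_triang.
Qed.

(** Mean value theorem: on the segment between two comparable numbers the
    derivative [p z ^ (p - 1)] is comparable to [x ^ p / x]. *)
Lemma Rpower_diff_le p x y :
  0 <= p -> 0 < x -> x <= 4 * y -> y <= 4 * x ->
  Rabs (Rpower y p - Rpower x p)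
    <= p * (4 * Rpower 4 p * Rpower x p / x) * Rabs (y - x).
Proof.
  intros Hp Hx H1 H2.
  set (K := p * (4 * Rpower 4 p * Rpower x p / x)).
  assert (D : forall z, 0 < z -> is_derive (fun z => Rpower z p) z (p * Rpower z (p - 1))).
  { intros z Hz. apply is_derive_Reals. now apply derivable_pt_lim_power. }
  assert (B : forall z, x / 4 <= z <= 4 * x -> Rabs (p * Rpower z (p - 1)) <= K).
  { intros z [Hz1 Hz2]. assert (Hz : 0 < z) by lra.
    rewrite Rabs_mult, (Rabs_right p), Rabs_right
      by (lra || left; apply exp_pos).
    apply Rmult_le_compat_l; [exact Hp|].
    unfold Rminus. rewrite Rpower_plus, Rpower_Ropp, Rpower_1 by exact Hz.
    apply Rle_trans with (Rpower (4 * x) p * / (x / 4)).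
    - apply Rmult_le_compat.
      + left; apply exp_pos.
      + left; now apply Rinv_0_lt_compat.
      + apply Rpower_base_le; lra.
      + apply Rinv_le_contravar; lra.
    - rewrite <- Rpower_mult_distr by lra. right. field. lra. }
  destruct (Rle_dec x y) as [Hxy|Hxy].
  - rewrite (Rabs_right (y - x)) by lra.
    apply (abs_le_of_derive_le (fun z => Rpower z p) (fun z => p * Rpower z (p - 1)));
      [exact Hxy| |]; intros z Hz; [apply D|apply B]; lra.
  - rewrite Rabs_minus_sym, (Rabs_minus_sym y), (Rabs_right (x - y)) by lra.
    apply (abs_le_of_derive_le (fun z => Rpower z p) (fun z => p * Rpower z (p - 1)));
      [lra| |]; intros z Hz; [apply D|apply B]; lra.
Qed.

(** When [j] is the smallest of three resonant frequencies the other two are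
    comparable, and replacing one by the other gains a factor [j / l]. *)
Lemma pw_compare p :
  0 <= p -> exists K, 0 <= K /\ forall j l n, (j + l + n = 0)%Z ->
    Rabs (IZR j) <= Rabs (IZR l) -> Rabs (IZR j) <= Rabs (IZR n) ->
    pw p n <= K * pw p l /\
    Rabs (IZR l) * Rabs (pw p n - pw p l) <= K * (Rabs (IZR j) * pw p l).
Proof.
  intros Hp. set (c := Rpower 4 p). assert (Hc : 0 < c) by apply exp_pos.
  exists (c + 12 * p * c).
  assert (Hpc : 0 <= p * c) by (apply Rmult_le_pos; lra).
  split; [lra|]. intros j l n H Hl Hn.
  pose proof (resonant_abs j l n H) as H1.
  pose proof (resonant_abs j n l ltac:(lia)) as H2.
  pose proof (pw_pos p l) as Hpl.
  set (J := Rabs (IZR j)) in *. set (L := Rabs (IZR l)) in *.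
  assert (HJ : 0 <= J) by apply Rabs_pos. assert (HL : 0 <= L) by apply Rabs_pos.
  assert (A : pw p n <= c * pw p l).
  { replace c with (Rpower (2 ^ 2) p) by (unfold c; f_equal; ring).
    apply pw_abs_le; [exact Hp|lra|]. fold L. lra. }
  split; [nra|].
  pose proof (jap_abs_le n l 2 ltac:(lra) ltac:(fold L; lra)) as B1.
  pose proof (jap_abs_le l n 2 ltac:(lra) ltac:(fold L; lra)) as B2.
  pose proof (Rpower_diff_le p (jap l) (jap n) Hp (jap_pos l) ltac:(lra) ltac:(lra)) as D.
  fold (pw p n) (pw p l) c in D.
  assert (E : Rabs (jap n - jap l) <= 3 * L * J).
  { unfold jap. rewrite (resonant_IZR j l n H).
    replace (1 + (- IZR j - IZR l) ^ 2 - (1 + IZR l ^ 2))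
      with (IZR j * (IZR j + 2 * IZR l)) by ring.
    rewrite Rabs_mult. fold J. rewrite (Rmult_comm (3 * L)).
    apply Rmult_le_compat_l; [exact HJ|].
    apply Rle_trans with (1 := Rabs_triang _ _).
    rewrite Rabs_mult, (Rabs_right 2) by lra. fold J L. lra. }
  assert (HLj : L * L <= jap l).
  { unfold jap, L. rewrite <- (pow2_abs (IZR l)). lra. }
  pose proof (jap_pos l) as Hjl.
  apply Rle_trans with (L * (p * (4 * c * pw p l / jap l) * (3 * L * J))).
  - apply Rmult_le_compat_l; [exact HL|]. apply Rle_trans with (1 := D).
    apply Rmult_le_compat_l; [|exact E].
    apply Rmult_le_pos; [exact Hp|]. left. apply Rdiv_lt_0_compat; nra.
  - replace (L * (p * (4 * c * pw p l / jap l) * (3 * L * J)))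
      with (12 * p * c * (J * pw p l) * (L * L * / jap l)) by (field; lra).
    assert (HJp : 0 <= J * pw p l) by nra.
    assert (HX : 0 <= 12 * p * c * (J * pw p l)) by nra.
    assert (HR : L * L * / jap l <= 1).
    { apply Rmult_le_reg_r with (jap l); [exact Hjl|].
      rewrite Rmult_assoc, Rinv_l by lra. lra. }
    apply Rle_trans with (12 * p * c * (J * pw p l) * 1); [|nra].
    now apply Rmult_le_compat_l.
Qed.

(** With [m = A s u], testing [2 u_x m + u m_x] against [A r u] gives the factor
    [2 j + l], which is [j - n] for resonant frequencies. *)
Definition usymb (s r : R) (j l n : Z) : R := pw s l * pw r n * (IZR j - IZR n).

Definition usymb_sym (s r : R) (j l n : Z) : R :=
  usymb s r j l n + usymb s r l j n + usymb s r j n l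
  + usymb s r n j l + usymb s r l n j + usymb s r n l j.

(** Had [A s] and [A r] the same symbol at [l] and [n], the terms with the
    factor [l] would cancel, the frequencies [l] and [n] being almost opposite.
    What remains has either the factor [j] or, by [pw_compare], a difference of
    symbols worth [j / l]. *)
Lemma usymb_sym_min s r :
  0 <= s -> 0 <= r -> exists K, 0 <= K /\ forall j l n, (j + l + n = 0)%Z ->
    Rabs (IZR j) <= Rabs (IZR l) -> Rabs (IZR j) <= Rabs (IZR n) ->
    Rabs (usymb_sym s r j l n)
      <= K * (Rabs (IZR j) * (pw ((s + r) / 2) l * pw ((s + r) / 2) n)).
Proof.
  intros Hs Hr.
  destruct (pw_compare s Hs) as [Ka [HKa Ca]].
  destruct (pw_compare r Hr) as [Kw [HKw Cw]].
  destruct (pw_compare ((s + r) / 2) ltac:(lra)) as [Kb [HKb Cb]].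
  set (K := 6 * Kw + 4 * Ka + 2). assert (HK : 0 <= K) by (unfold K; lra).
  exists (K * Kb). split; [nra|]. intros j l n H Hl Hn.
  destruct (Ca j l n H Hl Hn) as [Ca1 Ca2].
  destruct (Cw j l n H Hl Hn) as [Cw1 Cw2].
  destruct (Cb j n l ltac:(lia) Hn Hl) as [Cb1 _].
  pose proof (pw_mono s j l Hs Hl) as Ma. pose proof (pw_mono r j l Hr Hl) as Mw.
  assert (Eb : pw s l * pw r l = pw ((s + r) / 2) l * pw ((s + r) / 2) l).
  { rewrite <- !pw_plus. f_equal. field. }
  unfold usymb_sym, usymb. rewrite (resonant_IZR j l n H).
  pose proof (pw_pos s j). pose proof (pw_pos s l). pose proof (pw_pos s n).
  pose proof (pw_pos r j). pose proof (pw_pos r l). pose proof (pw_pos r n).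
  pose proof (pw_pos ((s + r) / 2) l).
  set (aj := pw s j) in *. set (al := pw s l) in *. set (an := pw s n) in *.
  set (wj := pw r j) in *. set (wl := pw r l) in *. set (wn := pw r n) in *.
  set (bl := pw ((s + r) / 2) l) in *. set (bn := pw ((s + r) / 2) n) in *.
  set (J := Rabs (IZR j)) in *. set (L := Rabs (IZR l)) in *.
  assert (HJ : 0 <= J) by apply Rabs_pos. assert (HL : 0 <= L) by apply Rabs_pos.
  apply Rle_trans with (K * (J * (al * wl))).
  2: { rewrite Eb. rewrite Rmult_assoc. apply Rmult_le_compat_l; [exact HK|].
       replace (Kb * (J * (bl * bn))) with (J * (bl * (Kb * bn))) by ring.
       apply Rmult_le_compat_l; [exact HJ|]. apply Rmult_le_compat_l; lra. }
  (* every term carries an explicit factor j or a difference of symbols *)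
  match goal with |- Rabs ?X <= _ =>
    replace X with (IZR j * (2 * al * wn + an * wl - wj * (2 * al + an))
      + (al * (IZR l * (wn - wl)) - wl * (IZR l * (an - al))
         + wj * (IZR l * (an - al)))
      + aj * (IZR j * (wn - wl) + 2 * (IZR l * (wn - wl)))) by ring end.
  set (dw := IZR l * (wn - wl)) in *. set (da := IZR l * (an - al)) in *.
  assert (Hdw : Rabs dw <= Kw * (J * wl)) by (unfold dw; now rewrite Rabs_mult).
  assert (Hda : Rabs da <= Ka * (J * al)) by (unfold da; now rewrite Rabs_mult).
  assert (T1 : Rabs (IZR j * (2 * al * wn + an * wl - wj * (2 * al + an)))
    <= J * ((2 * Kw + Ka + 2 + Ka) * (al * wl))).
  { rewrite Rabs_mult. fold J. apply Rmult_le_compat_l; [exact HJ|].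
    assert (0 <= al * wn <= Kw * (al * wl)) by nra.
    assert (0 <= an * wl <= Ka * (al * wl)) by nra.
    assert (0 <= wj * al <= al * wl) by nra.
    assert (0 <= wj * an <= Ka * (al * wl)).
    { split; [nra|]. apply Rle_trans with (wl * an); nra. }
    apply Rabs_le. lra. }
  assert (T2 : forall c d x y, 0 <= c <= d -> Rabs x <= y -> Rabs (c * x) <= d * y).
  { intros c d x y Hc Hx. rewrite Rabs_mult, (Rabs_right c) by lra.
    apply Rmult_le_compat; try lra. apply Rabs_pos. }
  pose proof (T2 al al dw _ ltac:(lra) Hdw) as U1.
  pose proof (T2 wl wl da _ ltac:(lra) Hda) as U2.
  pose proof (T2 wj wl da _ ltac:(lra) Hda) as U3.
  pose proof (T2 aj al dw _ ltac:(lra) Hdw) as U4.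
  assert (U5 : Rabs (aj * (IZR j * (wn - wl))) <= al * (2 * (Kw * (J * wl)))).
  { apply T2; [lra|]. rewrite Rabs_mult. fold J.
    apply Rle_trans with (L * Rabs (wn - wl)); [|nra].
    apply Rmult_le_compat_r; [apply Rabs_pos|exact Hl]. }
  apply Rle_trans with (J * ((2 * Kw + Ka + 2 + Ka) * (al * wl))
    + (al * (Kw * (J * wl)) + wl * (Ka * (J * al)) + wl * (Ka * (J * al)))
    + (al * (Kw * (J * wl)) + 2 * (al * (Kw * (J * wl))))).
  - apply Rle_trans with (1 := Rabs_triang _ _). apply Rplus_le_compat.
    + apply Rle_trans with (1 := Rabs_triang _ _). apply Rplus_le_compat; [exact T1|].
      apply Rle_trans with (1 := Rabs_triang _ _). apply Rplus_le_compat; [|exact U3].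
      unfold Rminus. apply Rle_trans with (1 := Rabs_triang _ _).
      rewrite Rabs_Ropp. now apply Rplus_le_compat.
    + rewrite Rmult_plus_distr_l. apply Rle_trans with (1 := Rabs_triang _ _).
      apply Rplus_le_compat.
      * rewrite Rabs_mult, (Rabs_right aj), Rabs_mult by lra. fold J.
        apply Rle_trans with (al * (L * Rabs (wn - wl))).
        -- apply Rmult_le_compat; try lra.
           ++ apply Rmult_le_pos; [exact HJ|apply Rabs_pos].
           ++ apply Rmult_le_compat_r; [apply Rabs_pos|exact Hl].
        -- apply Rmult_le_compat_l; [lra|exact Cw2].
      * replace (aj * (2 * dw)) with (2 * (aj * dw)) by ring.
        rewrite Rabs_mult, (Rabs_right 2) by lra. apply Rmult_le_compat_l; [lra|exact U4].
  - unfold K. assert (0 <= Kw * (J * (al * wl))).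
    { apply Rmult_le_pos; [lra|]. apply Rmult_le_pos; [lra|]. nra. }
    lra.
Qed.

Lemma min_cases (P : Z -> Z -> Z -> Prop) :
  (forall j l n, P j l n -> P l j n) -> (forall j l n, P j l n -> P j n l) ->
  (forall j l n, Rabs (IZR j) <= Rabs (IZR l) -> Rabs (IZR j) <= Rabs (IZR n) -> P j l n) ->
  forall j l n, P j l n.
Proof.
  intros S1 S2 H j l n.
  destruct (Rle_lt_dec (Rabs (IZR j)) (Rabs (IZR l))) as [A|A];
    destruct (Rle_lt_dec (Rabs (IZR j)) (Rabs (IZR n))) as [B|B];
    destruct (Rle_lt_dec (Rabs (IZR l)) (Rabs (IZR n))) as [C|C];
    first [ apply H; lra | apply S1, H; lra | apply S2, S1, H; lra ].
Qed.

Lemma usymb_sym_bound s r :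
  0 <= s -> 0 <= r -> exists K, 0 <= K /\ forall j l n, (j + l + n = 0)%Z ->
    let b := pw ((s + r) / 2) in
    Rabs (usymb_sym s r j l n)
      <= K * (Rabs (IZR j) * (b l * b n)) + K * (Rabs (IZR l) * (b j * b n))
         + K * (Rabs (IZR n) * (b j * b l)).
Proof.
  intros Hs Hr. destruct (usymb_sym_min s r Hs Hr) as [K [HK B]].
  exists K. split; [exact HK|]. cbv zeta.
  apply (min_cases (fun j l n => (j + l + n = 0)%Z -> _)).
  - intros j l n H E. specialize (H ltac:(lia)).
    replace (usymb_sym s r l j n) with (usymb_sym s r j l n) by (unfold usymb_sym; ring).
    lra.
  - intros j l n H E. specialize (H ltac:(lia)).
    replace (usymb_sym s r j n l) with (usymb_sym s r j l n) by (unfold usymb_sym; ring).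
    lra.
  - intros j l n Hl Hn E. specialize (B j l n E Hl Hn).
    assert (P : forall k p q, 0 <= K * (Rabs (IZR k) * (pw ((s + r) / 2) p * pw ((s + r) / 2) q))).
    { intros k p q. apply Rmult_le_pos; [exact HK|].
      apply Rmult_le_pos; [apply Rabs_pos|]. left. apply Rmult_lt_0_compat; apply pw_pos. }
    pose proof (P l j n). pose proof (P n j l). lra.
Qed.

(** The term [kappa rho rho_x] tested against [A r u] contributes [j w_j], the
    density equation tested against [kappa A r rho] contributes [l w_l + n w_n];
    they combine because of the common factor [kappa]. *)
Definition rsymb (r : R) (j l n : Z) : R :=
  IZR j * pw r j + IZR l * pw r l + IZR n * pw r n.

Lemma rsymb_min r :
  0 <= r -> exists K, 0 <= K /\ forall j l n, (j + l + n = 0)%Z ->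
    Rabs (IZR j) <= Rabs (IZR l) -> Rabs (IZR j) <= Rabs (IZR n) ->
    Rabs (rsymb r j l n) <= K * (Rabs (IZR j) * (pw (r / 2) l * pw (r / 2) n)).
Proof.
  intros Hr. destruct (pw_compare r Hr) as [Kw [HKw Cw]].
  destruct (pw_compare (r / 2) ltac:(lra)) as [Kv [HKv Cv]].
  exists ((1 + 2 * Kw) * Kv). split; [nra|]. intros j l n H Hl Hn.
  destruct (Cw j l n H Hl Hn) as [Cw1 Cw2].
  destruct (Cv j n l ltac:(lia) Hn Hl) as [Cv1 _].
  pose proof (pw_mono r j l Hr Hl) as Mw.
  assert (Ev : pw r l = pw (r / 2) l * pw (r / 2) l).
  { rewrite <- pw_plus. f_equal. field. }
  pose proof (pw_pos (r / 2) l) as Hv. pose proof (pw_pos r j). pose proof (pw_pos r n).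
  set (J := Rabs (IZR j)) in *. assert (HJ : 0 <= J) by apply Rabs_pos.
  apply Rle_trans with ((1 + 2 * Kw) * (J * pw r l)).
  - unfold rsymb. rewrite (resonant_IZR j l n H).
    replace (IZR j * pw r j + IZR l * pw r l + (- IZR j - IZR l) * pw r n)
      with (IZR j * pw r j + (- (IZR j * pw r n) + - (IZR l * (pw r n - pw r l)))) by ring.
    apply Rle_trans with (1 := Rabs_triang _ _).
    replace ((1 + 2 * Kw) * (J * pw r l))
      with (J * pw r l + (J * (Kw * pw r l) + Kw * (J * pw r l))) by ring.
    apply Rplus_le_compat.
    + rewrite Rabs_mult, (Rabs_right (pw r j)) by lra. fold J. nra.
    + apply Rle_trans with (1 := Rabs_triang _ _). rewrite !Rabs_Ropp.
      apply Rplus_le_compat; [|now rewrite Rabs_mult].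
      rewrite Rabs_mult, (Rabs_right (pw r n)) by lra. fold J. nra.
  - rewrite Ev, Rmult_assoc. apply Rmult_le_compat_l; [lra|].
    replace (Kv * (J * (pw (r / 2) l * pw (r / 2) n)))
      with (J * (pw (r / 2) l * (Kv * pw (r / 2) n))) by ring.
    apply Rmult_le_compat_l; [exact HJ|]. apply Rmult_le_compat_l; lra.
Qed.

Lemma rsymb_swap12 r j l n : rsymb r l j n = rsymb r j l n.
Proof. unfold rsymb. ring. Qed.

Lemma rsymb_swap23 r j l n : rsymb r j n l = rsymb r j l n.
Proof. unfold rsymb. ring. Qed.

(** If a [rho]-frequency [l] is the smallest one, the derivative falling on it is
    paid for by the additional regularity [A s] of [u]. *)
Lemma rsymb_bound s r :
  0 <= s -> 0 <= r -> exists K, 0 <= K /\ forall j l n, (j + l + n = 0)%Z ->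
    let b := pw ((s + r) / 2) in let v := pw (r / 2) in
    let z k := Rabs (IZR k) * pw (- (s / 2)) k in
    Rabs (rsymb r j l n)
      <= K * (Rabs (IZR j) * (v l * v n)) + K * (z l * (b j * v n))
         + K * (z n * (b j * v l)).
Proof.
  intros Hs Hr. destruct (rsymb_min r Hr) as [K [HK B]].
  exists K. split; [exact HK|]. cbv zeta. intros j l n H.
  assert (P1 : 0 <= K * (Rabs (IZR j) * (pw (r / 2) l * pw (r / 2) n))).
  { apply Rmult_le_pos; [exact HK|].
    apply Rmult_le_pos; [apply Rabs_pos|]. left. apply Rmult_lt_0_compat; apply pw_pos. }
  assert (P2 : forall k q, 0 <= K * (Rabs (IZR k) * pw (- (s / 2)) k
    * (pw ((s + r) / 2) j * pw (r / 2) q))).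
  { intros k q. apply Rmult_le_pos; [exact HK|]. apply Rmult_le_pos.
    - apply Rmult_le_pos; [apply Rabs_pos|left; apply pw_pos].
    - left. apply Rmult_lt_0_compat; apply pw_pos. }
  pose proof (P2 l n) as P2l. pose proof (P2 n l) as P2n.
  assert (Q : forall k q, Rabs (IZR k) <= Rabs (IZR j) ->
    K * (Rabs (IZR k) * (pw (r / 2) j * pw (r / 2) q))
    <= K * (Rabs (IZR k) * pw (- (s / 2)) k * (pw ((s + r) / 2) j * pw (r / 2) q))).
  { intros k q Hk. apply Rmult_le_compat_l; [exact HK|].
    rewrite Rmult_assoc. apply Rmult_le_compat_l; [apply Rabs_pos|].
    rewrite <- Rmult_assoc. apply Rmult_le_compat_r; [left; apply pw_pos|].
    replace ((s + r) / 2) with (s / 2 + r / 2) by field. rewrite pw_plus, <- Rmult_assoc.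
    rewrite <- (Rmult_1_l (pw (r / 2) j)) at 1.
    apply Rmult_le_compat_r; [left; apply pw_pos|].
    rewrite <- (pw_0 k), <- (Rplus_opp_l (s / 2)), pw_plus.
    apply Rmult_le_compat_l; [left; apply pw_pos|]. apply pw_mono; lra. }
  destruct (Rle_lt_dec (Rabs (IZR j)) (Rabs (IZR l))) as [A1|A1];
    destruct (Rle_lt_dec (Rabs (IZR j)) (Rabs (IZR n))) as [A2|A2];
    destruct (Rle_lt_dec (Rabs (IZR l)) (Rabs (IZR n))) as [A3|A3];
    first
    [ pose proof (B j l n H ltac:(lra) ltac:(lra)); lra
    | pose proof (B l j n ltac:(lia) ltac:(lra) ltac:(lra)) as B1;
      rewrite rsymb_swap12 in B1; pose proof (Q l n ltac:(lra)); lra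
    | pose proof (B n j l ltac:(lia) ltac:(lra) ltac:(lra)) as B1;
      rewrite rsymb_swap12, rsymb_swap23 in B1; pose proof (Q n l ltac:(lra)); lra ].
Qed.

Definition tsymb (r : R) (l n : Z) : R := IZR l * pw r l + IZR n * pw r n.

(** Here nothing cancels when [l] or [n] is small compared with [j], so all the
    derivatives are left to [u], which is the known coefficient in the density
    equation. *)
Lemma tsymb_bound r :
  0 <= r -> exists K, 0 <= K /\ forall j l n, (j + l + n = 0)%Z ->
    Rabs (tsymb r l n)
      <= K * (Rabs (IZR j) * pw r j * (pw (r / 2) l * pw (r / 2) n)).
Proof.
  intros Hr. destruct (rsymb_min r Hr) as [K [HK B]].
  set (c := Rpower 4 r). assert (Hc : 0 < c) by apply exp_pos.
  exists (K + 1 + 4 * c). split; [lra|]. intros j l n H.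
  pose proof (Rabs_pos (IZR j)) as HJ. pose proof (pw_ge_1 r j Hr) as Hw.
  pose proof (pw_ge_1 (r / 2) l ltac:(lra)) as Hvl.
  pose proof (pw_ge_1 (r / 2) n ltac:(lra)) as Hvn.
  assert (Hvv : 1 <= pw (r / 2) l * pw (r / 2) n) by nra.
  set (vv := pw (r / 2) l * pw (r / 2) n) in *.
  set (J := Rabs (IZR j)) in *.
  assert (HJw : 0 <= J * pw r j) by nra.
  assert (HJv : J * pw r j <= J * pw r j * vv) by nra.
  assert (Far : Rabs (IZR l) <= 2 * J -> Rabs (IZR n) <= 2 * J ->
    Rabs (tsymb r l n) <= (K + 1 + 4 * c) * (J * pw r j * vv)).
  { intros Fl Fn.
    assert (C : forall k, Rabs (IZR k) <= 2 * J -> Rabs (IZR k * pw r k) <= 2 * J * (c * pw r j)).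
    { intros k Hk. rewrite Rabs_mult, (Rabs_right (pw r k)) by (left; apply pw_pos).
      apply Rmult_le_compat; [apply Rabs_pos|left; apply pw_pos|exact Hk|].
      replace c with (Rpower (2 ^ 2) r) by (unfold c; f_equal; ring).
      apply pw_abs_le; [exact Hr|lra|exact Hk]. }
    pose proof (C l Fl). pose proof (C n Fn).
    unfold tsymb. apply Rle_trans with (1 := Rabs_triang _ _).
    assert (4 * c * (J * pw r j) <= 4 * c * (J * pw r j * vv)) by nra.
    assert (0 <= K * (J * pw r j * vv)) by (apply Rmult_le_pos; nra).
    assert (0 <= J * pw r j * vv) by nra. lra. }
  pose proof (resonant_abs j n l ltac:(lia)) as HL.
  pose proof (resonant_abs j l n ltac:(lia)) as HN. fold J in HL, HN.
  destruct (Rle_lt_dec J (Rabs (IZR l))) as [A1|A1]; [|apply Far; lra].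
  destruct (Rle_lt_dec J (Rabs (IZR n))) as [A2|A2]; [|apply Far; lra].
  specialize (B j l n H A1 A2).
  replace (tsymb r l n) with (rsymb r j l n + - (IZR j * pw r j))
    by (unfold rsymb, tsymb; ring).
  apply Rle_trans with (1 := Rabs_triang _ _).
  rewrite Rabs_Ropp, Rabs_mult, (Rabs_right (pw r j)) by lra. fold J vv in B |- *.
  assert (K * (J * vv) <= K * (J * pw r j * vv)).
  { apply Rmult_le_compat_l; [exact HK|]. apply Rmult_le_compat_r; nra. }
  assert (0 <= 4 * c * (J * pw r j * vv)) by nra. lra.
Qed.

(** * Sums over resonant triples *)

Lemma tsum_ext N F G :
  (forall j l n, (j + l + n = 0)%Z -> F j l n = G j l n) -> tsum N F = tsum N G.
Proof.
  intros H. apply zsum_ext; intros j. apply zsum_ext; intros l. apply zsum_ext; intros n.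
  destruct (Z.eqb_spec (j + l + n) 0); auto.
Qed.

Lemma tsum_le N F G :
  (forall j l n, (j + l + n = 0)%Z -> F j l n <= G j l n) -> tsum N F <= tsum N G.
Proof.
  intros H. apply zsum_le; intros j. apply zsum_le; intros l. apply zsum_le; intros n.
  destruct (Z.eqb_spec (j + l + n) 0); [auto|lra].
Qed.

Lemma tsum_plus N F G :
  tsum N (fun j l n => F j l n + G j l n) = tsum N F + tsum N G.
Proof.
  unfold tsum. rewrite <- zsum_plus. apply zsum_ext; intros j.
  rewrite <- zsum_plus. apply zsum_ext; intros l.
  rewrite <- zsum_plus. apply zsum_ext; intros n.
  destruct (Z.eqb _ _); ring.
Qed.

Lemma tsum_scal N a F : tsum N (fun j l n => a * F j l n) = a * tsum N F.
Proof.
  unfold tsum. rewrite <- zsum_scal. apply zsum_ext; intros j.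
  rewrite <- zsum_scal. apply zsum_ext; intros l.
  rewrite <- zsum_scal. apply zsum_ext; intros n.
  destruct (Z.eqb _ _); ring.
Qed.

Lemma tsum_abs N F : Rabs (tsum N F) <= tsum N (fun j l n => Rabs (F j l n)).
Proof.
  unfold tsum. apply Rle_trans with (1 := zsum_abs _ _). apply zsum_le; intros j.
  apply Rle_trans with (1 := zsum_abs _ _). apply zsum_le; intros l.
  apply Rle_trans with (1 := zsum_abs _ _). apply zsum_le; intros n.
  destruct (Z.eqb _ _); [lra|]. rewrite Rabs_R0. lra.
Qed.

Lemma tsum_swap12 N F : tsum N (fun j l n => F l j n) = tsum N F.
Proof.
  unfold tsum. rewrite zsum_exchange.
  apply zsum_ext; intros j. apply zsum_ext; intros l. apply zsum_ext; intros n.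
  now replace (l + j + n)%Z with (j + l + n)%Z by lia.
Qed.

Lemma tsum_swap23 N F : tsum N (fun j l n => F j n l) = tsum N F.
Proof.
  unfold tsum. apply zsum_ext; intros j. rewrite zsum_exchange.
  apply zsum_ext; intros l. apply zsum_ext; intros n.
  now replace (j + n + l)%Z with (j + l + n)%Z by lia.
Qed.

Lemma tsum_rot N F : tsum N (fun j l n => F n j l) = tsum N F.
Proof.
  rewrite <- (tsum_swap12 N F). rewrite <- (tsum_swap23 N (fun j l n => F l j n)).
  reflexivity.
Qed.

Lemma tsum_two_indices N (x y : Z -> R) :
  (forall k, 0 <= x k) -> (forall k, 0 <= y k) ->
  tsum N (fun j l _ => x j * y l) <= zsum N x * zsum N y.
Proof.
  intros Hx Hy. unfold tsum.
  rewrite Rmult_comm, <- zsum_scal. apply zsum_le; intros j.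
  rewrite Rmult_comm, <- zsum_scal. apply zsum_le; intros l.
  rewrite (zsum_ext N _ (fun n => if Z.eqb n (- j - l) then x j * y l else 0)).
  - apply zsum_delta_le. now apply Rmult_le_pos.
  - intros n. destruct (Z.eqb_spec (j + l + n) 0), (Z.eqb_spec n (- j - l)); lia || reflexivity.
Qed.

(** Young's inequality, from [2 x z <= x ^ 2 + z ^ 2]: two indices determine the
    third one. *)
Lemma tsum_young N (y x z : Z -> R) :
  (forall k, 0 <= y k) ->
  tsum N (fun j l n => y j * (x l * z n))
    <= zsum N y * (/ 2 * (zsum N (fun k => x k ^ 2) + zsum N (fun k => z k ^ 2))).
Proof.
  intros Hy.
  apply Rle_trans with (tsum N (fun j l n =>
    / 2 * (y j * x l ^ 2) + / 2 * (y j * z n ^ 2))).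
  - apply tsum_le. intros j l n _. specialize (Hy j).
    assert (0 <= y j * (x l - z n) ^ 2) by (apply Rmult_le_pos; [exact Hy|apply pow2_ge_0]).
    nra.
  - rewrite tsum_plus, !tsum_scal.
    rewrite (tsum_swap23 N (fun j l _ => y j * z l ^ 2)).
    pose proof (tsum_two_indices N y (fun k => x k ^ 2) Hy (fun k => pow2_ge_0 _)).
    pose proof (tsum_two_indices N y (fun k => z k ^ 2) Hy (fun k => pow2_ge_0 _)).
    cbv beta in *. lra.
Qed.

(** This is the Sobolev embedding behind the whole proof, and what requires [3 /
    2 < s]: functions of finite energy have absolutely summable derivatives.
    The sum is compared with the telescoping sum of [x ^ - (2 s - 3)]. *)
Lemma weights_summable s :
  3 / 2 < s -> exists C, 0 <= C /\ forall N, zsum N (fun k => IZR k ^ 2 * pw (- s) k) <= C.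
Proof.
  intros Hs. set (sg := 2 * s - 3). assert (Hsg : 0 < sg) by (unfold sg; lra).
  assert (D : forall x, 0 < x ->
    is_derive (fun x => - Rpower x (- sg)) x (sg * Rpower x (- sg - 1))).
  { intros x Hx. replace (sg * Rpower x (- sg - 1)) with (- (- sg * Rpower x (- sg - 1))) by ring.
    apply (is_derive_opp (fun x => Rpower x (- sg))). apply is_derive_Reals.
    now apply derivable_pt_lim_power. }
  assert (P : forall x y, 0 < x <= y -> Rpower y (- sg - 1) <= Rpower x (- sg - 1)).
  { intros x y H. replace (- sg - 1) with (- (sg + 1)) by ring. rewrite !Rpower_Ropp.
    apply Rinv_le_contravar; [apply exp_pos|]. apply Rpower_base_le; lra. }
  assert (T : forall m, sg * Rpower (INR m + 2) (- sg - 1)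
    <= Rpower (INR m + 1) (- sg) - Rpower (INR m + 2) (- sg)).
  { intros m. pose proof (pos_INR m) as Hm.
    destruct (MVT_gen (fun x => - Rpower x (- sg)) (INR m + 1) (INR m + 2)
      (fun x => sg * Rpower x (- sg - 1))) as [c [Hc E]].
    - intros x. rewrite Rmin_left, Rmax_right by lra. intros Hx. apply D. lra.
    - intros x. rewrite Rmin_left, Rmax_right by lra. intros Hx.
      apply continuity_pt_filterlim. apply (ex_derive_continuous (fun x => - Rpower x (- sg))).
      eexists. apply D. lra.
    - rewrite Rmin_left, Rmax_right in Hc by lra.
      pose proof (P c (INR m + 2) ltac:(lra)) as B.
      apply Rmult_le_compat_l with (r := sg) in B; [|lra].
      ring_simplify (INR m + 2 - (INR m + 1)) in E. lra. }
  assert (B : forall m, IZR (Z.of_nat (S m)) ^ 2 * pw (- s) (Z.of_nat (S m))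
    <= Rpower (INR m + 1) (- sg - 1)).
  { intros m. pose proof (pos_INR m) as Hm. rewrite <- INR_IZR_INZ, S_INR.
    unfold pw, jap. rewrite <- INR_IZR_INZ, S_INR. set (x := INR m + 1) in *.
    assert (Hx : 0 < x) by (unfold x; lra).
    replace (- sg - 1) with (2 + 2 * - s) by (unfold sg; ring).
    assert (X2 : Rpower x 2 = x ^ 2)
      by (rewrite <- Rpower_pow by exact Hx; f_equal; simpl; ring).
    rewrite Rpower_plus, <- Rpower_mult, X2.
    apply Rmult_le_compat_l; [apply pow2_ge_0|]. rewrite !Rpower_Ropp.
    apply Rinv_le_contravar; [apply exp_pos|]. apply Rpower_base_le; [|lra].
    pose proof (pow_lt x 2 Hx). lra. }
  exists (2 + 2 / sg).
  assert (Hisg : 0 < / sg) by now apply Rinv_0_lt_compat.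
  split; [unfold Rdiv; lra|].
  assert (I : forall N, zsum (S N) (fun k => IZR k ^ 2 * pw (- s) k)
    <= 2 + 2 / sg * (1 - Rpower (INR N + 1) (- sg))).
  { induction N as [|N IH].
    - cbn [zsum]. rewrite pw_opp, opp_IZR.
      pose proof (B 0%nat) as B0. simpl INR in B0. rewrite Rplus_0_l in B0 |- *.
      assert (R1 : forall p, Rpower 1 p = 1)
        by (intros; unfold Rpower; rewrite ln_1, Rmult_0_r; apply exp_0).
      rewrite R1 in B0 |- *.
      replace ((- IZR (Z.of_nat 1)) ^ 2) with (IZR (Z.of_nat 1) ^ 2) by ring. lra.
    - rewrite zsum_S, S_INR.
      rewrite pw_opp, opp_IZR. pose proof (B (S N)) as BN. rewrite S_INR in BN.
      replace ((- IZR (Z.of_nat (S (S N)))) ^ 2)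
        with (IZR (Z.of_nat (S (S N))) ^ 2) by ring.
      specialize (T N).
      replace (INR N + 1 + 1) with (INR N + 2) in BN |- * by ring.
      apply Rmult_le_compat_l with (r := / sg) in T; [|lra].
      rewrite <- Rmult_assoc, Rinv_l, Rmult_1_l in T by lra.
      unfold Rdiv in *. lra. }
  intros [|N].
  - cbn [zsum]. rewrite pow_i, Rmult_0_l by lia. unfold Rdiv. lra.
  - apply Rle_trans with (1 := I N).
    assert (0 < Rpower (INR N + 1) (- sg)) by apply exp_pos.
    unfold Rdiv. nra.
Qed.

(** Cauchy-Schwarz, with the product of norms replaced by half the sum of their
    squares. *)
Lemma zsum_abs_freq_le s N C (x : Z -> R) :
  zsum N (fun k => IZR k ^ 2 * pw (- s) k) <= C ->
  zsum N (fun k => Rabs (IZR k) * x k)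
    <= / 2 * (C + zsum N (fun k => pw s k * x k ^ 2)).
Proof.
  intros HC.
  apply Rle_trans with (/ 2 * (zsum N (fun k => IZR k ^ 2 * pw (- s) k)
    + zsum N (fun k => pw s k * x k ^ 2))); [|lra].
  rewrite <- zsum_plus, <- zsum_scal. apply zsum_le. intros k.
  assert (E1 : pw s k = pw (s / 2) k ^ 2)
    by (simpl; rewrite Rmult_1_r, <- pw_plus; f_equal; field).
  assert (E2 : pw (- s) k = pw (- (s / 2)) k ^ 2)
    by (simpl; rewrite Rmult_1_r, <- pw_plus; f_equal; field).
  assert (E3 : pw (- (s / 2)) k * pw (s / 2) k = 1)
    by (rewrite <- pw_plus, Rplus_opp_l; apply pw_0).
  rewrite E1, E2, <- (pow2_abs (IZR k)).
  set (p := pw (s / 2) k) in *. set (q := pw (- (s / 2)) k) in *.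
  assert (Rabs (IZR k) * x k = Rabs (IZR k) * q * (p * x k)).
  { transitivity (Rabs (IZR k) * x k * (q * p)); [rewrite E3|]; ring. }
  pose proof (pow2_ge_0 (Rabs (IZR k) * q - p * x k)). nra.
Qed.

(** * The rate of change of the energies *)

Definition momentum_rhs (s kappa alpha : R) (u rho : R -> R) (x : R) : R :=
  alpha * Derive u x - 2 * Derive u x * A s u x - u x * Derive (A s u) x
  - kappa * rho x * Derive rho x.

Definition density_rhs (u rho : R -> R) (x : R) : R :=
  - u x * Derive rho x - Derive u x * rho x.

Lemma momentum_rhs_smooth s kappa alpha u rho :
  smooth_circle u -> smooth_circle rho -> smooth_circle (momentum_rhs s kappa alpha u rho).
Proof.
  intros Hu Hr. unfold momentum_rhs. auto 10 with smooth.
Qed.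

Lemma density_rhs_smooth u rho :
  smooth_circle u -> smooth_circle rho -> smooth_circle (density_rhs u rho).
Proof.
  intros Hu Hr.
  replace (density_rhs u rho) with (fun x => -1 * (u x * Derive rho x) - Derive u x * rho x)
    by (extensionality x; unfold density_rhs; ring).
  auto with smooth.
Qed.

#[export] Hint Resolve momentum_rhs_smooth density_rhs_smooth : smooth.

(** The factor [i] stems from the one derivative in each nonlinear term; it
    leaves a real symbol. *)
Definition triple (f g h : R -> R) (j l n : Z) : R :=
  Re ((0, 1) * (fourier_coef f j * fourier_coef g l * fourier_coef h n))%C.

Lemma triple_swap12 f g j l n : triple f f g l j n = triple f f g j l n.
Proof. unfold triple. apply (f_equal (fun z => Re ((0, 1) * z)%C)). ring. Qed.

Lemma triple_swap23 f g j l n : triple f g g j n l = triple f g g j l n.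
Proof. unfold triple. apply (f_equal (fun z => Re ((0, 1) * z)%C)). ring. Qed.

Lemma triple_abs f g h j l n :
  Rabs (triple f g h j l n)
  <= Cmod (fourier_coef f j) * (Cmod (fourier_coef g l) * Cmod (fourier_coef h n)).
Proof.
  unfold triple. apply Rle_trans with (1 := re_le_Cmod _). rewrite !Cmod_mult.
  replace (Cmod (0, 1)) with 1; [lra|].
  unfold Cmod. simpl. replace (0 * (0 * 1) + 1 * (1 * 1)) with 1 by ring. now rewrite sqrt_1.
Qed.

Lemma tsum_usymb s r u N :
  tsum N (fun j l n => usymb_sym s r j l n * triple u u u j l n)
  = 6 * tsum N (fun j l n => usymb s r j l n * triple u u u j l n).
Proof.
  set (F := fun j l n => usymb s r j l n * triple u u u j l n).
  transitivity (tsum N F + tsum N (fun j l n => F l j n) + tsum N (fun j l n => F j n l)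
    + tsum N (fun j l n => F n j l) + tsum N (fun j l n => F l n j)
    + tsum N (fun j l n => F n l j)).
  - rewrite <- !tsum_plus. apply tsum_ext. intros j l n _. unfold F, usymb_sym.
    rewrite (triple_swap12 u u j l n), (triple_swap23 u u j l n),
      (triple_swap12 u u j n l), (triple_swap23 u u l j n), (triple_swap12 u u l n j).
    rewrite ?(triple_swap23 u u l j n), ?(triple_swap23 u u j l n), ?(triple_swap12 u u j l n).
    ring.
  - rewrite (tsum_swap12 N F), (tsum_swap23 N F), (tsum_rot N F).
    assert (E2 : tsum N (fun j l n => F l n j) = tsum N F).
    { rewrite <- (tsum_rot N (fun j l n => F l n j)). reflexivity. }
    assert (E3 : tsum N (fun j l n => F n l j) = tsum N F).
    { rewrite <- (tsum_rot N F). rewrite <- (tsum_swap12 N (fun j l n => F n j l)).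
      reflexivity. }
    rewrite E2, E3. ring.
Qed.

Lemma tsum_rsymb r u rho N :
  tsum N (fun j l n => rsymb r j l n * triple u rho rho j l n)
  = - 2 * tsum N (fun j l n =>
      (pw r j * IZR n - IZR n * pw r n) * triple u rho rho j l n).
Proof.
  set (F := fun j l n => (pw r j * IZR n - IZR n * pw r n) * triple u rho rho j l n).
  replace (- 2 * tsum N F) with (- 1 * tsum N F + - 1 * tsum N F) by ring.
  rewrite <- (tsum_swap23 N F) at 2. rewrite <- !tsum_scal, <- tsum_plus.
  apply tsum_ext. intros j l n H. unfold F, rsymb.
  rewrite triple_swap23, (resonant_IZR j l n H). ring.
Qed.

Lemma tsum_tsymb r u rho N :
  tsum N (fun j l n => tsymb r l n * triple u rho rho j l n)
  = 2 * tsum N (fun j l n => IZR n * pw r n * triple u rho rho j l n).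
Proof.
  set (F := fun j l n => IZR n * pw r n * triple u rho rho j l n).
  replace (2 * tsum N F) with (tsum N F + tsum N F) by ring.
  rewrite <- (tsum_swap23 N F) at 2. rewrite <- tsum_plus.
  apply tsum_ext. intros j l n H. unfold F, tsymb. rewrite triple_swap23. ring.
Qed.

(** The symbol [i k (1 + k ^ 2) ^ r] is odd; this is why [alpha] does not
    matter. *)
Lemma mean_Derive_A r u : smooth_circle u -> mean (fun x => Derive u x * A r u x) = 0.
Proof.
  intros Hu.
  pose proof (mean_A_mult r u (Derive u) Hu (smooth_circle_Derive _ Hu)) as L.
  replace (fun x => Derive u x * A r u x) with (fun x => A r u x * Derive u x)
    by (extensionality x; ring).
  apply (is_lim_seq_eventually_const _ _ 0 0%nat) in L; [now injection L|].
  intros N _. rewrite <- (zsum_zero N). apply zsum_ext. intros k.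
  rewrite fourier_coef_Derive by exact Hu.
  destruct (fourier_coef u k) as [a b]. unfold Cmult, Cconj, Re. simpl. ring.
Qed.

Lemma mean_density_rhs_lim r u rho :
  smooth_circle u -> smooth_circle rho ->
  is_lim_seq (fun N => - 1 * tsum N (fun j l n =>
      (IZR l + IZR j) * pw r n * triple u rho rho j l n))
    (mean (fun x => density_rhs u rho x * A r rho x)).
Proof.
  intros Hu Hr.
  pose proof (smooth_circle_Derive _ Hu) as Hu'. pose proof (smooth_circle_Derive _ Hr) as Hr'.
  pose proof (A_smooth r _ Hr) as HW.
  pose proof (mean_triple u (Derive rho) (A r rho) Hu Hr' HW) as L1.
  pose proof (mean_triple (Derive u) rho (A r rho) Hu' Hr HW) as L2.
  rewrite fourier_coef_A in L1, L2 by exact Hr.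
  set (m1 := mean (fun x => u x * Derive rho x * A r rho x)) in *.
  set (m2 := mean (fun x => Derive u x * rho x * A r rho x)) in *.
  assert (E : mean (fun x => density_rhs u rho x * A r rho x) = - 1 * (m1 + m2)).
  { unfold m1, m2. rewrite <- mean_plus, <- mean_scal by auto with smooth.
    f_equal. extensionality x. unfold density_rhs. ring. }
  rewrite E. apply (is_lim_seq_scal_l _ (-1) (m1 + m2)).
  pose proof (is_lim_seq_plus' _ _ _ _ L1 L2) as L.
  apply is_lim_seq_ext with (2 := L). intros N. rewrite <- tsum_plus.
  apply tsum_ext. intros j l n _. rewrite !fourier_coef_Derive by assumption.
  unfold triple, pwc.
  destruct (fourier_coef u j), (fourier_coef rho l), (fourier_coef rho n).
  unfold Cmult, RtoC, Re. simpl. ring.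
Qed.

Lemma mean_momentum_rhs_lim s r kappa alpha u rho :
  smooth_circle u -> smooth_circle rho ->
  is_lim_seq (fun N =>
      - 1 * tsum N (fun j l n => usymb s r j l n * triple u u u j l n)
      + - kappa * tsum N (fun j l n => pw r j * IZR n * triple u rho rho j l n))
    (mean (fun x => momentum_rhs s kappa alpha u rho x * A r u x)).
Proof.
  intros Hu Hr.
  pose proof (smooth_circle_Derive _ Hu) as Hu'. pose proof (smooth_circle_Derive _ Hr) as Hr'.
  pose proof (A_smooth r _ Hu) as HW. pose proof (A_smooth s _ Hu) as Hm.
  pose proof (smooth_circle_Derive _ Hm) as Hm'.
  pose proof (mean_triple (Derive u) (A s u) (A r u) Hu' Hm HW) as L1.
  pose proof (mean_triple u (Derive (A s u)) (A r u) Hu Hm' HW) as L2.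
  pose proof (mean_triple (A r u) rho (Derive rho) HW Hr Hr') as L3.
  pose proof (mean_Derive_A r u Hu) as E0.
  set (m1 := mean (fun x => Derive u x * A s u x * A r u x)) in *.
  set (m2 := mean (fun x => u x * Derive (A s u) x * A r u x)) in *.
  set (m3 := mean (fun x => A r u x * rho x * Derive rho x)) in *.
  assert (E : mean (fun x => momentum_rhs s kappa alpha u rho x * A r u x)
    = alpha * 0 + (- 2 * m1 + (- 1 * m2 + - kappa * m3))).
  { rewrite <- E0 at 1. unfold m1, m2, m3.
    rewrite <- !mean_scal, <- !mean_plus by auto 7 with smooth.
    f_equal. extensionality x. unfold momentum_rhs. ring. }
  rewrite E, Rmult_0_r, Rplus_0_l.
  apply (is_lim_seq_scal_l _ (-2)) in L1. apply (is_lim_seq_scal_l _ (-1)) in L2.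
  apply (is_lim_seq_scal_l _ (- kappa)) in L3.
  pose proof (is_lim_seq_plus' _ _ _ _ L2 L3) as L23.
  pose proof (is_lim_seq_plus' _ _ _ _ L1 L23) as L.
  apply is_lim_seq_ext with (2 := L). intros N.
  rewrite <- Rplus_assoc. f_equal.
  - rewrite <- !tsum_scal, <- tsum_plus. apply tsum_ext. intros j l n H.
    rewrite !fourier_coef_Derive, !fourier_coef_A by assumption.
    unfold usymb, triple, pwc. rewrite (resonant_IZR j l n H).
    destruct (fourier_coef u j), (fourier_coef u l), (fourier_coef u n).
    unfold Cmult, RtoC, Re. simpl. ring.
  - f_equal. apply tsum_ext. intros j l n _.
    rewrite !fourier_coef_Derive, !fourier_coef_A by assumption.
    unfold triple, pwc.
    destruct (fourier_coef u j), (fourier_coef rho l), (fourier_coef rho n).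
    unfold Cmult, RtoC, Re. simpl. ring.
Qed.

(** The time derivative of the energy along a solution, as computed in
    [is_derive_energy] below. *)
Definition energy_rate (s r kappa alpha : R) (u rho : R -> R) : R :=
  2 * mean (fun x => momentum_rhs s kappa alpha u rho x * A r u x)
  + kappa * (2 * mean (fun x => density_rhs u rho x * A r rho x)).

Lemma energy_rate_lim s r kappa alpha u rho :
  smooth_circle u -> smooth_circle rho ->
  is_lim_seq (fun N =>
      - / 3 * tsum N (fun j l n => usymb_sym s r j l n * triple u u u j l n)
      + kappa * tsum N (fun j l n => rsymb r j l n * triple u rho rho j l n))
    (energy_rate s r kappa alpha u rho).
Proof.
  intros Hu Hr.
  pose proof (mean_momentum_rhs_lim s r kappa alpha u rho Hu Hr) as L1.
  pose proof (mean_density_rhs_lim r u rho Hu Hr) as L2.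
  apply (is_lim_seq_scal_l _ 2) in L1. apply (is_lim_seq_scal_l _ 2) in L2.
  apply (is_lim_seq_scal_l _ kappa) in L2.
  pose proof (is_lim_seq_plus' _ _ _ _ L1 L2) as L.
  apply is_lim_seq_ext with (2 := L). intros N.
  rewrite tsum_usymb, tsum_rsymb.
  set (T := tsum N (fun j l n => usymb s r j l n * triple u u u j l n)).
  replace (tsum N (fun j l n => (IZR l + IZR j) * pw r n * triple u rho rho j l n))
    with (- tsum N (fun j l n => IZR n * pw r n * triple u rho rho j l n)).
  - replace (tsum N (fun j l n => (pw r j * IZR n - IZR n * pw r n) * triple u rho rho j l n))
      with (tsum N (fun j l n => pw r j * IZR n * triple u rho rho j l n)
            + -1 * tsum N (fun j l n => IZR n * pw r n * triple u rho rho j l n)).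
    + field.
    + rewrite <- tsum_scal, <- tsum_plus. apply tsum_ext. intros; ring.
  - replace (- tsum N (fun j l n => IZR n * pw r n * triple u rho rho j l n))
      with (-1 * tsum N (fun j l n => IZR n * pw r n * triple u rho rho j l n)) by ring.
    rewrite <- tsum_scal. apply tsum_ext. intros j l n H.
    rewrite (resonant_IZR j l n H). ring.
Qed.

(** For [r = 0] both symmetrised symbols vanish for resonant frequencies: the
    energy is conserved. *)
Lemma energy_rate_0 s kappa alpha u rho :
  smooth_circle u -> smooth_circle rho -> energy_rate s 0 kappa alpha u rho = 0.
Proof.
  intros Hu Hr. pose proof (energy_rate_lim s 0 kappa alpha u rho Hu Hr) as L.
  apply (is_lim_seq_eventually_const _ _ 0 0%nat) in L; [now injection L|].
  intros N _.
  assert (Z0 : forall F : Z -> Z -> Z -> R, tsum N (fun j l n => 0 * F j l n) = 0).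
  { intros F. rewrite tsum_scal. ring. }
  rewrite (tsum_ext N _ (fun j l n => 0 * triple u u u j l n)).
  2: { intros j l n _. f_equal. unfold usymb_sym, usymb. rewrite !pw_0. ring. }
  rewrite (tsum_ext N (fun j l n => rsymb 0 j l n * _) (fun j l n => 0 * triple u rho rho j l n)).
  2: { intros j l n H. f_equal. unfold rsymb. rewrite !pw_0, (resonant_IZR j l n H). ring. }
  rewrite !Z0. ring.
Qed.

(** The square of the norm of [(u, rho)] in [H^(s+r) + H^r], with the weight
    [kappa] that makes it conserved for [r = 0]. *)
Definition energy (s r kappa : R) (u rho : R -> R) : R :=
  mean (fun x => A (s + r) u x * u x) + kappa * mean (fun x => A r rho x * rho x).

Lemma energy_nonneg s r kappa u rho :
  0 <= kappa -> smooth_circle u -> smooth_circle rho -> 0 <= energy s r kappa u rho.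
Proof.
  intros Hk Hu Hr. apply Rplus_le_le_0_compat; [now apply mean_A_self_nonneg|].
  apply Rmult_le_pos; [exact Hk|now apply mean_A_self_nonneg].
Qed.

Lemma pw_half_sq p k : pw (p / 2) k ^ 2 = pw p k.
Proof. simpl. rewrite Rmult_1_r, <- pw_plus. f_equal. field. Qed.

Lemma is_lim_seq_abs_le (u : nat -> R) (l M : R) :
  is_lim_seq u l -> (forall n, Rabs (u n) <= M) -> Rabs l <= M.
Proof.
  intros H HM. apply is_lim_seq_abs in H.
  exact (is_lim_seq_le _ _ _ _ HM H (is_lim_seq_const M)).
Qed.

Lemma tsum_usymb_bound s r :
  0 <= s -> 0 <= r -> exists K, 0 <= K /\ forall N u,
    Rabs (tsum N (fun j l n => usymb_sym s r j l n * triple u u u j l n))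
    <= K * (zsum N (fun k => Rabs (IZR k) * Cmod (fourier_coef u k))
            * zsum N (fun k => pw (s + r) k * Cmod (fourier_coef u k) ^ 2)).
Proof.
  intros Hs Hr. destruct (usymb_sym_bound s r Hs Hr) as [K [HK B]].
  exists (3 * K). split; [lra|]. intros N u.
  set (U := fun k => Cmod (fourier_coef u k)).
  assert (HU : forall k, 0 <= U k) by (intros; apply Cmod_ge_0).
  set (b := pw ((s + r) / 2)).
  set (F := fun j l n => Rabs (IZR j) * U j * (b l * U l * (b n * U n))).
  apply Rle_trans with (tsum N (fun j l n => K * F j l n)
    + tsum N (fun j l n => K * F l j n) + tsum N (fun j l n => K * F n j l)).
  - rewrite <- !tsum_plus. apply Rle_trans with (1 := tsum_abs _ _).
    apply tsum_le. intros j l n H. rewrite Rabs_mult.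
    pose proof (triple_abs u u u j l n) as T. fold (U j) (U l) (U n) in T.
    specialize (B j l n H). cbv zeta in B. fold b in B.
    apply Rle_trans with ((K * (Rabs (IZR j) * (b l * b n)) + K * (Rabs (IZR l) * (b j * b n))
         + K * (Rabs (IZR n) * (b j * b l))) * (U j * (U l * U n))).
    + apply Rmult_le_compat; auto using Rabs_pos.
    + unfold F. right. ring.
  - rewrite !tsum_scal, (tsum_swap12 N F), (tsum_rot N F).
    pose proof (tsum_young N (fun k => Rabs (IZR k) * U k) (fun k => b k * U k)
      (fun k => b k * U k)) as Y.
    assert (E : zsum N (fun k => (b k * U k) ^ 2) = zsum N (fun k => pw (s + r) k * U k ^ 2)).
    { apply zsum_ext. intros k. unfold b. now rewrite Rpow_mult_distr, pw_half_sq. }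
    cbv beta in Y. rewrite E in Y. fold F in Y.
    assert (Y' : tsum N F <= zsum N (fun k => Rabs (IZR k) * U k)
      * zsum N (fun k => pw (s + r) k * U k ^ 2)).
    { apply Rle_trans with (1 := Y (fun k => Rmult_le_pos _ _ (Rabs_pos _) (HU k))).
      right. field. }
    apply Rmult_le_compat_l with (r := K) in Y'; [|exact HK]. unfold U in Y'. lra.
Qed.

(** The square root of [kappa] is attached to every factor [rho], so that the
    bound involves only the weighted norms that occur in the energy. *)
Lemma tsum_rsymb_bound s r :
  0 <= s -> 0 <= r -> exists K, 0 <= K /\ forall N u rho kappa, 0 <= kappa ->
    Rabs (kappa * tsum N (fun j l n => rsymb r j l n * triple u rho rho j l n))
    <= K * (zsum N (fun k => Rabs (IZR k) * Cmod (fourier_coef u k))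
            * (kappa * zsum N (fun k => pw r k * Cmod (fourier_coef rho k) ^ 2))
        + zsum N (fun k => Rabs (IZR k) * (pw (- (s / 2)) k * (sqrt kappa * Cmod (fourier_coef rho k))))
          * (zsum N (fun k => pw (s + r) k * Cmod (fourier_coef u k) ^ 2)
             + kappa * zsum N (fun k => pw r k * Cmod (fourier_coef rho k) ^ 2))).
Proof.
  intros Hs Hr. destruct (rsymb_bound s r Hs Hr) as [K [HK B]].
  exists K. split; [exact HK|]. intros N u rho kappa Hk.
  set (U := fun k => Cmod (fourier_coef u k)).
  set (P := fun k => Cmod (fourier_coef rho k)).
  assert (HU : forall k, 0 <= U k) by (intros; apply Cmod_ge_0).
  assert (HP : forall k, 0 <= P k) by (intros; apply Cmod_ge_0).
  pose proof (sqrt_sqrt kappa Hk) as Hsq. pose proof (sqrt_pos kappa) as Hq.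
  set (q := sqrt kappa) in *.
  set (b := pw ((s + r) / 2)). set (v := pw (r / 2)). set (w := pw (- (s / 2))).
  set (F := fun j l n => Rabs (IZR j) * U j * (v l * P l * (v n * P n))).
  set (H := fun j l n => Rabs (IZR j) * (w j * (q * P j)) * (b l * U l * (q * (v n * P n)))).
  apply Rle_trans with (tsum N (fun j l n => K * kappa * F j l n)
    + tsum N (fun j l n => K * H l j n) + tsum N (fun j l n => K * H n j l)).
  - rewrite <- tsum_scal, <- !tsum_plus. apply Rle_trans with (1 := tsum_abs _ _).
    apply tsum_le. intros j l n E. rewrite !Rabs_mult, (Rabs_right kappa) by lra.
    pose proof (triple_abs u rho rho j l n) as T. fold (U j) (P l) (P n) in T.
    specialize (B j l n E). cbv zeta in B. fold b v w in B.
    apply Rle_trans with (kappa * ((K * (Rabs (IZR j) * (v l * v n))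
      + K * (Rabs (IZR l) * w l * (b j * v n)) + K * (Rabs (IZR n) * w n * (b j * v l)))
      * (U j * (P l * P n)))).
    + apply Rmult_le_compat_l; [exact Hk|]. apply Rmult_le_compat; auto using Rabs_pos.
    + unfold F, H. rewrite <- Hsq. right. ring.
  - rewrite !tsum_scal, (tsum_swap12 N H), (tsum_rot N H).
    pose proof (tsum_young N (fun k => Rabs (IZR k) * U k) (fun k => v k * P k)
      (fun k => v k * P k)) as Y1.
    pose proof (tsum_young N (fun k => Rabs (IZR k) * (w k * (q * P k))) (fun k => b k * U k)
      (fun k => q * (v k * P k))) as Y2.
    assert (E1 : zsum N (fun k => (b k * U k) ^ 2) = zsum N (fun k => pw (s + r) k * U k ^ 2)).
    { apply zsum_ext. intros k. unfold b. now rewrite Rpow_mult_distr, pw_half_sq. }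
    assert (E2 : zsum N (fun k => (v k * P k) ^ 2) = zsum N (fun k => pw r k * P k ^ 2)).
    { apply zsum_ext. intros k. unfold v. now rewrite Rpow_mult_distr, pw_half_sq. }
    assert (E3 : zsum N (fun k => (q * (v k * P k)) ^ 2)
                 = kappa * zsum N (fun k => pw r k * P k ^ 2)).
    { rewrite <- E2, <- zsum_scal. apply zsum_ext. intros k. rewrite <- Hsq. ring. }
    cbv beta in Y1, Y2. rewrite E2 in Y1. rewrite E1, E3 in Y2. fold F in Y1. fold H in Y2.
    specialize (Y1 (fun k => Rmult_le_pos _ _ (Rabs_pos _) (HU k))).
    assert (Hz : forall k, 0 <= Rabs (IZR k) * (w k * (q * P k))).
    { intros k. apply Rmult_le_pos; [apply Rabs_pos|].
      apply Rmult_le_pos; [left; apply pw_pos|]. now apply Rmult_le_pos. }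
    specialize (Y2 Hz).
    apply Rmult_le_compat_l with (r := K * kappa) in Y1; [|now apply Rmult_le_pos].
    apply Rmult_le_compat_l with (r := K) in Y2; [|exact HK].
    unfold U, P in Y1, Y2. lra.
Qed.

(** The higher energies grow at most linearly in themselves: the factor that
    carries few derivatives is controlled by the conserved energy. *)
Lemma energy_rate_bound s r :
  3 / 2 < s -> 0 <= r -> exists K, 0 <= K /\ forall kappa alpha u rho,
    0 <= kappa -> smooth_circle u -> smooth_circle rho ->
    Rabs (energy_rate s r kappa alpha u rho)
      <= K * (1 + energy s 0 kappa u rho) * energy s r kappa u rho.
Proof.
  intros Hs Hr.
  destruct (tsum_usymb_bound s r ltac:(lra) Hr) as [K1 [HK1 B1]].
  destruct (tsum_rsymb_bound s r ltac:(lra) Hr) as [K2 [HK2 B2]].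
  destruct (weights_summable s Hs) as [C [HC W]].
  exists ((K1 + 2 * K2) * (C + 1)). split; [nra|].
  intros kappa alpha u rho Hk Hu Hrho.
  set (E0 := energy s 0 kappa u rho). set (E := energy s r kappa u rho).
  apply is_lim_seq_abs_le with (1 := energy_rate_lim s r kappa alpha u rho Hu Hrho).
  intros N. specialize (B1 N u). specialize (B2 N u rho kappa Hk).
  pose proof (zsum_abs_freq_le s N C (fun k => Cmod (fourier_coef u k)) (W N)) as S1.
  pose proof (zsum_abs_freq_le s N C
    (fun k => pw (- (s / 2)) k * (sqrt kappa * Cmod (fourier_coef rho k))) (W N)) as S2.
  assert (ES2 : zsum N (fun k => pw s k * (pw (- (s / 2)) k
      * (sqrt kappa * Cmod (fourier_coef rho k))) ^ 2)
    = kappa * zsum N (fun k => pw 0 k * Cmod (fourier_coef rho k) ^ 2)).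
  { rewrite <- zsum_scal. apply zsum_ext. intros k.
    rewrite !Rpow_mult_distr, pow2_sqrt by exact Hk.
    replace (- (s / 2)) with (- s / 2) by field. rewrite pw_half_sq.
    rewrite <- !Rmult_assoc, <- pw_plus, Rplus_opp_r. ring. }
  cbv beta in S1, S2. rewrite ES2 in S2. clear ES2.
  pose proof (zsum_le_mean_A s u N Hu) as M1.
  pose proof (zsum_le_mean_A 0 rho N Hrho) as M2.
  pose proof (zsum_le_mean_A (s + r) u N Hu) as M3.
  pose proof (zsum_le_mean_A r rho N Hrho) as M4.
  apply Rmult_le_compat_l with (r := kappa) in M2, M4; try exact Hk.
  assert (HE0 : E0 = mean (fun x => A s u x * u x) + kappa * mean (fun x => A 0 rho x * rho x))
    by (unfold E0, energy; now rewrite Rplus_0_r).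
  assert (HE : E = mean (fun x => A (s + r) u x * u x) + kappa * mean (fun x => A r rho x * rho x))
    by reflexivity.
  pose proof (mean_A_self_nonneg s u Hu) as N1.
  pose proof (Rmult_le_pos _ _ Hk (mean_A_self_nonneg 0 rho Hrho)) as N2.
  pose proof (mean_A_self_nonneg (s + r) u Hu) as N3.
  pose proof (Rmult_le_pos _ _ Hk (mean_A_self_nonneg r rho Hrho)) as N4.
  assert (Q1 : 0 <= zsum N (fun k => pw (s + r) k * Cmod (fourier_coef u k) ^ 2)).
  { apply zsum_nonneg. intros k. apply Rmult_le_pos; [left; apply pw_pos|apply pow2_ge_0]. }
  assert (Q2 : 0 <= kappa * zsum N (fun k => pw r k * Cmod (fourier_coef rho k) ^ 2)).
  { apply Rmult_le_pos; [exact Hk|]. apply zsum_nonneg. intros k.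
    apply Rmult_le_pos; [left; apply pw_pos|apply pow2_ge_0]. }
  set (f1 := zsum N (fun k => Rabs (IZR k) * Cmod (fourier_coef u k))) in *.
  set (f2 := zsum N (fun k => Rabs (IZR k) * (pw (- (s / 2)) k * _))) in *.
  set (g1 := zsum N (fun k => pw (s + r) k * Cmod (fourier_coef u k) ^ 2)) in *.
  set (g2 := kappa * zsum N (fun k => pw r k * Cmod (fourier_coef rho k) ^ 2)) in *.
  assert (F1 : f1 <= (C + 1) * (1 + E0)) by nra.
  assert (F2 : f2 <= (C + 1) * (1 + E0)) by nra.
  set (G := (C + 1) * (1 + E0)) in *.
  assert (HG : 0 <= G) by (unfold G; nra).
  assert (P1 : f1 * g1 <= G * E).
  { apply Rle_trans with (G * g1); [now apply Rmult_le_compat_r|].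
    apply Rmult_le_compat_l; lra. }
  assert (P2 : f1 * g2 <= G * E).
  { apply Rle_trans with (G * g2); [now apply Rmult_le_compat_r|].
    apply Rmult_le_compat_l; lra. }
  assert (P3 : f2 * (g1 + g2) <= G * E).
  { apply Rle_trans with (G * (g1 + g2)); [apply Rmult_le_compat_r; lra|].
    apply Rmult_le_compat_l; lra. }
  apply Rmult_le_compat_l with (r := K1) in P1; [|exact HK1].
  apply Rle_trans with (1 := Rabs_triang _ _).
  rewrite (Rabs_mult (- / 3)), Rabs_Ropp, (Rabs_right (/ 3)) by lra.
  replace ((K1 + 2 * K2) * (C + 1) * (1 + E0) * E) with (K1 * (G * E) + K2 * (2 * (G * E)))
    by (unfold G; ring).
  apply Rplus_le_compat.
  - pose proof (Rabs_pos (tsum N (fun j l n => usymb_sym s r j l n * triple u u u j l n))). lra.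
  - apply Rle_trans with (1 := B2). apply Rmult_le_compat_l; [exact HK2|]. lra.
Qed.

(** For a given [u] the density equation is linear; this bound does not rely on
    the energy, which says nothing about [rho] when [kappa = 0]. *)
Lemma density_rate_bound s r :
  3 / 2 < s -> 0 <= r -> exists K, 0 <= K /\ forall u rho,
    smooth_circle u -> smooth_circle rho ->
    Rabs (2 * mean (fun x => density_rhs u rho x * A r rho x))
      <= K * (1 + mean (fun x => A (s + 2 * r) u x * u x))
         * mean (fun x => A r rho x * rho x).
Proof.
  intros Hs Hr. destruct (tsymb_bound r Hr) as [K [HK B]].
  destruct (weights_summable s Hs) as [C [HC W]].
  exists (K * (C + 1)). split; [nra|]. intros u rho Hu Hrho.
  pose proof (mean_density_rhs_lim r u rho Hu Hrho) as L.
  apply (is_lim_seq_scal_l _ 2) in L.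
  apply is_lim_seq_abs_le with (1 := L). intros N.
  replace (2 * (-1 * tsum N (fun j l n => (IZR l + IZR j) * pw r n * triple u rho rho j l n)))
    with (tsum N (fun j l n => tsymb r l n * triple u rho rho j l n)).
  2: { rewrite tsum_tsymb, <- !tsum_scal. apply tsum_ext. intros j l n H.
       rewrite (resonant_IZR j l n H). ring. }
  set (U := fun k => Cmod (fourier_coef u k)).
  set (P := fun k => Cmod (fourier_coef rho k)).
  assert (HU : forall k, 0 <= U k) by (intros; apply Cmod_ge_0).
  assert (HP : forall k, 0 <= P k) by (intros; apply Cmod_ge_0).
  set (v := pw (r / 2)).
  apply Rle_trans with (K * tsum N (fun j l n =>
    Rabs (IZR j) * (pw r j * U j) * (v l * P l * (v n * P n)))).
  - rewrite <- tsum_scal. apply Rle_trans with (1 := tsum_abs _ _).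
    apply tsum_le. intros j l n E. rewrite Rabs_mult.
    pose proof (triple_abs u rho rho j l n) as T. fold (U j) (P l) (P n) in T.
    specialize (B j l n E). fold v in B.
    apply Rle_trans with (K * (Rabs (IZR j) * pw r j * (v l * v n)) * (U j * (P l * P n))).
    + apply Rmult_le_compat; auto using Rabs_pos.
    + right. ring.
  - pose proof (tsum_young N (fun k => Rabs (IZR k) * (pw r k * U k)) (fun k => v k * P k)
      (fun k => v k * P k)) as Y.
    assert (E2 : zsum N (fun k => (v k * P k) ^ 2) = zsum N (fun k => pw r k * P k ^ 2)).
    { apply zsum_ext. intros k. unfold v. now rewrite Rpow_mult_distr, pw_half_sq. }
    cbv beta in Y. rewrite E2 in Y.
    assert (Hz : forall k, 0 <= Rabs (IZR k) * (pw r k * U k)).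
    { intros k. apply Rmult_le_pos; [apply Rabs_pos|].
      apply Rmult_le_pos; [left; apply pw_pos|auto]. }
    specialize (Y Hz).
    pose proof (zsum_abs_freq_le s N C (fun k => pw r k * U k) (W N)) as S1.
    cbv beta in S1. rewrite (zsum_ext N (fun k => pw s k * _) (fun k => pw (s + 2 * r) k * U k ^ 2)) in S1.
    2: { intros k. replace (s + 2 * r) with (s + (r + r)) by ring. rewrite !pw_plus. ring. }
    pose proof (zsum_le_mean_A (s + 2 * r) u N Hu) as M1.
    pose proof (zsum_le_mean_A r rho N Hrho) as M2.
    pose proof (mean_A_self_nonneg (s + 2 * r) u Hu) as N1.
    unfold U, P in S1, Y, Hz |- *.
    assert (Q : 0 <= zsum N (fun k => pw r k * Cmod (fourier_coef rho k) ^ 2)).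
    { apply zsum_nonneg. intros k. apply Rmult_le_pos; [left; apply pw_pos|apply pow2_ge_0]. }
    rewrite !Rmult_assoc. apply Rmult_le_compat_l; [exact HK|].
    apply Rle_trans with (1 := Y).
    set (M := mean (fun x => A (s + 2 * r) u x * u x)) in *.
    set (Z := zsum N (fun k => pw r k * Cmod (fourier_coef rho k) ^ 2)) in *.
    replace (/ 2 * (Z + Z)) with Z by field.
    rewrite <- Rmult_assoc. apply Rmult_le_compat; try lra.
    + now apply zsum_nonneg.
    + nra.
Qed.

(** * Differential calculus of curves of smooth functions *)

(** Continuous linear operators on the Frechet space of smooth functions; the
    system is built from these and from products. *)
Record linop (Op : (R -> R) -> R -> R) : Prop := {
  linop_smooth : forall f, smooth_circle f -> smooth_circle (Op f);
  linop_lin : forall a b f g, smooth_circle f -> smooth_circle g ->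
    Op (fun x => a * f x + b * g x) = (fun x => a * Op f x + b * Op g x);
  linop_bnd : forall n, exists m K, forall f a,
    smooth_circle f -> bnd m f a -> bnd n (Op f) (K * a)
}.

Lemma linop_Derive : linop Derive.
Proof.
  split.
  - apply smooth_circle_Derive.
  - intros a b f g Hf Hg. extensionality x. apply is_derive_unique.
    apply (is_derive_plus (fun x => a * f x)); apply (is_derive_scal _ x);
      now apply smooth_circle_is_derive.
  - intros n. exists (S n), 1. intros f a _ H. rewrite Rmult_1_l. now apply bnd_Derive.
Qed.

Lemma linop_A p : linop (A p).
Proof.
  split; [apply A_smooth|intros; now apply A_lin|apply A_bnd].
Qed.

Lemma linop_scal c : linop (fun f x => c * f x).
Proof.
  split.
  - intros f. apply smooth_circle_scal.
  - intros. extensionality x. ring.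
  - intros n. exists n, (Rabs c). intros f a _. apply bnd_scal.
Qed.

Lemma linop_minus Op f g :
  linop Op -> smooth_circle f -> smooth_circle g ->
  Op (fun x => f x - g x) = (fun x => Op f x - Op g x).
Proof.
  intros H Hf Hg.
  replace (fun x => f x - g x) with (fun x => 1 * f x + -1 * g x)
    by (extensionality x; ring).
  rewrite (linop_lin _ H) by assumption. extensionality x. ring.
Qed.

(** Convergence in the Frechet space along a filter.  One notion serves for
    difference quotients (filter [increments]) and for limits at the end of a
    time interval (filter [at_left]). *)
Definition conv (F : (R -> Prop) -> Prop) (phi : R -> R -> R) (f : R -> R) : Prop :=
  smooth_circle f /\ F (fun h => smooth_circle (phi h)) /\
  forall n eps, 0 < eps -> F (fun h => bnd n (fun x => phi h x - f x) eps).

Lemma conv_ext {F} {FF : Filter F} phi psi f :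
  F (fun h => phi h = psi h) -> conv F phi f -> conv F psi f.
Proof.
  intros E [Hf [Hs Hc]]. split; [exact Hf|]. split.
  - generalize (filter_and _ _ E Hs). apply filter_imp. now intros h [<- H].
  - intros n eps Heps. generalize (filter_and _ _ E (Hc n eps Heps)).
    apply filter_imp. now intros h [<- H].
Qed.

Lemma conv_const {F} {FF : Filter F} f : smooth_circle f -> conv F (fun _ => f) f.
Proof.
  intros Hf. split; [exact Hf|]. split; [now apply filter_forall|].
  intros n eps Heps. apply filter_forall. intros _ i x _.
  rewrite Derive_n_minus_smooth, Rminus_diag, Rabs_R0 by assumption. lra.
Qed.

Lemma conv_plus {F} {FF : Filter F} phi psi f g :
  conv F phi f -> conv F psi g -> conv F (fun h x => phi h x + psi h x) (fun x => f x + g x).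
Proof.
  intros [Hf [Sf Cf]] [Hg [Sg Cg]]. split; [now apply smooth_circle_plus|]. split.
  - generalize (filter_and _ _ Sf Sg). apply filter_imp. intros h [H1 H2].
    now apply smooth_circle_plus.
  - intros n eps Heps. assert (He2 : 0 < eps / 2) by lra.
    generalize (filter_and _ _ (filter_and _ _ Sf Sg)
      (filter_and _ _ (Cf n _ He2) (Cg n _ He2))).
    apply filter_imp. intros h [[H1 H2] [H3 H4]].
    replace (fun x => phi h x + psi h x - (f x + g x))
      with (fun x => (phi h x - f x) + (psi h x - g x)) by (extensionality x; ring).
    replace eps with (eps / 2 + eps / 2) by field.
    apply bnd_plus; auto using smooth_circle_minus.
Qed.

Lemma conv_op {F} {FF : Filter F} Op phi f :
  linop Op -> conv F phi f -> conv F (fun h => Op (phi h)) (Op f).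
Proof.
  intros HO [Hf [Sf Cf]]. split; [now apply (linop_smooth _ HO)|]. split.
  - revert Sf. apply filter_imp. intros h. apply (linop_smooth _ HO).
  - intros n eps Heps. destruct (linop_bnd _ HO n) as [m [K HK]].
    pose proof (Rabs_pos K) as HK0.
    assert (He : 0 < eps / (Rabs K + 1)) by (apply Rdiv_lt_0_compat; lra).
    generalize (filter_and _ _ Sf (Cf m _ He)). apply filter_imp. intros h [H1 H2].
    rewrite <- (linop_minus Op (phi h) f HO H1 Hf).
    apply (bnd_le n n _ (K * (eps / (Rabs K + 1)))); [lia| |].
    + apply Rle_trans with ((Rabs K + 1) * (eps / (Rabs K + 1))); [|right; field; lra].
      apply Rmult_le_compat_r; [lra|]. pose proof (Rle_abs K). lra.
    + apply HK; [now apply smooth_circle_minus|exact H2].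
Qed.

Lemma conv_mult {F} {FF : Filter F} phi psi f g :
  conv F phi f -> conv F psi g -> conv F (fun h x => phi h x * psi h x) (fun x => f x * g x).
Proof.
  intros [Hf [Sf Cf]] [Hg [Sg Cg]]. split; [now apply smooth_circle_mult|]. split.
  - generalize (filter_and _ _ Sf Sg). apply filter_imp. intros h [H1 H2].
    now apply smooth_circle_mult.
  - intros n eps Heps.
    destruct (bnd_exists n f Hf) as [a Ha]. destruct (bnd_exists n g Hg) as [b Hb].
    pose proof (bnd_nonneg _ _ _ Ha) as Ha0. pose proof (bnd_nonneg _ _ _ Hb) as Hb0.
    pose proof (pow_lt 2 n ltac:(lra)) as H2n.
    assert (HD : 0 < 2 ^ n * (1 + a + b)) by (apply Rmult_lt_0_compat; lra).
    set (d := Rmin 1 (eps / (2 ^ n * (1 + a + b)))).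
    assert (Hd : 0 < d) by (apply Rmin_pos; [lra|now apply Rdiv_lt_0_compat]).
    assert (Hd1 : d <= 1) by apply Rmin_l.
    assert (Hd2 : d <= eps / (2 ^ n * (1 + a + b))) by apply Rmin_r.
    generalize (filter_and _ _ (filter_and _ _ Sf Sg)
      (filter_and _ _ (Cf n d Hd) (Cg n d Hd))).
    apply filter_imp. intros h [[H1 H2] [H3 H4]].
    replace (fun x => phi h x * psi h x - f x * g x)
      with (fun x => ((phi h x - f x) * (psi h x - g x) + (phi h x - f x) * g x)
                     + f x * (psi h x - g x)) by (extensionality x; ring).
    apply (bnd_le n n _ (2 ^ n * (d * d) + 2 ^ n * (d * b) + 2 ^ n * (a * d))); [lia| |].
    + replace (2 ^ n * (d * d) + 2 ^ n * (d * b) + 2 ^ n * (a * d))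
        with (2 ^ n * (d + a + b) * d) by ring.
      apply Rle_trans with (2 ^ n * (1 + a + b) * (eps / (2 ^ n * (1 + a + b))));
        [|right; field; lra].
      apply Rmult_le_compat; [|lra| |exact Hd2].
      * apply Rmult_le_pos; lra.
      * apply Rmult_le_compat_l; lra.
    + assert (S1 : smooth_circle (fun x => phi h x - f x)) by now apply smooth_circle_minus.
      assert (S2 : smooth_circle (fun x => psi h x - g x)) by now apply smooth_circle_minus.
      apply bnd_plus; [|now apply smooth_circle_mult| |now apply bnd_mult].
      * apply smooth_circle_plus; now apply smooth_circle_mult.
      * apply bnd_plus; try now apply smooth_circle_mult.
        -- now apply bnd_mult.
        -- now apply bnd_mult.
Qed.

Lemma ball_R (x y eps : R) : ball x eps y <-> Rabs (y - x) < eps.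
Proof. reflexivity. Qed.

(** The restriction to [J] gives one-sided derivatives at end points. *)
Definition increments (J : R -> Prop) (t : R) : (R -> Prop) -> Prop :=
  within (fun h => h <> 0 /\ J (t + h)) (locally 0).

#[export] Instance increments_filter J t : Filter (increments J t).
Proof. apply within_filter. apply locally_filter. Qed.

Lemma increments_iff J t (P : R -> Prop) :
  increments J t P <->
  exists delta, 0 < delta /\ forall h, h <> 0 -> Rabs h < delta -> J (t + h) -> P h.
Proof.
  unfold increments, within. split.
  - intros [d H]. exists d. split; [apply cond_pos|]. intros h H0 Hh HJ.
    apply H; [|now split]. apply ball_R. now rewrite Rminus_0_r.
  - intros [d [Hd H]]. exists (mkposreal d Hd). intros h Hh [H0 HJ].
    change (Rabs (h - 0) < d) in Hh.
    rewrite Rminus_0_r in Hh. now apply H.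
Qed.

Definition quotient (v : R -> R -> R) (t h x : R) : R := / h * (v (t + h) x - v t x).

(** Reduces the rules for derivatives of curves to the rules for limits. *)
Lemma curve_derive_conv J v t w :
  (forall t, J t -> smooth_circle (v t)) -> J t -> smooth_circle w ->
  is_curve_derive J v t w <-> conv (increments J t) (quotient v t) w.
Proof.
  intros Hv Ht Hw.
  assert (E : forall h n x, J (t + h) ->
    Derive_n (fun x => quotient v t h x - w x) n x
    = (Derive_n (v (t + h)) n x - Derive_n (v t) n x) / h - Derive_n w n x).
  { intros h n x HJ. unfold quotient.
    rewrite (Derive_n_minus_smooth (fun x => / h * (v (t + h) x - v t x)));
      [|apply smooth_circle_scal, smooth_circle_minus; auto|exact Hw].
    rewrite Derive_n_scal_l, Derive_n_minus_smooth by auto.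
    unfold Rdiv. ring. }
  split.
  - intros H. split; [exact Hw|]. split.
    + apply increments_iff. exists 1. split; [lra|]. intros h _ _ HJ.
      apply smooth_circle_scal, smooth_circle_minus; auto.
    + intros n eps Heps. induction n as [|n IH].
      * destruct (H 0%nat eps Heps) as [d [Hd Hb]]. apply increments_iff.
        exists d. split; [exact Hd|]. intros h H0 Hh HJ i x Hi.
        replace i with 0%nat by lia. rewrite E by exact HJ. now apply Hb.
      * destruct (H (S n) eps Heps) as [d [Hd Hb]].
        assert (IH' : increments J t (fun h => forall x,
          Rabs (Derive_n (fun x => quotient v t h x - w x) (S n) x) <= eps)).
        { apply increments_iff. exists d. split; [exact Hd|]. intros h H0 Hh HJ x.
          rewrite E by exact HJ. now apply Hb. }
        generalize (filter_and _ _ IH IH'). apply filter_imp.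
        intros h [H1 H2] i x Hi. destruct (Nat.eq_dec i (S n)) as [->|Hne]; [apply H2|].
        apply H1. lia.
  - intros [_ [_ Hc]] n eps Heps. specialize (Hc n eps Heps).
    apply increments_iff in Hc. destruct Hc as [d [Hd Hb]].
    exists d. split; [exact Hd|]. intros h x H0 Hh HJ.
    rewrite <- E by exact HJ. now apply (Hb h H0 Hh HJ).
Qed.

Lemma conv_increments J t : conv (increments J t) (fun h _ => h) (fun _ => 0).
Proof.
  split; [apply smooth_circle_const|]. split.
  - apply filter_forall. intros h. apply smooth_circle_const.
  - intros n eps Heps. apply increments_iff. exists eps. split; [exact Heps|].
    intros h _ Hh _ i x _.
    rewrite (Derive_n_ext _ (fun _ => h)) by (intros; ring).
    rewrite Derive_n_const. destruct i; [lra|]. rewrite Rabs_R0. lra.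
Qed.

Lemma curve_derive_continuous J v t w :
  (forall t, J t -> smooth_circle (v t)) -> J t -> smooth_circle w ->
  is_curve_derive J v t w -> conv (increments J t) (fun h => v (t + h)) (v t).
Proof.
  intros Hv Ht Hw H. apply curve_derive_conv in H; auto.
  pose proof (conv_plus _ _ _ _ (conv_const (v t) (Hv t Ht))
    (conv_mult _ _ _ _ (conv_increments J t) H)) as C.
  replace (v t) with (fun x => v t x + 0 * w x) by (extensionality x; ring).
  apply conv_ext with (2 := C). apply increments_iff. exists 1. split; [lra|].
  intros h H0 _ _. extensionality x. unfold quotient. field. exact H0.
Qed.

Lemma curve_derive_plus J v v' t w w' :
  (forall t, J t -> smooth_circle (v t)) -> (forall t, J t -> smooth_circle (v' t)) ->
  J t -> smooth_circle w -> smooth_circle w' ->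
  is_curve_derive J v t w -> is_curve_derive J v' t w' ->
  is_curve_derive J (fun t x => v t x + v' t x) t (fun x => w x + w' x).
Proof.
  intros Hv Hv' Ht Hw Hw' H H'.
  apply curve_derive_conv in H; auto. apply curve_derive_conv in H'; auto.
  apply curve_derive_conv; auto using smooth_circle_plus.
  apply conv_ext with (2 := conv_plus _ _ _ _ H H').
  apply filter_forall. intros h. extensionality x. unfold quotient. ring.
Qed.

Lemma curve_derive_op Op J v t w :
  linop Op -> (forall t, J t -> smooth_circle (v t)) -> J t -> smooth_circle w ->
  is_curve_derive J v t w -> is_curve_derive J (fun t => Op (v t)) t (Op w).
Proof.
  intros HO Hv Ht Hw H. pose proof (linop_smooth _ HO) as HS.
  apply curve_derive_conv in H; auto. apply curve_derive_conv; auto.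
  apply conv_ext with (2 := conv_op _ _ _ HO H).
  apply increments_iff. exists 1. split; [lra|]. intros h _ _ HJ.
  unfold quotient.
  replace (fun x => / h * (v (t + h) x - v t x))
    with (fun x => / h * v (t + h) x + - / h * v t x) by (extensionality x; ring).
  rewrite (linop_lin _ HO) by auto. extensionality x. ring.
Qed.

Lemma curve_derive_mult J v v' t w w' :
  (forall t, J t -> smooth_circle (v t)) -> (forall t, J t -> smooth_circle (v' t)) ->
  J t -> smooth_circle w -> smooth_circle w' ->
  is_curve_derive J v t w -> is_curve_derive J v' t w' ->
  is_curve_derive J (fun t x => v t x * v' t x) t (fun x => w x * v' t x + v t x * w' x).
Proof.
  intros Hv Hv' Ht Hw Hw' H H'.
  pose proof (curve_derive_continuous J v' t w' Hv' Ht Hw' H') as C'.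
  apply curve_derive_conv in H; auto. apply curve_derive_conv in H'; auto.
  apply curve_derive_conv; auto using smooth_circle_plus, smooth_circle_mult.
  apply conv_ext with (2 := conv_plus _ _ _ _ (conv_mult _ _ _ _ H C')
    (conv_mult _ _ _ _ (conv_const (v t) (Hv t Ht)) H')).
  apply filter_forall. intros h. extensionality x. unfold quotient. ring.
Qed.

Lemma is_derive_of_increments J (f : R -> R) t l :
  locally t J ->
  (forall eps, 0 < eps -> exists delta, 0 < delta /\ forall h, h <> 0 -> Rabs h < delta ->
     J (t + h) -> Rabs ((f (t + h) - f t) / h - l) <= eps) ->
  is_derive f t l.
Proof.
  intros [r Hr] H. apply is_derive_Reals. intros eps Heps.
  destruct (H (eps / 2) ltac:(lra)) as [d [Hd Hb]].
  assert (Hm : 0 < Rmin r d) by (apply Rmin_pos; [apply cond_pos|exact Hd]).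
  exists (mkposreal _ Hm). intros h H0 Hh. simpl in Hh.
  apply Rle_lt_trans with (eps / 2); [|lra]. apply Hb; [exact H0| |].
  - apply Rlt_le_trans with (1 := Hh). apply Rmin_r.
  - apply Hr, ball_R. replace (t + h - t) with h by ring.
    apply Rlt_le_trans with (1 := Hh). apply Rmin_l.
Qed.

Lemma curve_derive_pointwise J v t w n x :
  locally t J -> is_curve_derive J v t w ->
  is_derive (fun tau => Derive_n (v tau) n x) t (Derive_n w n x).
Proof.
  intros HJ H. apply (is_derive_of_increments J); [exact HJ|]. intros eps Heps.
  destruct (H n eps Heps) as [d [Hd Hb]]. exists d. split; [exact Hd|]. auto.
Qed.

Lemma curve_derive_mean J v t w :
  (forall t, J t -> smooth_circle (v t)) -> J t -> locally t J -> smooth_circle w ->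
  is_curve_derive J v t w -> is_derive (fun tau => mean (v tau)) t (mean w).
Proof.
  intros Hv Ht HJ Hw H. apply (is_derive_of_increments J); [exact HJ|]. intros eps Heps.
  destruct (H 0%nat eps Heps) as [d [Hd Hb]]. exists d. split; [exact Hd|].
  intros h H0 Hh Hth. specialize (Hv _ Ht) as Hvt. specialize (Hv _ Hth) as Hvth.
  replace ((mean (v (t + h)) - mean (v t)) / h - mean w)
    with (mean (fun x => / h * (v (t + h) x - v t x) - w x)).
  - apply mean_abs_le.
    + auto with smooth.
    + intros x. specialize (Hb h x H0 Hh Hth). simpl in Hb.
      replace (/ h * (v (t + h) x - v t x)) with ((v (t + h) x - v t x) / h)
        by (unfold Rdiv; ring). exact Hb.
  - rewrite mean_minus, mean_scal, mean_minus by auto with smooth. unfold Rdiv. ring.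
Qed.

(** * The system as a differential equation in the space of smooth functions *)

(** The equation for [u] solved for [u_t]. *)
Definition velocity_rhs (s kappa alpha : R) (u rho : R -> R) : R -> R :=
  A (- s) (momentum_rhs s kappa alpha u rho).

Lemma velocity_rhs_smooth s kappa alpha u rho :
  smooth_circle u -> smooth_circle rho -> smooth_circle (velocity_rhs s kappa alpha u rho).
Proof. intros Hu Hr. unfold velocity_rhs. auto with smooth. Qed.

#[export] Hint Resolve velocity_rhs_smooth : smooth.

Lemma A_velocity_rhs s kappa alpha u rho :
  smooth_circle u -> smooth_circle rho ->
  A s (velocity_rhs s kappa alpha u rho) = momentum_rhs s kappa alpha u rho.
Proof.
  intros Hu Hr. pose proof (momentum_rhs_smooth s kappa alpha u rho Hu Hr) as H.
  unfold velocity_rhs. rewrite A_A, Rplus_opp_r by exact H. now apply A_0.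
Qed.

(** The right-hand sides are built from sums, products and continuous linear
    operators only, so any property preserved by these passes to them.  The
    second argument of [P] is meant for limits. *)
Lemma rhs_closed (P : (R -> R -> R) -> (R -> R) -> Prop) s kappa alpha u rho u0 rho0 :
  (forall v w f g, P v f -> P w g -> P (fun t x => v t x + w t x) (fun x => f x + g x)) ->
  (forall v w f g, P v f -> P w g -> P (fun t x => v t x * w t x) (fun x => f x * g x)) ->
  (forall Op v f, linop Op -> P v f -> P (fun t => Op (v t)) (Op f)) ->
  P u u0 -> P rho rho0 ->
  P (fun t => velocity_rhs s kappa alpha (u t) (rho t)) (velocity_rhs s kappa alpha u0 rho0) /\
  P (fun t => density_rhs (u t) (rho t)) (density_rhs u0 rho0).
Proof.
  intros Hp Hm Ho Hu Hr.
  pose proof (Ho _ _ _ linop_Derive Hu) as Hu'. pose proof (Ho _ _ _ linop_Derive Hr) as Hr'.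
  pose proof (Ho _ _ _ (linop_A s) Hu) as HA. pose proof (Ho _ _ _ linop_Derive HA) as HA'.
  pose proof (fun c v f H => Ho _ v f (linop_scal c) H) as Hs. cbv beta in Hs, Hu', Hr', HA, HA'.
  split.
  - apply (Ho (A (- s)) (fun t => momentum_rhs s kappa alpha (u t) (rho t))); [apply linop_A|].
    assert (E : forall u rho, momentum_rhs s kappa alpha u rho
      = (fun x => (alpha * Derive u x + -2 * (Derive u x * A s u x))
                  + (-1 * (u x * Derive (A s u) x) + - kappa * (rho x * Derive rho x)))).
    { intros. extensionality x. unfold momentum_rhs. ring. }
    rewrite E. replace (fun t => momentum_rhs s kappa alpha (u t) (rho t))
      with (fun t x => (alpha * Derive (u t) x + -2 * (Derive (u t) x * A s (u t) x))
                  + (-1 * (u t x * Derive (A s (u t)) x) + - kappa * (rho t x * Derive (rho t) x)))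
      by (extensionality t; now rewrite E).
    repeat apply Hp; apply Hs; auto.
  - assert (E : forall u rho, density_rhs u rho
      = (fun x => -1 * (u x * Derive rho x) + -1 * (Derive u x * rho x))).
    { intros. extensionality x. unfold density_rhs. ring. }
    rewrite E. replace (fun t => density_rhs (u t) (rho t))
      with (fun t x => -1 * (u t x * Derive (rho t) x) + -1 * (Derive (u t) x * rho t x))
      by (extensionality t; now rewrite E).
    apply Hp; apply Hs; auto.
Qed.

Definition bounded_on (S : R -> Prop) (v : R -> R -> R) : Prop :=
  (forall t, S t -> smooth_circle (v t)) /\
  forall n, exists C, forall t, S t -> bnd n (v t) C.

Lemma bounded_on_rhs S s kappa alpha u rho :
  bounded_on S u -> bounded_on S rho ->
  bounded_on S (fun t => velocity_rhs s kappa alpha (u t) (rho t)) /\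
  bounded_on S (fun t => density_rhs (u t) (rho t)).
Proof.
  intros Hu Hr.
  apply (rhs_closed (fun v _ => bounded_on S v) s kappa alpha u rho (fun _ => 0) (fun _ => 0));
    [| | |exact Hu|exact Hr].
  - intros v w _ _ [Sv Bv] [Sw Bw]. split; [auto using smooth_circle_plus|].
    intros n. destruct (Bv n) as [a Ha]. destruct (Bw n) as [b Hb]. exists (a + b).
    auto using bnd_plus.
  - intros v w _ _ [Sv Bv] [Sw Bw]. split; [auto using smooth_circle_mult|].
    intros n. destruct (Bv n) as [a Ha]. destruct (Bw n) as [b Hb]. exists (2 ^ n * (a * b)).
    auto using bnd_mult.
  - intros Op v _ HO [Sv Bv]. split; [intros; now apply (linop_smooth _ HO), Sv|].
    intros n. destruct (linop_bnd _ HO n) as [m [K HK]]. destruct (Bv m) as [a Ha].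
    exists (K * a). auto.
Qed.

Lemma conv_rhs F {FF : Filter F} s kappa alpha u rho u0 rho0 :
  conv F u u0 -> conv F rho rho0 ->
  conv F (fun t => velocity_rhs s kappa alpha (u t) (rho t)) (velocity_rhs s kappa alpha u0 rho0) /\
  conv F (fun t => density_rhs (u t) (rho t)) (density_rhs u0 rho0).
Proof.
  intros Hu Hr. apply (rhs_closed (conv F)); auto.
  - intros. now apply conv_plus.
  - intros. now apply conv_mult.
  - intros. now apply conv_op.
Qed.

(** Graded by the number [k] of time derivatives for the sake of bootstrapping:
    if [u] and [rho] are in [Ck J k], so are the right-hand sides of the system,
    hence [u] and [rho] are in [Ck J (S k)]. *)
Fixpoint Ck (J : R -> Prop) (k : nat) (v : R -> R -> R) : Prop :=
  (forall t, J t -> smooth_circle (v t)) /\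
  match k with
  | O => True
  | S k => exists w, (forall t, J t -> is_curve_derive J v t (w t)) /\ Ck J k w
  end.

Lemma Ck_smooth J k v t : Ck J k v -> J t -> smooth_circle (v t).
Proof. destruct k; intros [H _]; apply H. Qed.

Lemma Ck_pred J k v : Ck J (S k) v -> Ck J k v.
Proof.
  revert v. induction k as [|k IH]; intros v [Hs [w [Hw Hk]]]; [now split|].
  split; [exact Hs|]. exists w. split; [exact Hw|]. now apply IH.
Qed.

Lemma curve_derive_ext J v v' t w :
  (forall t, J t -> v t = v' t) -> J t -> is_curve_derive J v t w -> is_curve_derive J v' t w.
Proof.
  intros E Ht H n eps Heps. destruct (H n eps Heps) as [d [Hd Hb]].
  exists d. split; [exact Hd|]. intros h x H0 Hh HJ. rewrite <- !E by assumption. auto.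
Qed.

Lemma Ck_ext J k v v' : (forall t, J t -> v t = v' t) -> Ck J k v -> Ck J k v'.
Proof.
  intros E. destruct k as [|k]; intros [Hs H]; (split; [intros t Ht; rewrite <- E; auto|]).
  - exact I.
  - destruct H as [w [Hw Hk]]. exists w. split; [|exact Hk].
    intros t Ht. apply curve_derive_ext with v; auto.
Qed.

Lemma Ck_plus J k v w : Ck J k v -> Ck J k w -> Ck J k (fun t x => v t x + w t x).
Proof.
  revert v w. induction k as [|k IH]; intros v w [Sv Hv] [Sw Hw];
    (split; [auto using smooth_circle_plus|]); [exact I|].
  destruct Hv as [v' [Dv Cv]]. destruct Hw as [w' [Dw Cw]].
  exists (fun t x => v' t x + w' t x). split; [|now apply IH].
  intros t Ht. apply curve_derive_plus; auto; eapply Ck_smooth; eassumption.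
Qed.

Lemma Ck_mult J k v w : Ck J k v -> Ck J k w -> Ck J k (fun t x => v t x * w t x).
Proof.
  revert v w. induction k as [|k IH]; intros v w Hv Hw.
  - split; [|exact I]. intros t Ht. apply smooth_circle_mult; eapply Ck_smooth; eassumption.
  - pose proof (Ck_pred _ _ _ Hv) as Pv. pose proof (Ck_pred _ _ _ Hw) as Pw.
    destruct Hv as [Sv [v' [Dv Cv]]]. destruct Hw as [Sw [w' [Dw Cw]]].
    split; [auto using smooth_circle_mult|].
    exists (fun t x => v' t x * w t x + v t x * w' t x). split.
    + intros t Ht. apply curve_derive_mult; auto; eapply Ck_smooth; eassumption.
    + apply Ck_plus; now apply IH.
Qed.

Lemma Ck_op J k Op v : linop Op -> Ck J k v -> Ck J k (fun t => Op (v t)).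
Proof.
  intros HO. revert v. induction k as [|k IH]; intros v [Sv Hv];
    (split; [intros t Ht; apply (linop_smooth _ HO); auto|]); [exact I|].
  destruct Hv as [v' [Dv Cv]]. exists (fun t => Op (v' t)). split; [|now apply IH].
  intros t Ht. apply curve_derive_op; auto. eapply Ck_smooth; eassumption.
Qed.

(** The derivatives in [Ck] are existentially quantified for each [k]; they
    agree because they are the pointwise time derivatives. *)
Lemma smooth_curve_of_Ck J v : open J -> (forall k, Ck J k v) -> smooth_curve J v.
Proof.
  intros HJ Hv. set (V := fun j t x => Derive_n (fun tau => v tau x) j t).
  assert (step : forall j w, (forall t, J t -> is_curve_derive J (V j) t (w t)) ->
    forall t, J t -> w t = V (S j) t).
  { intros j w Hw t Ht. extensionality x. symmetry.
    apply (is_derive_unique (fun tau => V j tau x)).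
    apply (curve_derive_pointwise J (V j) t (w t) 0 x); auto. }
  assert (HV : forall j k, Ck J k (V j)).
  { induction j as [|j IH]; intros k; [apply Hv|].
    destruct (IH (S k)) as [_ [w [Hw Hk]]].
    apply Ck_ext with w; [now apply step|exact Hk]. }
  exists V. split; [reflexivity|]. split.
  - intros j t Ht. now apply (Ck_smooth J 0).
  - intros j t Ht. destruct (HV j 1%nat) as [_ [w [Hw _]]].
    rewrite <- (step j w Hw t Ht). auto.
Qed.

(** The system as an ordinary differential equation in [C^oo]. *)
Definition flow (s kappa alpha : R) (J : R -> Prop) (u rho : R -> R -> R) : Prop :=
  forall t, J t ->
    smooth_circle (u t) /\ smooth_circle (rho t) /\
    is_curve_derive J u t (velocity_rhs s kappa alpha (u t) (rho t)) /\
    is_curve_derive J rho t (density_rhs (u t) (rho t)).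

Lemma flow_Ck s kappa alpha J u rho k :
  flow s kappa alpha J u rho -> Ck J k u /\ Ck J k rho.
Proof.
  intros H. induction k as [|k [IHu IHr]].
  - split; (split; [intros t Ht; apply (H t Ht)|exact I]).
  - destruct (rhs_closed (fun v _ => Ck J k v) s kappa alpha u rho (fun _ => 0) (fun _ => 0))
      as [Hv Hd]; auto.
    + intros. now apply Ck_plus.
    + intros. now apply Ck_mult.
    + intros. now apply Ck_op.
    + split; (split; [intros t Ht; apply (H t Ht)|]); eexists;
        (split; [intros t Ht; apply (H t Ht)|assumption]).
Qed.

Lemma smooth_curve_derive J v :
  smooth_curve J v -> exists w, (forall t, J t -> smooth_circle (v t)) /\
    (forall t, J t -> smooth_circle (w t)) /\ (forall t, J t -> is_curve_derive J v t (w t)).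
Proof.
  intros [V [H0 [Hs Hd]]].
  assert (E : forall t, J t -> V 0%nat t = v t) by (intros t Ht; extensionality x; auto).
  exists (V 1%nat). split; [|split].
  - intros t Ht. rewrite <- E by exact Ht. now apply Hs.
  - intros t Ht. now apply Hs.
  - intros t Ht. apply curve_derive_ext with (V 0%nat); auto.
Qed.

(** As [A s] is continuous it commutes with the time derivative, so [m_t = A s
    u_t], and [A s] is invertible. *)
Lemma solution_flow s kappa alpha u0 rho0 J u rho :
  is_solution s kappa alpha u0 rho0 J u rho -> flow s kappa alpha J u rho.
Proof.
  intros [[HJ _] Su Sr _ _ Hm Hd] t Ht.
  destruct (smooth_curve_derive _ _ Su) as [u' [Su1 [Su2 Du]]].
  destruct (smooth_curve_derive _ _ Sr) as [rho' [Sr1 [Sr2 Dr]]].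
  split; [auto|]. split; [auto|]. split.
  - assert (E : A s (u' t) = momentum_rhs s kappa alpha (u t) (rho t)).
    { pose proof (curve_derive_op (A s) J u t (u' t) (linop_A s) Su1 Ht (Su2 t Ht) (Du t Ht))
        as D.
      extensionality x.
      pose proof (curve_derive_pointwise _ _ _ _ 0 x (HJ t Ht) D) as D0.
      apply is_derive_unique in D0. simpl in D0.
      transitivity (Derive (fun tau => A s (u tau) x) t); [now symmetry|].
      apply is_derive_unique, (Hm t x Ht). }
    unfold velocity_rhs. rewrite <- E, A_A, Rplus_opp_l, A_0 by auto. auto.
  - replace (density_rhs (u t) (rho t)) with (rho' t); [auto|].
    extensionality x.
    pose proof (curve_derive_pointwise _ _ _ _ 0 x (HJ t Ht) (Dr t Ht)) as D0.
    apply is_derive_unique in D0. simpl in D0.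
    transitivity (Derive (fun tau => rho tau x) t); [now symmetry|].
    apply is_derive_unique, (Hd t x Ht).
Qed.

Lemma flow_solution s kappa alpha J u rho u0 rho0 :
  open_interval_around_0 J -> (forall x, u 0 x = u0 x) -> (forall x, rho 0 x = rho0 x) ->
  flow s kappa alpha J u rho -> is_solution s kappa alpha u0 rho0 J u rho.
Proof.
  intros HI Hu0 Hr0 H. pose proof (proj1 HI) as HJ. split; auto.
  - apply smooth_curve_of_Ck; [exact HJ|]. intros k. now apply (flow_Ck s kappa alpha J u rho k).
  - apply smooth_curve_of_Ck; [exact HJ|]. intros k. now apply (flow_Ck s kappa alpha J u rho k).
  - intros m t x Ht. destruct (H t Ht) as [Su [Sr [Du _]]].
    pose proof (curve_derive_op (A s) J u t _ (linop_A s) (fun t Ht => proj1 (H t Ht)) Ht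
      (velocity_rhs_smooth s kappa alpha _ _ Su Sr) Du) as D.
    rewrite A_velocity_rhs in D by assumption.
    exact (curve_derive_pointwise _ _ _ _ 0 x (HJ t Ht) D).
  - intros t x Ht. destruct (H t Ht) as [Su [Sr [_ Dr]]].
    exact (curve_derive_pointwise _ _ _ _ 0 x (HJ t Ht) Dr).
Qed.

(** * A priori bounds *)

Lemma is_derive_mean_A_self J v t w p :
  (forall t, J t -> smooth_circle (v t)) -> J t -> locally t J -> smooth_circle w ->
  is_curve_derive J v t w ->
  is_derive (fun tau => mean (fun x => A p (v tau) x * v tau x)) t
    (2 * mean (fun x => w x * A p (v t) x)).
Proof.
  intros Hv Ht HJ Hw H.
  pose proof (curve_derive_op (A p) J v t w (linop_A p) Hv Ht Hw H) as HA.
  assert (SA : forall t, J t -> smooth_circle (A p (v t))) by auto using A_smooth.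
  pose proof (curve_derive_mult J _ _ t _ _ SA Hv Ht (A_smooth p w Hw) Hw HA H) as HM.
  apply curve_derive_mean in HM; auto with smooth.
  cbv beta in HM. rewrite mean_plus in HM by auto with smooth.
  rewrite (mean_A_sym p w (v t)) in HM by auto.
  replace (fun x => A p (v t) x * w x) with (fun x => w x * A p (v t) x) in HM
    by (extensionality x; ring).
  replace (2 * mean (fun x => w x * A p (v t) x))
    with (mean (fun x => w x * A p (v t) x) + mean (fun x => w x * A p (v t) x)) by ring.
  exact HM.
Qed.

(** By symmetry of [A], the derivative of [<A (s + r) u, u>] is [2 <A s u_t, A r
    u>], and [A s u_t] is given by the momentum equation. *)
Lemma is_derive_energy s r kappa alpha J u rho t :
  flow s kappa alpha J u rho -> J t -> locally t J ->
  is_derive (fun tau => energy s r kappa (u tau) (rho tau)) t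
    (energy_rate s r kappa alpha (u t) (rho t)).
Proof.
  intros H Ht HJ. destruct (H t Ht) as [Su [Sr [Du Dr]]].
  pose proof (velocity_rhs_smooth s kappa alpha _ _ Su Sr) as Sv.
  pose proof (density_rhs_smooth _ _ Su Sr) as Sd.
  assert (E : mean (fun x => velocity_rhs s kappa alpha (u t) (rho t) x * A (s + r) (u t) x)
    = mean (fun x => momentum_rhs s kappa alpha (u t) (rho t) x * A r (u t) x)).
  { rewrite <- (A_A s r (u t) Su).
    rewrite <- (mean_A_sym s _ (A r (u t)) Sv (A_smooth r _ Su)).
    now rewrite A_velocity_rhs. }
  unfold energy, energy_rate. rewrite <- E.
  apply (is_derive_plus (fun tau => mean (fun x => A (s + r) (u tau) x * u tau x))).
  - apply (is_derive_mean_A_self J); auto. intros tau Htau. apply (H tau Htau).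
  - apply (is_derive_scal (fun tau => mean (fun x => A r (rho tau) x * rho tau x))).
    apply (is_derive_mean_A_self J); auto. intros tau Htau. apply (H tau Htau).
Qed.

Lemma gronwall (f df : R -> R) T K :
  0 <= K -> 0 <= f 0 -> (forall t, 0 <= t < T -> is_derive f t (df t)) ->
  (forall t, 0 <= t < T -> Rabs (df t) <= K * f t) ->
  forall t, 0 <= t < T -> f t <= f 0 * exp (K * T).
Proof.
  intros HK H0 Hd Hb t Ht.
  set (g := fun t => f t * exp (- K * t)).
  set (dg := fun t => (df t - K * f t) * exp (- K * t)).
  assert (Dg : forall t, 0 <= t < T -> is_derive g t (dg t)).
  { intros z Hz. unfold g, dg. pose proof (Hd z Hz) as D.
    auto_derive; [now exists (df z)|]. change (fun x : R => f x) with f.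
    rewrite (is_derive_unique _ _ _ D). ring. }
  destruct (MVT_gen g 0 t dg) as [c [Hc E]].
  - intros x. rewrite Rmin_left, Rmax_right by lra. intros Hx. apply Dg. lra.
  - intros x. rewrite Rmin_left, Rmax_right by lra. intros Hx.
    apply continuity_pt_filterlim. apply (ex_derive_continuous g).
    eexists. apply Dg. lra.
  - rewrite Rmin_left, Rmax_right in Hc by lra.
    specialize (Hb c ltac:(lra)). apply Rabs_le_between in Hb.
    pose proof (exp_pos (- K * c)) as Hec.
    assert (Hdg : dg c <= 0) by (unfold dg; nra).
    assert (Hg : g t <= g 0) by nra.
    unfold g in Hg. rewrite Rmult_0_r, exp_0, Rmult_1_r in Hg.
    pose proof (exp_pos (K * t)) as Het.
    assert (Hexp : exp (- K * t) * exp (K * t) = 1).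
    { rewrite <- exp_plus. replace (- K * t + K * t) with 0 by ring. apply exp_0. }
    assert (H1 : f t <= f 0 * exp (K * t)).
    { apply Rmult_le_compat_r with (r := exp (K * t)) in Hg; [|lra].
      rewrite Rmult_assoc, Hexp in Hg. lra. }
    apply Rle_trans with (1 := H1). apply Rmult_le_compat_l; [exact H0|].
    destruct (Rle_lt_or_eq_dec (K * t) (K * T)) as [Hlt|Heq]; [nra| |rewrite Heq; lra].
    left. now apply exp_increasing.
Qed.

(** A Sobolev embedding: the quadratic form of order [2 * q] controls each
    Fourier coefficient with weight [(1 + k ^ 2) ^ q], and this is enough for [q
    - 1] derivatives. *)
Lemma bounded_on_of_means (S : R -> Prop) (v : R -> R -> R) :
  (forall t, S t -> smooth_circle (v t)) ->
  (forall q : nat, exists C, forall t, S t ->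
     mean (fun x => A (INR q) (v t) x * v t x) <= C) ->
  bounded_on S v.
Proof.
  intros Hs Hq. split; [exact Hs|]. intros n.
  set (q := Datatypes.S n). destruct (Hq (2 * q)%nat) as [C HC].
  exists (5 * (1 + C)). intros t Ht. specialize (HC t Ht). specialize (Hs t Ht).
  rewrite <- (syn_fourier_coef (v t) Hs).
  apply syn_bnd; [now apply fourier_coef_rapid|]. fold q. intros k.
  pose proof (zsum_le_mean_A (INR (2 * q)) (v t) (Z.to_nat (Z.abs k)) Hs) as B.
  pose proof (zsum_term_le (Z.to_nat (Z.abs k))
    (fun k => pw (INR (2 * q)) k * Cmod (fourier_coef (v t) k) ^ 2) k) as B1.
  cbv beta in B1. rewrite pw_INR in B1.
  assert (B2 : jap k ^ (2 * q) * Cmod (fourier_coef (v t) k) ^ 2 <= C).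
  { apply Rle_trans with (2 := HC). apply Rle_trans with (2 := B). apply B1; [|lia].
    intros l. apply Rmult_le_pos; [left; apply pw_pos|apply pow2_ge_0]. }
  rewrite Nat.mul_comm, pow_mult, <- Rpow_mult_distr in B2.
  set (y := jap k ^ q * Cmod (fourier_coef (v t) k)) in *.
  pose proof (pow2_ge_0 (y - 1)). nra.
Qed.

(** The a priori estimate: first the conserved energy, then the higher energies,
    which control [u]; then [rho], as the solution of a linear equation. *)
Lemma flow_bounded s kappa alpha J u rho T :
  3 / 2 < s -> 0 <= kappa -> open J -> (forall t, 0 <= t < T -> J t) -> 0 < T ->
  flow s kappa alpha J u rho ->
  bounded_on (fun t => 0 <= t < T) u /\ bounded_on (fun t => 0 <= t < T) rho.
Proof.
  intros Hs Hk HJ HT HT0 H.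
  assert (Su : forall t, 0 <= t < T -> smooth_circle (u t)) by (intros t Ht; apply H; auto).
  assert (Sr : forall t, 0 <= t < T -> smooth_circle (rho t)) by (intros t Ht; apply H; auto).
  assert (DE : forall r t, 0 <= t < T ->
    is_derive (fun tau => energy s r kappa (u tau) (rho tau)) t
      (energy_rate s r kappa alpha (u t) (rho t))).
  { intros r t Ht. apply (is_derive_energy s r kappa alpha J); auto. }
  set (E0 := energy s 0 kappa (u 0) (rho 0)).
  assert (HE0 : 0 <= E0) by (apply energy_nonneg; [exact Hk|apply Su|apply Sr]; lra).
  assert (Cons : forall t, 0 <= t < T -> energy s 0 kappa (u t) (rho t) = E0).
  { intros t Ht.
    pose proof (abs_le_of_derive_le (fun tau => energy s 0 kappa (u tau) (rho tau))
      (fun t => energy_rate s 0 kappa alpha (u t) (rho t)) 0 t 0) as B. cbv beta in B.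
    rewrite Rmult_0_l in B. fold E0 in B.
    assert (B0 : Rabs (energy s 0 kappa (u t) (rho t) - E0) <= 0).
    { apply B; [lra| |].
      - intros x Hx. apply DE. lra.
      - intros x Hx. rewrite energy_rate_0 by (apply Su || apply Sr; lra).
        rewrite Rabs_R0. lra. }
    apply Rabs_le_between in B0. lra. }
  assert (HE : forall r, 0 <= r -> exists C, forall t, 0 <= t < T ->
    energy s r kappa (u t) (rho t) <= C).
  { intros r Hr. destruct (energy_rate_bound s r Hs Hr) as [K [HK B]].
    eexists.
    apply (gronwall (fun tau => energy s r kappa (u tau) (rho tau))
      (fun t => energy_rate s r kappa alpha (u t) (rho t)) T (K * (1 + E0))).
    - apply Rmult_le_pos; lra.
    - apply energy_nonneg; [exact Hk|apply Su|apply Sr]; lra.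
    - intros t Ht. now apply DE.
    - intros t Ht. rewrite <- (Cons t Ht). apply B; auto. }
  assert (HU : forall r, 0 <= r -> exists C, forall t, 0 <= t < T ->
    mean (fun x => A (s + r) (u t) x * u t x) <= C).
  { intros r Hr. destruct (HE r Hr) as [C HC]. exists C. intros t Ht.
    specialize (HC t Ht). unfold energy in HC.
    pose proof (Rmult_le_pos _ _ Hk (mean_A_self_nonneg r (rho t) (Sr t Ht))). lra. }
  split.
  - apply bounded_on_of_means; [exact Su|]. intros q.
    destruct (HU (INR q) (pos_INR q)) as [C HC]. exists C. intros t Ht.
    apply Rle_trans with (2 := HC t Ht).
    pose proof (mean_A_self (INR q) (u t) (Su t Ht)) as L1.
    pose proof (mean_A_self (s + INR q) (u t) (Su t Ht)) as L2.
    apply (is_lim_seq_le _ _ _ _) with (2 := L1) (3 := L2). intros N.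
    apply zsum_le. intros k. apply Rmult_le_compat_r; [apply pow2_ge_0|].
    apply pw_le. lra.
  - apply bounded_on_of_means; [exact Sr|]. intros q. pose proof (pos_INR q) as Hq.
    destruct (HU (2 * INR q) ltac:(lra)) as [C HC].
    destruct (density_rate_bound s (INR q) Hs Hq) as [K [HK B]].
    assert (HC0 : 0 <= C).
    { apply Rle_trans with (2 := HC 0 ltac:(lra)). apply mean_A_self_nonneg, Su. lra. }
    eexists.
    apply (gronwall (fun tau => mean (fun x => A (INR q) (rho tau) x * rho tau x))
      (fun t => 2 * mean (fun x => density_rhs (u t) (rho t) x * A (INR q) (rho t) x))
      T (K * (1 + C))).
    + apply Rmult_le_pos; lra.
    + apply mean_A_self_nonneg, Sr. lra.
    + intros t Ht. destruct (H t (HT t Ht)) as [Sut [Srt [_ Dr]]].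
      apply (is_derive_mean_A_self J); auto using density_rhs_smooth.
      intros tau Htau. apply (H tau Htau).
    + intros t Ht. apply Rle_trans with (1 := B (u t) (rho t) (Su t Ht) (Sr t Ht)).
      apply Rmult_le_compat_r; [apply mean_A_self_nonneg; auto|].
      apply Rmult_le_compat_l; [exact HK|]. specialize (HC t Ht). lra.
Qed.

Lemma at_left_intro T (P : R -> Prop) d :
  0 < d -> (forall t, T - d < t < T -> P t) -> at_left T P.
Proof.
  intros Hd H. exists (mkposreal d Hd). intros t Ht Hlt. apply H.
  change (Rabs (t - T) < d) in Ht. apply Rabs_lt_between in Ht. lra.
Qed.

Lemma at_left_elim T (P : R -> Prop) :
  at_left T P -> exists d, 0 < d /\ forall t, T - d < t < T -> P t.
Proof.
  intros [d H]. exists d. split; [apply cond_pos|]. intros t Ht. apply H; [|lra].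
  change (Rabs (t - T) < d). apply Rabs_lt_between. lra.
Qed.

(** All the derivatives are Lipschitz in time, hence Cauchy at [T] uniformly in
    [x]; the limits are successive derivatives of each other because the bounds
    on Taylor remainders pass to the limit. *)
Lemma curve_limit J v w T :
  open J -> 0 < T -> (forall t, 0 <= t < T -> J t) ->
  (forall t, 0 <= t < T -> is_curve_derive J v t (w t)) ->
  bounded_on (fun t => 0 <= t < T) v -> bounded_on (fun t => 0 <= t < T) w ->
  exists f, conv (at_left T) v f.
Proof.
  intros HJ HT0 HT Hd [Sv Bv] [Sw Bw].
  assert (Lip : forall n, exists C, 0 <= C /\ forall i x t t', (i <= n)%nat ->
    0 <= t < T -> 0 <= t' < T ->
    Rabs (Derive_n (v t) i x - Derive_n (v t') i x) <= C * Rabs (t - t')).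
  { intros n. destruct (Bw n) as [C HC].
    pose proof (bnd_nonneg _ _ _ (HC 0 ltac:(lra))) as HC0.
    exists C. split; [exact HC0|].
    assert (L : forall i x t t', (i <= n)%nat -> 0 <= t <= t' -> t' < T ->
      Rabs (Derive_n (v t') i x - Derive_n (v t) i x) <= C * (t' - t)).
    { intros i x t t' Hi Ht Ht'.
      apply (abs_le_of_derive_le (fun tau => Derive_n (v tau) i x)
        (fun tau => Derive_n (w tau) i x)); [lra| |].
      - intros tau Htau. apply (curve_derive_pointwise J); [apply HJ, HT|apply Hd]; lra.
      - intros tau Htau. apply HC; [lra|exact Hi]. }
    intros i x t t' Hi Ht Ht'. destruct (Rle_dec t t') as [Hle|Hle].
    - rewrite Rabs_minus_sym, (Rabs_minus_sym t), (Rabs_right (t' - t)) by lra.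
      apply L; auto; lra.
    - rewrite (Rabs_right (t - t')) by lra. apply L; auto; lra. }
  (* a sequence of times increasing to T *)
  set (tt := fun j : nat => T - T / (INR j + 1)).
  assert (Htt : forall j, 0 <= tt j < T).
  { intros j. unfold tt. pose proof (pos_INR j).
    assert (0 < T / (INR j + 1)) by (apply Rdiv_lt_0_compat; lra).
    assert (T / (INR j + 1) <= T).
    { apply Rmult_le_reg_r with (INR j + 1); [lra|].
      unfold Rdiv. rewrite Rmult_assoc, Rinv_l by lra. nra. }
    lra. }
  assert (Ltt : is_lim_seq tt T).
  { pose proof (is_lim_seq_minus' _ _ _ _ (is_lim_seq_const T) (is_lim_seq_inv_succ T)) as L.
    rewrite Rminus_0_r in L. exact L. }
  set (L := fun n x => real (Lim_seq (fun j => Derive_n (v (tt j)) n x))).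
  assert (HL : forall n x, is_lim_seq (fun j => Derive_n (v (tt j)) n x) (L n x)).
  { intros n x. apply Lim_seq_correct'. apply ex_lim_seq_cauchy_corr. intros eps.
    destruct (Lip n) as [C [HC HLip]].
    apply is_lim_seq_Reals in Ltt.
    pose proof (CV_Cauchy tt (exist _ T Ltt)) as Cau.
    pose proof (cond_pos eps) as Heps.
    destruct (Cau (eps / (C + 1)) ltac:(apply Rdiv_lt_0_compat; lra)) as [N HN].
    exists N. intros n' m' Hn Hm.
    apply Rle_lt_trans with (1 := HLip n x _ _ (le_n n) (Htt n') (Htt m')).
    specialize (HN n' m' Hn Hm). unfold Rdist in HN.
    apply Rmult_lt_compat_r with (r := C + 1) in HN; [|lra].
    unfold Rdiv in HN. rewrite Rmult_assoc, Rinv_l in HN by lra.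
    pose proof (Rabs_pos (tt n' - tt m')). nra. }
  assert (DL : forall n x, is_derive (L n) x (L (S n) x)).
  { intros n x. destruct (Bv (S (S n))) as [C HC].
    apply is_derive_of_quadratic with C. intros h.
    assert (Q : is_lim_seq (fun j => Derive_n (v (tt j)) n (x + h) - Derive_n (v (tt j)) n x
      - h * Derive_n (v (tt j)) (S n) x) (L n (x + h) - L n x - h * L (S n) x)).
    { apply is_lim_seq_minus'; [now apply is_lim_seq_minus'|].
      now apply (is_lim_seq_scal_l _ h (L (S n) x)). }
    apply is_lim_seq_abs_le with (1 := Q). intros j.
    pose proof (Sv _ (Htt j)) as Sj.
    apply (taylor_bound _ _ (Derive_n (v (tt j)) (S (S n)))).
    - intros y. now apply smooth_circle_is_derive_n.
    - intros y. now apply smooth_circle_is_derive_n.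
    - intros y. apply HC; auto. }
  assert (SL : smooth_circle (L 0%nat)).
  { split.
    - intros x. unfold L. f_equal. apply Lim_seq_ext. intros j. apply (Sv _ (Htt j)).
    - intros n x. now apply Derive_n_tower. }
  exists (L 0%nat). split; [exact SL|]. split.
  - apply at_left_intro with T; [exact HT0|]. intros t Ht. apply Sv. lra.
  - intros n eps Heps. destruct (Lip n) as [C [HC HLip]].
    assert (Hmin : 0 < Rmin T (eps / (C + 1)))
      by (apply Rmin_pos; [exact HT0|apply Rdiv_lt_0_compat; lra]).
    apply at_left_intro with (1 := Hmin). intros t Ht i x Hi.
    pose proof (Rmin_l T (eps / (C + 1))). pose proof (Rmin_r T (eps / (C + 1))).
    assert (Ht0 : 0 <= t < T) by lra.
    rewrite Derive_n_minus_smooth by auto.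
    rewrite (proj2 (Derive_n_tower L DL i x)).
    assert (Q1 : is_lim_seq (fun j => Rabs (Derive_n (v t) i x - Derive_n (v (tt j)) i x))
      (Rabs (Derive_n (v t) i x - L i x))).
    { apply (is_lim_seq_abs _ (Finite (Derive_n (v t) i x - L i x))).
      apply is_lim_seq_minus'; [apply is_lim_seq_const|apply HL]. }
    assert (Q2 : is_lim_seq (fun j => C * Rabs (t - tt j)) (C * Rabs (t - T))).
    { apply (is_lim_seq_scal_l _ C (Rabs (t - T))).
      apply (is_lim_seq_abs _ (Finite (t - T))).
      apply is_lim_seq_minus'; [apply is_lim_seq_const|exact Ltt]. }
    apply Rle_trans with (C * Rabs (t - T)).
    + apply (is_lim_seq_le _ _ _ _) with (2 := Q1) (3 := Q2). intros j. now apply HLip.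
    + rewrite Rabs_minus_sym, Rabs_right by lra.
      apply Rle_trans with ((C + 1) * (eps / (C + 1))); [|right; field; lra].
      apply Rmult_le_compat; lra.
Qed.

Definition glue_times (J J' : R -> Prop) (T t : R) : Prop := J t \/ (T <= t /\ J' (t - T)).

Definition glue (T : R) (v v' : R -> R -> R) (t : R) : R -> R :=
  if Rlt_dec t T then v t else v' (t - T).

Lemma glue_lt T v v' t : t < T -> glue T v v' t = v t.
Proof. intros H. unfold glue. now destruct (Rlt_dec t T). Qed.

Lemma glue_ge T v v' t : T <= t -> glue T v v' t = v' (t - T).
Proof. intros H. unfold glue. destruct (Rlt_dec t T); [lra|reflexivity]. Qed.

(** The left derivative at [T] comes from the mean value inequality between
    [T + h] and [T], where the velocity is close to its limit. *)
Lemma curve_glue J J' T t0 v w v' w' :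
  (forall t, J t -> t < T) -> open J -> t0 < T -> (forall t, t0 <= t < T -> J t) -> J' 0 ->
  (forall t, J t -> smooth_circle (v t)) -> (forall t, J t -> smooth_circle (w t)) ->
  (forall t, J t -> is_curve_derive J v t (w t)) ->
  (forall t, J' t -> is_curve_derive J' v' t (w' t)) ->
  conv (at_left T) v (v' 0) -> conv (at_left T) w (w' 0) ->
  forall t, glue_times J J' T t ->
    is_curve_derive (glue_times J J' T) (glue T v v') t (glue T w w' t).
Proof.
  intros HJT HJ Ht0 Hend HJ'0 Sv Sw Dv Dv' Cv Cw t Ht n eps Heps.
  destruct (Rtotal_order t T) as [Hlt|[Heq|Hgt]].
  - destruct Ht as [Ht|[Ht _]]; [|lra].
    destruct (Dv t Ht n eps Heps) as [d [Hd H]].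
    assert (Hm : 0 < Rmin d (T - t)) by (apply Rmin_pos; lra).
    exists (Rmin d (T - t)). split; [exact Hm|]. intros h x H0 Hh Hth.
    pose proof (Rmin_l d (T - t)). pose proof (Rmin_r d (T - t)).
    pose proof (Rle_abs h).
    rewrite !glue_lt by lra. apply H; [exact H0|lra|].
    destruct Hth as [Hth|[Hth _]]; [exact Hth|lra].
  - subst t. destruct (Dv' 0 HJ'0 n eps Heps) as [d1 [Hd1 H1]].
    destruct Cv as [S0 [_ Cv]]. destruct Cw as [S0' [_ Cw]].
    destruct (at_left_elim _ _ (Cw n eps Heps)) as [d2 [Hd2 H2]].
    set (d := Rmin d1 (Rmin d2 (T - t0))).
    assert (D1 : d <= d1) by apply Rmin_l.
    assert (D2 : d <= d2) by (apply Rle_trans with (1 := Rmin_r _ _); apply Rmin_l).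
    assert (D3 : d <= T - t0) by (apply Rle_trans with (1 := Rmin_r _ _); apply Rmin_r).
    assert (Hd : 0 < d) by (unfold d; repeat apply Rmin_pos; lra).
    exists d. split; [exact Hd|]. intros h x H0 Hh Hth.
    rewrite (glue_ge T v v' T), (glue_ge T w w' T), Rminus_diag by lra.
    destruct (Rlt_dec h 0) as [Hneg|Hpos].
    + rewrite glue_lt by lra. rewrite Rabs_left in Hh by exact Hneg.
      set (l := Derive_n (w' 0) n x).
      set (psi := fun tau => Derive_n (v tau) n x - tau * l).
      (* mean value inequality up to any time before T *)
      assert (M : forall tau, T + h <= tau < T -> Rabs (psi tau - psi (T + h)) <= eps * (tau - (T + h))).
      { intros tau Htau.
        apply (abs_le_of_derive_le psi (fun z => Derive_n (w z) n x - l)); [lra| |].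
        - intros z Hz. assert (Jz : J z) by (apply Hend; lra).
          pose proof (curve_derive_pointwise J v z (w z) n x (HJ z Jz) (Dv z Jz)) as D.
          apply (is_derive_minus (fun z => Derive_n (v z) n x) (fun z => z * l)); [exact D|].
          auto_derive; [exact I|ring].
        - intros z Hz. assert (Jz : J z) by (apply Hend; lra).
          specialize (H2 z ltac:(lra) n x (le_n n)).
          rewrite Derive_n_minus_smooth in H2 by auto. exact H2. }
      assert (M' : Rabs (Derive_n (v' 0) n x - T * l - psi (T + h)) <= eps * - h).
      { apply le_epsilon. intros eta Heta.
        set (e1 := eta / 2). assert (He1 : 0 < e1) by (unfold e1; lra).
        destruct (at_left_elim _ _ (Cv n e1 He1)) as [d3 [Hd3 H3]].
        set (z := Rmin d3 (Rmin (- h) (e1 / (Rabs l + 1)))).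
        pose proof (Rabs_pos l) as Hl.
        assert (Hz1 : z <= d3) by apply Rmin_l.
        assert (Hz2 : z <= - h) by (apply Rle_trans with (1 := Rmin_r _ _); apply Rmin_l).
        assert (Hz3 : z <= e1 / (Rabs l + 1))
          by (apply Rle_trans with (1 := Rmin_r _ _); apply Rmin_r).
        assert (Hz : 0 < z).
        { unfold z. repeat apply Rmin_pos; try lra. apply Rdiv_lt_0_compat; lra. }
        set (tau := T - z / 2).
        specialize (M tau ltac:(unfold tau; lra)).
        specialize (H3 tau ltac:(unfold tau; lra) n x (le_n n)).
        assert (Jtau : J tau) by (apply Hend; unfold tau; lra).
        rewrite Derive_n_minus_smooth in H3 by auto.
        assert (Hzl : z / 2 * Rabs l <= e1).
        { apply Rle_trans with (e1 / (Rabs l + 1) * (Rabs l + 1)); [|right; field; lra].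
          apply Rmult_le_compat; lra. }
        replace (Derive_n (v' 0) n x - T * l - psi (T + h))
          with ((psi tau - psi (T + h))
                + (- (Derive_n (v tau) n x - Derive_n (v' 0) n x) + - (z / 2 * l)))
          by (unfold psi, tau; ring).
        apply Rle_trans with (1 := Rabs_triang _ _).
        pose proof (Rabs_triang (- (Derive_n (v tau) n x - Derive_n (v' 0) n x)) (- (z / 2 * l))) as R1.
        rewrite !Rabs_Ropp, Rabs_mult, (Rabs_right (z / 2)) in R1 by lra.
        assert (eps * (tau - (T + h)) <= eps * - h).
        { apply Rmult_le_compat_l; [lra|]. unfold tau. lra. }
        unfold e1 in *. lra. }
      replace ((Derive_n (v (T + h)) n x - Derive_n (v' 0) n x) / h - l)
        with ((Derive_n (v' 0) n x - T * l - psi (T + h)) / - h)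
        by (unfold psi; field; exact H0).
      unfold Rdiv. rewrite Rabs_mult, Rabs_inv, (Rabs_right (- h)) by lra.
      apply Rmult_le_reg_r with (- h); [lra|].
      rewrite Rmult_assoc, Rinv_l, Rmult_1_r by lra. exact M'.
    + assert (Hh0 : 0 < h) by lra.
      rewrite glue_ge by lra. replace (T + h - T) with h by ring.
      specialize (H1 h x H0 ltac:(lra)). rewrite !Rplus_0_l in H1. apply H1.
      destruct Hth as [Hth|[_ Hth]]; [specialize (HJT _ Hth); lra|].
      now replace (T + h - T) with h in Hth by ring.
  - destruct Ht as [Ht|[_ Ht]]; [specialize (HJT _ Ht); lra|].
    destruct (Dv' _ Ht n eps Heps) as [d [Hd H]].
    assert (Hm : 0 < Rmin d (t - T)) by (apply Rmin_pos; lra).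
    exists (Rmin d (t - T)). split; [exact Hm|]. intros h x H0 Hh Hth.
    pose proof (Rmin_l d (t - T)). pose proof (Rmin_r d (t - T)).
    pose proof (Rle_abs (- h)) as Hah. rewrite Rabs_Ropp in Hah.
    rewrite !glue_ge by lra. replace (t + h - T) with (t - T + h) by ring.
    apply H; [exact H0|lra|].
    destruct Hth as [Hth|[_ Hth]]; [specialize (HJT _ Hth); lra|].
    now replace (t + h - T) with (t - T + h) in Hth by ring.
Qed.

Lemma flow_glue s kappa alpha J J' T t0 u rho u' rho' :
  (forall t, J t -> t < T) -> open J -> t0 < T -> (forall t, t0 <= t < T -> J t) -> J' 0 ->
  flow s kappa alpha J u rho -> flow s kappa alpha J' u' rho' ->
  conv (at_left T) u (u' 0) -> conv (at_left T) rho (rho' 0) ->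
  flow s kappa alpha (glue_times J J' T) (glue T u u') (glue T rho rho').
Proof.
  intros HJT HJ Ht0 Hend HJ'0 F F' Cu Cr.
  destruct (conv_rhs (at_left T) s kappa alpha u rho _ _ Cu Cr) as [Cv Cd].
  assert (Sv : forall t, J t -> smooth_circle (velocity_rhs s kappa alpha (u t) (rho t))).
  { intros t Ht. destruct (F t Ht) as [Su [Sr _]]. now apply velocity_rhs_smooth. }
  assert (Sd : forall t, J t -> smooth_circle (density_rhs (u t) (rho t))).
  { intros t Ht. destruct (F t Ht) as [Su [Sr _]]. now apply density_rhs_smooth. }
  intros t Ht. split; [|split; [|split]].
  - destruct Ht as [Ht|[HT Ht]].
    + rewrite glue_lt by auto. apply (F t Ht).
    + rewrite glue_ge by auto. apply (F' _ Ht).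
  - destruct Ht as [Ht|[HT Ht]].
    + rewrite glue_lt by auto. apply (F t Ht).
    + rewrite glue_ge by auto. apply (F' _ Ht).
  - replace (velocity_rhs s kappa alpha (glue T u u' t) (glue T rho rho' t))
      with (glue T (fun t => velocity_rhs s kappa alpha (u t) (rho t))
              (fun t => velocity_rhs s kappa alpha (u' t) (rho' t)) t)
      by (unfold glue; now destruct (Rlt_dec t T)).
    apply (curve_glue J J' T t0); auto; intros z Hz; apply F || apply F'; exact Hz.
  - replace (density_rhs (glue T u u' t) (glue T rho rho' t))
      with (glue T (fun t => density_rhs (u t) (rho t))
              (fun t => density_rhs (u' t) (rho' t)) t)
      by (unfold glue; now destruct (Rlt_dec t T)).
    apply (curve_glue J J' T t0); auto; intros z Hz; apply F || apply F'; exact Hz.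
Qed.

Lemma glue_times_interval J J' T :
  open_interval_around_0 J -> open_interval_around_0 J' -> 0 < T ->
  (forall t, J t -> t < T) -> (forall t, 0 <= t < T -> J t) ->
  open_interval_around_0 (glue_times J J' T).
Proof.
  intros [HJ [J0 CJ]] [HJ' [J'0 CJ']] HT HJT Hend. split; [|split].
  - intros t Ht. destruct (Rtotal_order t T) as [Hlt|[Heq|Hgt]].
    + destruct Ht as [Ht|[Ht _]]; [|lra].
      apply filter_imp with (2 := HJ t Ht). intros z Hz. now left.
    + subst t. destruct (HJ' 0 J'0) as [d Hd].
      assert (Hm : 0 < Rmin d T) by (apply Rmin_pos; [apply cond_pos|exact HT]).
      exists (mkposreal _ Hm). intros z Hz.
      change (Rabs (z - T) < Rmin d T) in Hz.
      pose proof (Rmin_l d T). pose proof (Rmin_r d T).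
      destruct (Rlt_dec z T) as [Hz1|Hz1].
      * left. apply Hend. apply Rabs_lt_between in Hz. lra.
      * right. split; [lra|]. apply Hd, ball_R. rewrite Rminus_0_r. lra.
    + destruct Ht as [Ht|[_ Ht]]; [specialize (HJT _ Ht); lra|].
      destruct (HJ' _ Ht) as [d Hd].
      assert (Hm : 0 < Rmin d (t - T)) by (apply Rmin_pos; [apply cond_pos|lra]).
      exists (mkposreal _ Hm). intros z Hz.
      change (Rabs (z - t) < Rmin d (t - T)) in Hz.
      pose proof (Rmin_l d (t - T)). pose proof (Rmin_r d (t - T)).
      right. split; [apply Rabs_lt_between in Hz; lra|]. apply Hd, ball_R.
      replace (z - T - (t - T)) with (z - t) by ring. lra.
  - left. exact J0.
  - intros a b t Ha Hb Ht. destruct (Rlt_dec t T) as [Hlt|Hge].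
    + left. destruct Ha as [Ha|[Ha _]]; [|lra].
      destruct (Rle_dec 0 t) as [H0|H0]; [apply Hend; lra|].
      apply (CJ a 0); [exact Ha|exact J0|lra].
    + right. split; [lra|]. destruct Hb as [Hb|[_ Hb]]; [specialize (HJT _ Hb); lra|].
      apply (CJ' 0 (b - T)); [exact J'0|exact Hb|lra].
Qed.

Lemma interval_end J t1 :
  open_interval_around_0 J -> 0 <= t1 -> ~ J t1 ->
  exists T, 0 < T /\ ~ J T /\ (forall t, J t -> t < T) /\ (forall t, 0 <= t < T -> J t).
Proof.
  intros [HJ [J0 CJ]] Ht1 Hn.
  assert (UB : forall t, J t -> t < t1).
  { intros t Ht. apply Rnot_le_lt. intros Hle. apply Hn. apply (CJ 0 t); auto. }
  destruct (completeness J) as [T [HT1 HT2]].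
  { exists t1. intros t Ht. left. auto. }
  { now exists 0. }
  assert (Hup : forall t, J t -> exists d, 0 < d /\ J (t + d)).
  { intros t Ht. destruct (HJ t Ht) as [d Hd]. pose proof (cond_pos d).
    exists (d / 2). split; [lra|]. apply Hd, ball_R.
    replace (t + d / 2 - t) with (d / 2) by ring. rewrite Rabs_right; lra. }
  assert (Hlt : forall t, J t -> t < T).
  { intros t Ht. destruct (Hup t Ht) as [d [Hd Jd]]. specialize (HT1 _ Jd). lra. }
  exists T. split; [auto|]. split; [|split; [exact Hlt|]].
  - intros HT. specialize (Hlt T HT). lra.
  - intros t Ht. destruct (classic (J t)) as [Hy|Hno]; [exact Hy|exfalso].
    (* otherwise t would be an upper bound of J, which is an interval *)
    assert (T <= t); [|lra]. apply HT2. intros z Hz. apply Rnot_lt_le. intros Hzt.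
    apply Hno. apply (CJ 0 z); [exact J0|exact Hz|lra].
Qed.

Lemma smooth_curve_subset (J J' : R -> Prop) v :
  (forall t, J' t -> J t) -> smooth_curve J v -> smooth_curve J' v.
Proof.
  intros HJ [V [H0 [Hs Hd]]]. exists V. split; [auto|]. split; [auto|].
  intros j t Ht n eps Heps. destruct (Hd j t (HJ t Ht) n eps Heps) as [d [Hd0 Hb]].
  exists d. split; [exact Hd0|]. auto.
Qed.

Theorem theorem1p1 :
  forall s kappa alpha : R,
  3 / 2 < s -> 0 <= kappa ->
  locally_well_posed s kappa alpha ->
  forall u0 rho0 : R -> R, smooth_circle u0 -> smooth_circle rho0 ->
  forall (J : R -> Prop) (u rho : R -> R -> R),
  is_maximal_solution s kappa alpha u0 rho0 J u rho ->
  (forall t, 0 <= t -> J t) /\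
  smooth_curve (fun t => 0 <= t) u /\
  smooth_curve (fun t => 0 <= t) rho.
Proof.
  intros s kappa alpha Hs Hk LWP u0 rho0 Hu0 Hr0 J u rho [Sol Max].
  assert (HJ : forall t, 0 <= t -> J t).
  { intros t1 Ht1. destruct (classic (J t1)) as [Hy|Hno]; [exact Hy|exfalso].
    pose proof (sol_interval _ _ _ _ _ _ _ _ Sol) as HI.
    destruct (interval_end J t1 HI Ht1 Hno) as [T [HT0 [HTn [HJT Hend]]]].
    pose proof (solution_flow _ _ _ _ _ _ _ _ Sol) as F.
    pose proof (proj1 HI) as HO.
    destruct (flow_bounded s kappa alpha J u rho T Hs Hk HO Hend HT0 F) as [Bu Br].
    destruct (bounded_on_rhs _ s kappa alpha u rho Bu Br) as [Bv Bd].
    destruct (curve_limit J u _ T HO HT0 Hend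
      (fun t Ht => proj1 (proj2 (proj2 (F t (Hend t Ht))))) Bu Bv) as [uT Cu].
    destruct (curve_limit J rho _ T HO HT0 Hend
      (fun t Ht => proj2 (proj2 (proj2 (F t (Hend t Ht))))) Br Bd) as [rhoT Cr].
    destruct (LWP uT rhoT (proj1 Cu) (proj1 Cr)) as [J' [u' [rho' [[Sol' _] _]]]].
    pose proof (sol_interval _ _ _ _ _ _ _ _ Sol') as HI'.
    assert (Eu : u' 0 = uT) by (extensionality x; apply (sol_init_u _ _ _ _ _ _ _ _ Sol')).
    assert (Er : rho' 0 = rhoT)
      by (extensionality x; apply (sol_init_rho _ _ _ _ _ _ _ _ Sol')).
    rewrite <- Eu in Cu. rewrite <- Er in Cr.
    apply HTn.
    apply (Max (glue_times J J' T) (glue T u u') (glue T rho rho')).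
    - apply flow_solution.
      + now apply glue_times_interval.
      + intros x. rewrite glue_lt by exact HT0. apply (sol_init_u _ _ _ _ _ _ _ _ Sol).
      + intros x. rewrite glue_lt by exact HT0. apply (sol_init_rho _ _ _ _ _ _ _ _ Sol).
      + apply (flow_glue s kappa alpha J J' T 0); auto.
        * apply HI'.
        * now apply solution_flow with (1 := Sol').
    - intros t Ht. now left.
    - intros t x Ht. now rewrite !glue_lt by auto.
    - right. split; [lra|]. rewrite Rminus_diag. apply HI'. }
  split; [exact HJ|]. split; apply smooth_curve_subset with J; auto; apply Sol.
Qed.
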